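(* Let $(p_k)_{k\ge0}$, $\mathbf f$, $q$, $\mathbf P$, $\beta$, $\gamma$, $(X_n)_{n\ge0}$, $\mathbb P$ and $\Delta_n$ be as in the context. Then: (i) the laws of $(\Delta_n/n^{1/\gamma})_{n\ge1}$ under $\mathbb P$ are tight; (ii) the laws of $(|X_n|/n^{\gamma})_{n\ge1}$ under $\mathbb P$ are tight; (iii) $\displaystyle\lim_{n\to\infty}\frac{\ln|X_n|}{\ln n}=\gamma$, $\mathbb P$-almost surely.
   Context: Let $(p_k)_{k\ge0}$ be a probability distribution on $\{0,1,2,\dots\}$ with generating function $\mathbf f(z)=\sum_k p_kz^k$ such that $p_0>0$, $\mathbf m:=\mathbf f'(1)=\sum_k kp_k\in(1,\infty)$ and $\sum_k k^2p_k<\infty$. Let $q\in(0,1)$ be the extinction probability (the smallest solution of $\mathbf f(q)=q$ in $[0,1]$); then $0<\mathbf f'(q)<1$. Let $\mathbf P$ be the law of a Galton–Watson tree $T$ with offspring distribution $(p_k)$ and root $0$, conditioned on non-extinction. For a vertex $u$, $|u|$ is its graph distance to $0$. Fix $\beta>1/\mathbf f'(q)$ and set $\gamma=-\ln \mathbf f'(q)/\ln\beta\in(0,1)$. Given $T$, $(X_n)_{n\ge0}$ is the Markov chain on the vertices of $T$ with $X_0=0$ which, from a vertex $u\ne0$ with $k$ children and parent $\overleftarrow u$, jumps to $\overleftarrow u$ with probability $1/(1+\beta k)$ and to each child with probability $\beta/(1+\beta k)$, and from $0$ jumps to each child of $0$ with equal probability. $P^\omega$ is its law given $T$ and $\mathbb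 P=\mathbf P\times P^\omega$ is the averaged law (first choose $T$ under $\mathbf P$, then the walk under $P^\omega$). Finally $\Delta_n=\inf\{i\ge0:|X_i|=n\}$ is the hitting time of level $n$. *)

(* Defs.v *)
From HB Require Import structures.
From mathcomp Require Import all_boot all_order all_algebra.
From mathcomp Require Import all_classical all_reals all_analysis.
Set Implicit Arguments. Unset Strict Implicit. Unset Printing Implicit Defensive.
Import Order.TTheory GRing.Theory Num.Theory.
Import numFieldNormedType.Exports.
Local Open Scope classical_set_scope.
Local Open Scope ring_scope.

Section Defs.
Variable R : realType.

Definition gf (p : nat -> R) (z : R) : R := limn (series (fun k => p k * z ^+ k)).
Definition gf' (p : nat -> R) (z : R) : R :=
  limn (series (fun k => k%:R * p k * z ^+ k.-1)).

(** Vertices are Ulam-Harris words (seq nat); the root 0 is [::].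
    A tree is encoded by its offspring function nu : seq nat -> nat (Neveu):
    the vertex set is { u | forall i < |u|, u_i < nu (u_1..u_{i}) }. *)
Definition in_tree (nu : seq nat -> nat) (u : seq nat) : Prop :=
  forall i, (i < size u)%N -> (nth 0%N u i < nu (take i u))%N.

Definition survives (nu : seq nat -> nat) : Prop :=
  forall h : nat, exists u, size u = h /\ in_tree nu u.

Definition parent (u : seq nat) : seq nat := take (size u).-1 u.

Definition is_child (k : nat) (u v : seq nat) : bool :=
  [&& size v == (size u).+1, take (size u) v == u & (last 0%N v < k)%N].

(** one-step transition probability of the biased walk from u (which has k
    children) to v.  From the root: uniform on children (if the root has no
    child, which only happens on extinct trees, the walk stays put). *)
Definition trans (beta : R) (k : nat) (u v : seq nat) : R :=
  if u is [::] then
    (if k == 0%N then (v == u)%:R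
     else if is_child k u v then k%:R^-1 else 0)
  else if v == parent u then (1 + beta * k%:R)^-1
  else if is_child k u v then beta / (1 + beta * k%:R)
  else 0.

Definition cprob d (T : measurableType d) (P : probability T R) (S A : set T) : R :=
  fine (P (A `&` S)) / fine (P S).

(** level n reached within time t, i.e. Delta_n <= t *)
Definition hits_by (X : nat -> seq nat) (n : nat) (t : R) : Prop :=
  exists i : nat, i%:R <= t /\ size (X i) = n.

End Defs.

(* Main.v *)
(** The vertices with infinitely many descendants form the backbone of the tree,
    which is crossed ballistically: a vertex of the backbone has a child on it, and
    the bias [beta > 1] makes the expected number of crossings of each level
    bounded.
    The time is spent in the finite subtrees attached to the backbone.  With
    [r = f'(q)], such a subtree has height at least [h] with probability of order
    [r^h], and a walk that reaches depth [h] needs a time of order [beta^h] to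
    leave it, so the time spent in one trap has tail [t^-gamma].

    Upper bound on the hitting time of level [n]: at most [C n] traps are met on
    average; the probability that one of them is higher than [H] is at most
    [C n r^H], and the expected time spent in the other ones is at most
    [C n (beta r)^H].  Lower bound: the events that level [n] is reached by time
    [t] and that, at its first visit to level [l], the walk falls into a trap of
    height exactly [H] and stays there for [t] steps are disjoint for distinct
    [l < n], and each has conditional probability at least [c r^H] when
    [beta^H >= C t]; hence the probability of reaching level [n] by time [t] is at
    most [C t^gamma / n].  Together with a bound on the backtracking from level
    [4n] to level [n], Borel-Cantelli along [n = 2^k] gives the almost sure limit. *)
Require Import Defs.
From HB Require Import structures.
From mathcomp Require Import all_boot all_order all_algebra.
From mathcomp Require Import all_classical all_reals all_analysis.
From mathcomp Require Import measurable_realfun zify ring lra.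
Set Implicit Arguments. Unset Strict Implicit. Unset Printing Implicit Defensive.
Import Order.TTheory GRing.Theory Num.Theory.
Import numFieldNormedType.Exports.
Local Open Scope classical_set_scope.
Local Open Scope ring_scope.

(** * Generating function and extinction probabilities *)

(** The walk is given only through probabilities of finite path-and-offspring events, and it is
    studied under the unconditioned law, since conditioning on survival would destroy the
    independence of disjoint subtrees. Survival is carried along as an indicator, and its
    probability is divided out when the three assertions are derived. A subtree entered for the
    first time is independent of the past, whether or not it turns out to be infinite; that a
    fraction [1 - q] of such subtrees is infinite links the number of vertices visited to the
    crossings of the backbone. The estimates on the walk itself are made in a fixed tree, through a
    function of the current vertex whose average decreases at each step by the cost of that step.
    They need no assumption on the degrees: a parent of weight [beta] and one child of weight
    [beta^-1], all other children having weight 1, average to exactly 1 whatever the number of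
    children. Moments of the degrees enter when the cost of a freshly entered vertex is averaged
    over its subtree. The second moment controls [gf'] near 1 and near [q], and so gives the lower
    bound of order [r^h] on the tail of the trap heights. *)

Section PowerInequalities.
Context {R : realFieldType}.
Implicit Types a b : R.

(** The tangent bounds for the convex function [z^k], here and in [exprB_le], are summed against [p]
    later on; in this way [gf'] acts as the derivative of [gf] without differentiating a series. *)
Lemma exprB_ge a b k : 0 <= a -> a <= b ->
  k%:R * a ^+ k.-1 * (b - a) <= b ^+ k - a ^+ k.
Proof.
move=> a0 ab; elim: k => [|k IH]; first by rewrite !mul0r !expr0 subrr.
have ak0 : 0 <= a ^+ k by exact: exprn_ge0.
have bk : a ^+ k <= b ^+ k by apply: lerXn2r; rewrite ?nnegrE // (le_trans a0).
have -> : b ^+ k.+1 - a ^+ k.+1 = (b ^+ k - a ^+ k) * b + a ^+ k * (b - a).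
  rewrite !exprSr; ring.
have H : k%:R * a ^+ k * (b - a) <= (b ^+ k - a ^+ k) * b.
  apply: (@le_trans _ _ ((b ^+ k - a ^+ k) * a)); last first.
    by apply: ler_wpM2l => //; rewrite subr_ge0.
  case: k {ak0 bk} IH => [|k] /= IH; first by rewrite !mul0r !expr0 subrr mul0r.
  apply: le_trans (ler_wpM2r a0 IH).
  suff -> : k.+1%:R * a ^+ k.+1 * (b - a) = k.+1%:R * a ^+ k * (b - a) * a by [].
  by rewrite exprSr; ring.
rewrite /= mulrS mulrDl mul1r mulrDl addrC lerD //.
Qed.

Lemma exprB_le a b k : 0 <= a -> a <= b ->
  b ^+ k - a ^+ k <= k%:R * b ^+ k.-1 * (b - a).
Proof.
move=> a0 ab; have b0 : 0 <= b by exact: le_trans ab.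
elim: k => [|k IH]; first by rewrite !mul0r !expr0 subrr.
have bk : a ^+ k <= b ^+ k by apply: lerXn2r; rewrite ?nnegrE.
have -> : b ^+ k.+1 - a ^+ k.+1 = (b ^+ k - a ^+ k) * b + a ^+ k * (b - a).
  rewrite !exprSr; ring.
have H : (b ^+ k - a ^+ k) * b <= k%:R * b ^+ k * (b - a).
  case: k {bk} IH => [|k] /= IH; first by rewrite !mul0r !expr0 subrr mul0r.
  apply: le_trans (ler_wpM2r b0 IH) _.
  suff -> : k.+1%:R * b ^+ k.+1 * (b - a) = k.+1%:R * b ^+ k * (b - a) * b by [].
  by rewrite exprSr; ring.
rewrite -natr1 -mulrA [leRHS]mulrDl mul1r lerD //=; first by rewrite mulrA.
by rewrite ler_wpM2r // subr_ge0.
Qed.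

Lemma dexprB_le a b k : 0 <= a -> a <= b -> b <= 1 ->
  k%:R * b ^+ k.-1 - k%:R * a ^+ k.-1 <= (k ^ 2)%:R * (b - a).
Proof.
move=> a0 ab b1; have b0 : 0 <= b by exact: le_trans ab.
rewrite -mulrBr natrX expr2 -mulrA ler_wpM2l //.
apply: le_trans (exprB_le _ a0 ab) _; rewrite ler_wpM2r ?subr_ge0 //.
apply: (@le_trans _ _ k.-1%:R); last by rewrite ler_nat leq_pred.
by rewrite ler_piMr // exprn_ile1.
Qed.

End PowerInequalities.

(** Probability that a Galton-Watson tree has no vertex at height [h]. *)
Definition extp {R : realType} (p : nat -> R) h := iter h (gf p) 0.

Class supercritical {R : realType} (p : nat -> R) (q : R) : Prop := Supercritical {
  offspring_ge0 : forall k, 0 <= p k;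
  offspring_sum : series p @ \oo --> (1 : R);
  offspring0_gt0 : 0 < p 0%N;
  offspring_cvg_mean : cvg (series (fun k => k%:R * p k) @ \oo);
  offspring_mean_gt1 : 1 < limn (series (fun k => k%:R * p k));
  offspring_cvg_sqr : cvg (series (fun k => (k ^ 2)%:R * p k) @ \oo);
  extinction01 : 0 <= q <= 1;
  extinction_fix : gf p q = q;
  extinction_min : forall s, 0 <= s <= 1 -> gf p s = s -> q <= s }.

Section GeneratingFunction.
Context {R : realType} {p : nat -> R} {q : R} {S : supercritical p q}.
Let p_ge0 : forall k, 0 <= p k := offspring_ge0.
Let p_sum : series p @ \oo --> (1 : R) := offspring_sum.
Let p0_gt0 : 0 < p 0%N := offspring0_gt0.
Let cvg_m1 : cvgn (series (fun k => k%:R * p k)) := offspring_cvg_mean.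
Local Notation m1 := (limn (series (fun k => k%:R * p k))).
Let m1_gt1 : 1 < m1 := offspring_mean_gt1.
Let cvg_m2 : cvgn (series (fun k => (k ^ 2)%:R * p k)) := offspring_cvg_sqr.
Local Notation m2 := (limn (series (fun k => (k ^ 2)%:R * p k))).
Let q01 : 0 <= q <= 1 := extinction01.
Let gfq : gf p q = q := extinction_fix.
Let q_min : forall s, 0 <= s <= 1 -> gf p s = s -> q <= s := extinction_min.

Let cvg_p : cvgn (series p). Proof. by apply/cvg_ex; exists 1. Qed.

Lemma lim_series_lin_ge (a b c : R ^nat) x :
  cvgn (series a) -> cvgn (series b) -> cvgn (series c) ->
  (forall k, a k * x <= b k - c k) ->
  limn (series a) * x <= limn (series b) - limn (series c).
Proof.
move=> ca cb cc H.
have e : (fun k => a k * x) = x *: a by apply/funext => k /=; rewrite mulrC.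
have cxa : cvgn (series (x *: a)) by exact: is_cvg_seriesZ.
rewrite mulrC -[x * _]/(x *: _) -lim_seriesZ // -lim_seriesB //.
apply: lim_series_le => //; first exact: is_cvg_seriesB.
by move=> k; change (x * a k <= b k - c k); rewrite mulrC; exact: H.
Qed.

Lemma lim_series_lin_le (a b c : R ^nat) x :
  cvgn (series a) -> cvgn (series b) -> cvgn (series c) ->
  (forall k, b k - c k <= a k * x) ->
  limn (series b) - limn (series c) <= limn (series a) * x.
Proof.
move=> ca cb cc H.
rewrite -lerN2 opprB -mulrN; apply: lim_series_lin_ge => // k.
by rewrite mulrN -(opprB (b k)) lerN2 H.
Qed.

Lemma is_cvg_gf z : 0 <= z <= 1 -> cvgn (series (fun k => p k * z ^+ k)).
Proof.
move=> /andP[z0 z1]; apply: (series_le_cvg _ p_ge0 _ cvg_p) => k.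
  by rewrite mulr_ge0 // exprn_ge0.
by rewrite ler_piMr // exprn_ile1.
Qed.

Lemma is_cvg_gf' z : 0 <= z <= 1 ->
  cvgn (series (fun k => k%:R * p k * z ^+ k.-1)).
Proof.
move=> /andP[z0 z1]; apply: (series_le_cvg _ _ _ cvg_m1) => k.
- by rewrite !mulr_ge0 // exprn_ge0.
- by rewrite mulr_ge0.
- by rewrite ler_piMr ?mulr_ge0 // exprn_ile1.
Qed.

Lemma gf1 : gf p 1 = 1.
Proof.
rewrite /gf; under eq_fun do rewrite expr1n mulr1.
by apply/cvg_lim => //; exact: p_sum.
Qed.

Lemma gf'1 : gf' p 1 = m1.
Proof. by rewrite /gf'; under eq_fun do rewrite expr1n mulr1. Qed.

Lemma gf0 : gf p 0 = p 0%N.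
Proof.
rewrite /gf; apply/cvg_lim => //.
apply: cvg_near_cst; exists 1%N => // n /=; case: n => // n _.
rewrite seriesEnat /= big_nat_recl //= expr0 mulr1 big1 ?addr0 // => i _.
by rewrite expr0n mulr0.
Qed.

Lemma gf_ge a b : 0 <= a -> a <= b -> b <= 1 ->
  gf' p a * (b - a) <= gf p b - gf p a.
Proof.
move=> a0 ab b1.
have A : 0 <= a <= 1 by rewrite a0 (le_trans ab).
have B : 0 <= b <= 1 by rewrite b1 (le_trans a0).
apply: (lim_series_lin_ge (is_cvg_gf' A) (is_cvg_gf B) (is_cvg_gf A)) => k.
by rewrite -mulrBr [_ * p k]mulrC -!mulrA ler_wpM2l // mulrA exprB_ge.
Qed.

Lemma gf_le a b : 0 <= a -> a <= b -> b <= 1 ->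
  gf p b - gf p a <= gf' p b * (b - a).
Proof.
move=> a0 ab b1.
have A : 0 <= a <= 1 by rewrite a0 (le_trans ab).
have B : 0 <= b <= 1 by rewrite b1 (le_trans a0).
apply: (lim_series_lin_le (is_cvg_gf' B) (is_cvg_gf B) (is_cvg_gf A)) => k.
by rewrite -mulrBr [_ * p k]mulrC -!mulrA ler_wpM2l // mulrA exprB_le.
Qed.

Lemma gf'_lipschitz a b : 0 <= a -> a <= b -> b <= 1 ->
  gf' p b - gf' p a <= m2 * (b - a).
Proof.
move=> a0 ab b1.
have A : 0 <= a <= 1 by rewrite a0 (le_trans ab).
have B : 0 <= b <= 1 by rewrite b1 (le_trans a0).
apply: (lim_series_lin_le cvg_m2 (is_cvg_gf' B) (is_cvg_gf' A)) => k.
rewrite (mulrC k%:R) [_%:R * p k]mulrC -!mulrA -!mulrBr ler_wpM2l //.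
rewrite mulrBr; exact: dexprB_le.
Qed.

Lemma gf'_ge0 z : 0 <= z <= 1 -> 0 <= gf' p z.
Proof.
move=> z01; apply: limr_ge; first exact: is_cvg_gf'.
apply: nearW => n; apply: sumr_ge0 => k _; case/andP: z01 => z0 _.
by rewrite !mulr_ge0 // exprn_ge0.
Qed.

Lemma gf'_le a b : 0 <= a -> a <= b -> b <= 1 -> gf' p a <= gf' p b.
Proof.
move=> a0 ab b1.
have A : 0 <= a <= 1 by rewrite a0 (le_trans ab).
have B : 0 <= b <= 1 by rewrite b1 (le_trans a0).
apply: lim_series_le (is_cvg_gf' A) (is_cvg_gf' B) _ => k.
by rewrite ler_wpM2l ?mulr_ge0 // lerXn2r ?nnegrE // (le_trans a0).
Qed.

Lemma gf'_le_mean z : 0 <= z <= 1 -> gf' p z <= m1.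
Proof. by case/andP=> z0 z1; rewrite -gf'1 gf'_le. Qed.

Lemma gf_homo a b : 0 <= a -> a <= b -> b <= 1 -> gf p a <= gf p b.
Proof.
move=> a0 ab b1; rewrite -subr_ge0; apply: le_trans (gf_ge a0 ab b1).
by rewrite mulr_ge0 ?subr_ge0 // gf'_ge0 // a0 (le_trans ab).
Qed.

Lemma gf_ge0 z : 0 <= z <= 1 -> 0 < gf p z.
Proof.
case/andP=> z0 z1; apply: lt_le_trans p0_gt0 _.
by rewrite -gf0; exact: gf_homo.
Qed.

Lemma mean_le_m2 : m1 <= m2.
Proof.
apply: lim_series_le => // k; rewrite ler_wpM2r // ler_nat.
by case: k => // k; rewrite leq_pmull.
Qed.

Let m2_gt0 : 0 < m2.
Proof. by apply: lt_le_trans mean_le_m2; exact: lt_trans m1_gt1. Qed.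

Lemma gf_lt_id : exists2 s, 0 < s < 1 & gf p s < s.
Proof.
have m2m1 := mean_le_m2.
(* From 1 down to this point the Lipschitz bound lets [gf'] drop by at most half of [m1 - 1]. Hence
   [gf' p s > 1], and convexity puts the graph strictly below the diagonal at [s]. *)
pose s := 1 - (m1 - 1) / (2 * m2).
have h0 : 0 < (m1 - 1) / (2 * m2) by rewrite divr_gt0 ?subr_gt0 // mulr_gt0.
have h1 : (m1 - 1) / (2 * m2) < 1.
  rewrite ltr_pdivrMr ?mulr_gt0 // mul1r.
  by move: m2m1 m1_gt1 m2_gt0; move: m1 m2 => M1 M2; lra.
have s0 : 0 < s by rewrite /s; lra.
have s1 : s < 1 by rewrite /s; lra.
exists s; first by rewrite s0.
have L := gf'_lipschitz (ltW s0) (ltW s1) (lexx 1).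
have G := gf_ge (ltW s0) (ltW s1) (lexx 1).
rewrite gf'1 gf1 in L G.
have e : m2 * (1 - s) = (m1 - 1) / 2.
  rewrite /s; field; by rewrite gt_eqF.
rewrite e in L.
have K : 1 < gf' p s by move: L m1_gt1; move: m1 (gf' p s) => M1 G1; lra.
have : 1 - s < gf' p s * (1 - s) by rewrite ltr_pMl ?subr_gt0.
move: G; move: (_ * _) (gf p s) => G1 G2.
lra.
Qed.


(** Stated for supersolutions, so that it serves both for [q] and for the point of [gf_lt_id], which
    it thereby places above [q]. *)
Lemma extp_ge0_le_fix s h : 0 <= s <= 1 -> gf p s <= s -> 0 <= extp p h <= s.
Proof.
move=> /andP[s0 s1] fs; elim: h => [|h /andP[h0 hs]] /=; first by rewrite lexx.
rewrite ltW ?gf_ge0 ?h0 ?(le_trans hs) //=; apply: le_trans fs.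
exact: gf_homo.
Qed.

Lemma extp_bounds h : 0 <= extp p h <= q.
Proof. by apply: extp_ge0_le_fix => //; rewrite gfq. Qed.

Let extp01 h : 0 <= extp p h <= 1.
Proof.
case/andP: (extp_bounds h) => -> /le_trans; apply.
by case/andP: q01.
Qed.

Lemma extp_nondecreasing : {homo extp p : m n / (m <= n)%N >-> m <= n}.
Proof.
apply: (homo_leq (@lexx _ _) (@le_trans _ _)).
elim=> [|h IH]; first by case/andP: (extp01 1).
rewrite /extp !iterS; apply: gf_homo => //.
  by case/andP: (extp01 h).
by case/andP: (extp01 h.+1).
Qed.

Lemma cvg_extp : extp p @ \oo --> q.
Proof.
have cv : cvgn (extp p).
  apply: nondecreasing_is_cvgn; first exact: extp_nondecreasing.
  by exists q => _ [h _ <-]; case/andP: (extp_bounds h).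
pose L := limn (extp p).
have Lle : forall h, extp p h <= L.
  by move=> h; apply: nondecreasing_cvgn_le => //; exact: extp_nondecreasing.
have L0 : 0 <= L by apply: le_trans (Lle 0%N).
have Lq : L <= q.
  by apply: limr_le => //; apply: nearW => h; case/andP: (extp_bounds h).
have q1 : q <= 1 by case/andP: q01.
have L1 : L <= 1 by exact: le_trans q1.
suff fL : gf p L = L.
  by rewrite (_ : q = L) //; apply/eqP; rewrite eq_le Lq q_min ?L0.
apply/eqP; rewrite eq_le; apply/andP; split; last first.
  apply: limr_le => //; apply: nearW => -[|h]; first by rewrite ltW ?gf_ge0 ?L0.
  by rewrite /= gf_homo //; case/andP: (extp01 h).
(* The mean-value bound with slope [m1] replaces the continuity of [gf] at [L]: the last term tends
   to 0. *)
have H h : gf p L <= L + m1 * (L - extp p h).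
  case/andP: (extp01 h) => h0 h1.
  have A := gf_le h0 (Lle h) L1.
  have B : gf' p L * (L - extp p h) <= m1 * (L - extp p h).
    by rewrite ler_wpM2r ?subr_ge0 // gf'_le_mean // L0.
  have C : gf p (extp p h) <= L := Lle h.+1.
  lra.
have cvH : (fun h => L + m1 * (L - extp p h)) @ \oo --> L + m1 * (L - L).
  apply: cvgD; first exact: cvg_cst.
  apply: cvgMr; apply: cvgB => //; exact: cvg_cst.
rewrite subrr mulr0 addr0 in cvH.
rewrite -[leRHS](cvg_lim _ cvH) //; apply: limr_ge; first by apply/cvg_ex; exists L.
by apply: nearW => h; exact: H.
Qed.

Lemma q_gt0 : 0 < q.
Proof. by rewrite -gfq gf_ge0. Qed.

Let gf_lt_id_q : exists2 s, q < s < 1 & gf p s < s.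
Proof.
have [s /andP[s0 s1] fs] := gf_lt_id; exists s => //.
rewrite s1 andbT lt_neqAle; apply/andP; split.
  by apply: contraTneq fs => <-; rewrite gfq ltxx.
rewrite -(cvg_lim _ cvg_extp) //; apply: limr_le.
  by apply/cvg_ex; exists q; exact: cvg_extp.
apply: nearW => h.
by have /andP[] := @extp_ge0_le_fix s h (introT andP (conj (ltW s0) (ltW s1))) (ltW fs).
Qed.

Lemma q_lt1 : q < 1.
Proof. by have [s /andP[qs s1] _] := gf_lt_id_q; exact: lt_trans s1. Qed.

(** The tangent at [q] lies below the graph, which passes strictly below the diagonal at some
    [s > q]. *)
Lemma gf'q_lt1 : gf' p q < 1.
Proof.
have [s /andP[qs s1] fs] := gf_lt_id_q.
have := gf_ge (ltW q_gt0) (ltW qs) (ltW s1); rewrite gfq => H.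
have : gf' p q * (s - q) < 1 * (s - q) by rewrite mul1r; lra.
by rewrite ltr_pM2r // subr_gt0.
Qed.

Lemma offspring_pos : exists2 k, (0 < k)%N & 0 < p k.
Proof.
apply: contrapT => H; suff m0 : m1 = 0 by move: m1_gt1; rewrite m0 ltr10.
have -> : (fun k => k%:R * p k) = (fun=> 0).
  apply/funext => -[|k]; first by rewrite mul0r.
  suff -> : p k.+1 = 0 by rewrite mulr0.
  apply/eqP; rewrite eq_le p_ge0 andbT leNgt.
  by apply/negP => pk; apply: H; exists k.+1.
apply/cvg_lim => //.
suff -> : series (fun=> 0 : R) = fun=> 0 by exact: cvg_cst.
by apply/funext => n; rewrite /series /= big1.
Qed.

Lemma gf'q_gt0 : 0 < gf' p q.
Proof.
have [k k0 pk] := offspring_pos.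
have q0 := q_gt0.
set a := fun k => k%:R * p k * q ^+ k.-1.
have a0 j : 0 <= a j by rewrite !mulr_ge0 // exprn_ge0 // ltW.
have ak : 0 < a k by rewrite !mulr_gt0 ?ltr0n // exprn_gt0.
apply: (@lt_le_trans _ _ (series a k.+1)).
  by rewrite seriesSr ltr_wpDl // sumr_ge0.
apply: nondecreasing_cvgn_le; last exact: is_cvg_gf'.
exact: nondecreasing_series.
Qed.

Local Notation r := (gf' p q).

(** On [[0, q]] the slope of [gf] is at most its slope [r] at [q], so each generation multiplies the
    gap by at most [r]. *)
Lemma extp_gap_le h : q - extp p h <= r ^+ h.
Proof.
elim: h => [|h IH]; first by rewrite /= subr0 expr0; case/andP: q01.
have /andP[h0 hq] := extp_bounds h.
have q1 := ltW q_lt1.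
have := gf_le h0 hq q1; rewrite gfq => H.
by rewrite exprS; apply: le_trans H _; rewrite ler_wpM2l // ltW // gf'q_gt0.
Qed.

(** [c r^h (1 + K c r^h)] is a subsolution of the recursion satisfied by
    [q - extp p h], which is only quadratically perturbed from [e |-> r e]. *)
Lemma extp_gap_ge : exists2 c, 0 < c & forall h, c * r ^+ h <= q - extp p h.
Proof.
have r0 := gf'q_gt0; have r1 := gf'q_lt1; have q0 := q_gt0; have q1 := ltW q_lt1.
(* With [x = c r^h], the correction gains [K r (1 - r) x^2] in one generation and the quadratic
   error is [m2 x^2 (1 + K x)^2]. As [K x <= 1], the gain has to be [4 m2 x^2]. *)
pose K := 4 * m2 / (r * (1 - r)).
have rr : 0 < r * (1 - r) by rewrite mulr_gt0 // subr_gt0.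
have K0 : 0 < K by rewrite divr_gt0 // mulr_gt0.
(* The first bound ensures [K x <= 1] at every height; with it, the second one gives the base case
   [c (1 + K c) <= 2 c <= q]. *)
pose c := Num.min K^-1 (q / 2).
have c0 : 0 < c by rewrite lt_min invr_gt0 K0 divr_gt0.
have Kc : K * c <= 1 by rewrite mulrC -ler_pdivlMr // div1r ge_min lexx.
have cq : 2 * c <= q by rewrite mulrC -ler_pdivlMr // ge_min lexx orbT.
pose y h := c * r ^+ h * (1 + K * (c * r ^+ h)).
have rh0 h : 0 < r ^+ h by exact: exprn_gt0.
have rh1 h : r ^+ h <= 1 by rewrite exprn_ile1 // ltW.
suff Y h : y h <= q - extp p h.
  exists c => // h; apply: le_trans (Y h).
  have x0 : 0 < c * r ^+ h by rewrite mulr_gt0.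
  by rewrite ler_peMr ?(ltW x0) // lerDl mulr_ge0 // ltW.
elim: h => [|h IH].
  rewrite /y /= expr0 mulr1 subr0; apply: le_trans cq.
  by have := ler_wpM2l (ltW c0) Kc; rewrite mulr1 mulrDr mulr1; move: (c * (K * c)) => z; lra.
have /andP[h0 hq] := extp_bounds h.
have x0 : 0 < c * r ^+ h by rewrite mulr_gt0.
have Kx : K * (c * r ^+ h) <= 1.
  by apply: le_trans Kc; apply: (ler_wpM2l (ltW K0)); rewrite ler_piMr ?(ltW c0).
set x := c * r ^+ h in x0 Kx.
have ye : y h = x * (1 + K * x) by [].
have z0 : 0 <= 1 + K * x by rewrite addr_ge0 // mulr_ge0 // ltW.
have y0 : 0 <= y h by rewrite ye mulr_ge0 // ltW.
have hyq : extp p h <= q - y h by rewrite lerBrDr addrC -lerBrDr.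
have yq : 0 <= q - y h by exact: le_trans hyq.
have qy : q - y h <= q by rewrite gerBl.
have A := gf_homo h0 hyq (le_trans qy q1).
have B := gf_ge yq qy q1.
have C := gf'_lipschitz yq qy q1.
rewrite subKr in B C; rewrite gfq in B.
have D : r * y h - m2 * y h ^+ 2 <= gf' p (q - y h) * y h.
  have -> : r * y h - m2 * y h ^+ 2 = (r - m2 * y h) * y h.
    by move: (y h) => u; ring.
  by apply: (ler_wpM2r y0); rewrite lerBlDl -lerBlDr.
suff E : y h.+1 <= r * y h - m2 * y h ^+ 2 by apply: (le_trans E); apply: (le_trans D); apply: (le_trans B); rewrite lerB.
have -> : y h.+1 = r * x * (1 + K * (r * x)).
  by rewrite /y /x exprS; ring.
rewrite ye -subr_ge0.
have -> : r * (x * (1 + K * x)) - m2 * (x * (1 + K * x)) ^+ 2 -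
    r * x * (1 + K * (r * x)) = x ^+ 2 * (4 * m2 - m2 * (1 + K * x) ^+ 2).
  have e : K * (r * (1 - r)) = 4 * m2 by rewrite /K divfK // gt_eqF.
  by rewrite -e; ring.
apply: mulr_ge0; first exact: sqr_ge0.
rewrite subr_ge0 [leRHS]mulrC; apply: (ler_wpM2l (ltW m2_gt0)).
have -> : 4 = 2 ^+ 2 :> R by ring.
apply: lerXn2r; rewrite ?nnegrE //.
by move: Kx; move: (K * x) => a; lra.
Qed.

(** One generation multiplies the gap to [q] by at most [r], so the increment is at least a fraction
    [1 - r] of the gap. The increment is the probability that the tree has height exactly [h]. *)
Lemma extp_step_ge : exists2 c, 0 < c & forall h, c * r ^+ h <= extp p h.+1 - extp p h.
Proof.
have [c c0 H] := extp_gap_ge; have r1 := gf'q_lt1.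
exists (c * (1 - r)) => [|h]; first by rewrite mulr_gt0 // subr_gt0.
have /andP[h0 hq] := extp_bounds h.
have := gf_le h0 hq (ltW q_lt1); rewrite gfq => A.
have : (c * r ^+ h) * (1 - r) <= (q - extp p h) * (1 - r).
  by rewrite ler_wpM2r // subr_ge0 ltW.
rewrite /=; lra.
Qed.

End GeneratingFunction.

(** * Integrals over countable partitions and image measures *)

Section CountableDecomposition.
Context d (X : measurableType d) (R : realType) (mu : {measure set X -> \bar R}).
Context (T : countType).

Lemma bigcup_count_measurable d' (Y : measurableType d') (A : T -> set Y) :
  (forall t, measurable (A t)) -> measurable (\bigcup_t A t).
Proof.
move=> mA.
have -> : \bigcup_t A t = \bigcup_n (if unpickle n is Some t then A t else set0).
  apply/seteqP; split => [x [t _ At]|x [n _]].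
    by exists (pickle t) => //; rewrite pickleK.
  by case: unpickle => // t At; exists t.
by apply: bigcupT_measurable => n; case: unpickle.
Qed.

Lemma measurable_count_set d' (Y : measurableType d') (phi : Y -> T)
    (b : T -> set Y) :
  (forall t, measurable [set w | phi w = t]) -> (forall t, measurable (b t)) ->
  measurable [set w | b (phi w) w].
Proof.
move=> mphi mb.
rewrite (_ : [set _ | _] = \bigcup_t ([set w | phi w = t] `&` b t)).
  by apply: bigcup_count_measurable => t; exact: measurableI.
by apply/seteqP; split => [w bw|w [t _ [<-]]] //=; exists (phi w).
Qed.

Lemma measurable_fun_count d' d'' (Y : measurableType d') (Z : measurableType d'')
    (phi : Y -> T) (f : T -> Y -> Z) :
  (forall t, measurable [set w | phi w = t]) ->
  (forall t, measurable_fun setT (f t)) ->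
  measurable_fun setT (fun w => f (phi w) w).
Proof.
move=> mphi mf _ B mB; rewrite setTI.
apply: (@measurable_count_set _ _ phi (fun t => f t @^-1` B)) => // t.
by rewrite -[_ @^-1` _]setTI; exact: mf.
Qed.

(** Takes the place of conditional expectations: the past of the walk has countably many values, so
    two integrals may be compared on each atom separately. *)
Lemma le_integral_atoms (phi : X -> T) (f g : X -> \bar R) :
  (forall t, measurable [set w | phi w = t]) ->
  measurable_fun setT f -> measurable_fun setT g ->
  (forall x, 0 <= f x)%E -> (forall x, 0 <= g x)%E ->
  (forall t, \int[mu]_(x in [set w | phi w = t]) f x <=
             \int[mu]_(x in [set w | phi w = t]) g x)%E ->
  (\int[mu]_x f x <= \int[mu]_x g x)%E.
Proof.
move=> mphi mf mg f0 g0 H.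
pose F n := [set w | pickle (phi w) = n].
have FE n : F n = set0 \/ exists t, F n = [set w | phi w = t].
  have [[w Fw]|nF] := pselect (F n !=set0); [right; exists (phi w)|left].
    apply/seteqP; split => v; last by rewrite /F /= => ->.
    by rewrite /F /= => vn; apply: (pcan_inj pickleK); rewrite vn.
  by apply/eqP; rewrite -[_ == _]negbK; apply/negP => /set0P.
have mF n : measurable (F n) by case: (FE n) => [->|[t ->]].
have tF : trivIset setT F.
  by apply/trivIsetP => i j _ _ ij; apply/seteqP; split => // w [wi wj];
     move: ij; rewrite -wi -wj eqxx.
have UF : \bigcup_n F n = setT.
  by apply/seteqP; split => // w _; exists (pickle (phi w)).
rewrite -UF !ge0_integral_bigcup // ?UF //.
apply: lee_nneseries => n _.
  by move=> _; apply: integral_ge0.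
by case: (FE n) => [->|[t ->]] //; rewrite !integral_set0.
Qed.

Lemma eq_integral_atoms (phi : X -> T) (f g : X -> \bar R) :
  (forall t, measurable [set w | phi w = t]) ->
  measurable_fun setT f -> measurable_fun setT g ->
  (forall x, 0 <= f x)%E -> (forall x, 0 <= g x)%E ->
  (forall t, \int[mu]_(x in [set w | phi w = t]) f x =
             \int[mu]_(x in [set w | phi w = t]) g x)%E ->
  (\int[mu]_x f x = \int[mu]_x g x)%E.
Proof.
move=> mphi mf mg f0 g0 H; apply/eqP; rewrite eq_le.
by apply/andP; split; apply: (le_integral_atoms mphi) => // t; rewrite H.
Qed.

End CountableDecomposition.

Section ImageLaw.
Context d d' (X : measurableType d) (Y : measurableType d') (R : realType).
Implicit Types (mu : {measure set X -> \bar R}).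

Lemma integral_mrestr mu (D : set X) (mD : measurable D) (f : X -> \bar R) :
  measurable_fun setT f -> (forall x, 0 <= f x)%E ->
  (\int[mrestr mu mD]_x f x = \int[mu]_(x in D) f x)%E.
Proof.
move=> mf f0; rewrite -(setUv D) (ge0_integral_setU _ mD (measurableC mD)) //; last 2 first.
- by rewrite setUv.
- by rewrite disj_set2E setICr.
rewrite [X in (_ + X)%E](_ : _ = 0%E) ?adde0.
  apply: eq_measure_integral => A mA AD; rewrite /= /mrestr.
  by rewrite setIidl.
rewrite -[RHS](integral_measure_zero (~` D) f).
apply: eq_measure_integral => A mA AD; rewrite /= /mrestr /mzero.
rewrite (_ : A `&` D = set0) ?measure0 //.
by apply/seteqP; split => // x [/AD].
Qed.

Lemma integral_comp_restr mu (D : set X) (mD : measurable D) (phi : X -> Y)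
    (g : Y -> \bar R) :
  measurable_fun setT phi -> measurable_fun setT g -> (forall y, 0 <= g y)%E ->
  (\int[mu]_(x in D) g (phi x) = \int[pushforward (mrestr mu mD) phi]_y g y)%E.
Proof.
move=> mphi mg g0; rewrite (ge0_integral_pushforward mphi) //.
rewrite preimage_setT integral_mrestr //.
exact: measurableT_comp.
by move=> x; exact: g0.
Qed.

(** Turns an identity between probabilities into one between integrals. The factor [c] will be a
    transition probability for the Markov property, and the probability of a past event for
    independence. *)
Lemma integral_law_scale mu (D1 D2 : set X) (phi1 phi2 : X -> Y) (c : R)
    (g : Y -> \bar R) :
  measurable D1 -> measurable D2 -> 0 <= c ->
  measurable_fun setT phi1 -> measurable_fun setT phi2 ->
  (forall A, measurable A ->
     mu (phi1 @^-1` A `&` D1) = (c%:E * mu (phi2 @^-1` A `&` D2))%E) ->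
  measurable_fun setT g -> (forall y, 0 <= g y)%E ->
  (\int[mu]_(x in D1) g (phi1 x) = c%:E * \int[mu]_(x in D2) g (phi2 x))%E.
Proof.
move=> mD1 mD2 c0 m1 m2 H mg g0.
rewrite (integral_comp_restr mu mD1) // (integral_comp_restr mu mD2) //.
pose k := NngNum c0.
rewrite -(@ge0_integral_mscale _ _ _ (pushforward (mrestr mu mD2) phi2) setT measurableT k g) //.
by apply: eq_measure_integral => A mA _; exact: H.
Qed.

End ImageLaw.

(** * Environments and the law of the walk *)

Definition word := seq nat.

Definition cyl (s : seq word) (k : word -> nat) : set (word -> nat) :=
  [set om | forall u, u \in s -> om u = k u].

(** The empty set is adjoined because two cylinders that disagree on a common word do not meet; the
    family is then a pi-system. Lists are duplicate-free because the probability of a cylinder is a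
    product over its list. *)
Definition cyls : set (set (word -> nat)) :=
  [set A | A = set0 \/ exists s k, uniq s /\ A = cyl s k].

Local Notation env := (g_sigma_algebraType cyls).

Definition glue (s : seq word) (k k' : word -> nat) : word -> nat :=
  fun u => if u \in s then k u else k' u.

Lemma cylI s k s' k' : (forall u, u \in s -> u \in s' -> k u = k' u) ->
  cyl s k `&` cyl s' k' = cyl (undup (s ++ s')) (glue s k k').
Proof.
move=> kk; apply/seteqP; split => [om [h h'] u|om h].
  rewrite mem_undup mem_cat /glue => /orP[us|us']; first by rewrite us h.
  by case: ifP => us; [rewrite h|rewrite h'].
split => u us; (rewrite h ?mem_undup ?mem_cat ?us ?orbT // /glue); rewrite ?us //.
by case: ifP => // us'; rewrite kk.
Qed.

Lemma cylI0 s k s' k' u : u \in s -> u \in s' -> k u <> k' u ->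
  cyl s k `&` cyl s' k' = set0.
Proof.
by move=> us us' ku; apply/seteqP; split => // om [h h']; case: ku; rewrite -h // -h'.
Qed.

Lemma cyl_compat_dec (s s' : seq word) (k k' : word -> nat) :
  (forall u, u \in s -> u \in s' -> k u = k' u) \/
  (exists u, [/\ u \in s, u \in s' & k u <> k' u]).
Proof.
have [H|H] := pselect (forall u, u \in s -> u \in s' -> k u = k' u); first by left.
right; apply: contrapT => N; apply: H => u us us'.
by apply: contrapT => ku; apply: N; exists u.
Qed.

Lemma setI_closed_cyls : setI_closed cyls.
Proof.
move=> A B [->|[s [k [us ->]]]]; first by rewrite set0I; left.
case=> [->|[s' [k' [us' ->]]]]; first by rewrite setI0; left.
have [kk|[u [h1 h2 h3]]] := cyl_compat_dec s s' k k'; last by rewrite (cylI0 h1 h2 h3); left.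
by right; rewrite cylI //; exists (undup (s ++ s')), (glue s k k'); rewrite undup_uniq.
Qed.

Lemma measurable_cyl s k : measurable (cyl s k : set env).
Proof.
rewrite (_ : cyl s k = cyl (undup s) k).
  by apply: sub_sigma_algebra; right; exists (undup s), k; rewrite undup_uniq.
by apply/seteqP; split => om h u us; apply: h; move: us; rewrite mem_undup.
Qed.

Lemma measurable_coord u n : measurable [set om : env | om u = n].
Proof.
rewrite (_ : [set _ | _] = cyl [:: u] (fun=> n)); first exact: measurable_cyl.
apply/seteqP; split => om h; last by apply: h; rewrite inE.
by move=> v; rewrite inE => /eqP ->.
Qed.

(** Offspring numbers outside [B] are erased: [g (restr B om) = g om] says that
    [g] depends only on the coordinates in [B]. *)
Definition restr (B : pred word) (om : word -> nat) : word -> nat :=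
  fun u => if B u then om u else 0%N.

Section EnvironmentMaps.
Context d (X : measurableType d).

Lemma measurable_to_env (f : X -> env) :
  (forall u n, measurable [set x | f x u = n]) -> measurable_fun setT f.
Proof.
move=> mf; apply: (@measurability _ _ _ _ _ f cyls) => // _ [_ [->|[s [k [_ ->]]]] <-].
  by rewrite preimage_set0 setI0.
rewrite setTI.
rewrite (_ : _ @^-1` _ = \bigcap_(u in [set` s]) [set x | f x u = k u]).
  by apply: fin_bigcap_measurable => //; exact: finite_set_seq.
by apply/seteqP; split => x h u us; apply: h.
Qed.

End EnvironmentMaps.

Lemma measurable_restr B : measurable_fun setT (restr B : env -> env).
Proof.
apply: measurable_to_env => u n; rewrite /restr.
case: (B u) => /=; first exact: measurable_coord.
have [->|n0] := eqVneq n 0%N.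
  by rewrite (_ : [set _ | _] = setT) //; apply/seteqP; split.
rewrite (_ : [set _ | _] = set0) //; apply/seteqP; split => // om /= e.
by move: n0; rewrite -e eqxx.
Qed.

Lemma preimage_restr_cyl B s k :
  restr B @^-1` cyl s k = cyl [seq u <- s | B u] k \/ restr B @^-1` cyl s k = set0.
Proof.
have [H|H] := pselect (forall u, u \in s -> ~~ B u -> k u = 0%N); [left|right].
  apply/seteqP; split => om h u.
    by rewrite mem_filter => /andP[Bu us]; rewrite -(h u us) /restr Bu.
  move=> us; rewrite /restr; case: ifPn => Bu; last by rewrite H.
  by apply: h; rewrite mem_filter Bu.
apply/seteqP; split => // om h; apply: H => u us Bu.
by rewrite -(h u us) /restr (negbTE Bu).
Qed.

Lemma eq_env_measure (R : realType) (m1 m2 : {measure set env -> \bar R}) :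
  (m1 setT < +oo)%E ->
  (forall s k, uniq s -> m1 (cyl s k) = m2 (cyl s k)) ->
  forall A, measurable A -> m1 A = m2 A.
Proof.
move=> fin H A mA; apply: (@measure_unique _ R env cyls (fun=> setT) erefl _ _ _ m1 m2) => //.
- exact: setI_closed_cyls.
- by move=> _; right; exists [::], (fun=> 0%N); split => //; apply/seteqP; split.
- by rewrite bigcup_const //; exists 0%N.
- by move=> {mA}A [->|[s [k [us ->]]]]; rewrite ?measure0 // H.
Qed.

(** By the pi-system property, the explicit probabilities of cylinders joined with a path event
    suffice to compare environment laws restricted to such events. *)
Lemma eq_law_scale (R : realType) d (Omega : measurableType d) (P : probability Omega R)
    (phi1 phi2 : Omega -> env) (D1 D2 : set Omega) (c : R) :
  measurable_fun setT phi1 -> measurable_fun setT phi2 ->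
  measurable D1 -> measurable D2 -> 0 <= c ->
  (forall s k, uniq s ->
     P (phi1 @^-1` cyl s k `&` D1) = (c%:E * P (phi2 @^-1` cyl s k `&` D2))%E) ->
  forall A, measurable A -> P (phi1 @^-1` A `&` D1) = (c%:E * P (phi2 @^-1` A `&` D2))%E.
Proof.
move=> m1 m2 mD1 mD2 c0 H A mA; pose k := NngNum c0.
apply: (@eq_env_measure R
  (measure_function_pushforward__canonical__measure_function_Measure (mrestr P mD1) m1)
  (mscale k (measure_function_pushforward__canonical__measure_function_Measure (mrestr P mD2) m2))).
- rewrite /= /pushforward /mrestr /= preimage_setT setTI.
  by rewrite (le_lt_trans (probability_le1 _ mD1)) ?ltry.
- by move=> s l us; exact: H.
- exact: mA.
Qed.

Class galton_watson_walk {R : realType} (p : nat -> R) (q beta : R)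
    {d : measure_display} {Omega : measurableType d} (P : probability Omega R)
    (nu : Omega -> word -> nat) (X : Omega -> nat -> word) : Prop :=
  GaltonWatsonWalk {
  walk_supercritical :: supercritical p q;
  bias_gt : (gf' p q)^-1 < beta;
  measurable_offspring : forall u k, measurable [set w | nu w u = k];
  measurable_walk : forall i v, measurable [set w | X w i = v];
  walk_law : forall (n : nat) (x : nat -> seq nat) (s : seq (seq nat))
      (kk : seq nat -> nat),
    uniq s -> (forall i, (i < n)%N -> x i \in s) ->
    P [set w | (forall u, u \in s -> nu w u = kk u) /\
               (forall i, (i <= n)%N -> X w i = x i)]
    = ((\prod_(u <- s) p (kk u)) * (x 0%N == [::])%:R *
       \prod_(i < n) trans beta (kk (x i)) (x i) (x i.+1))%:E }.

Definition traj {T : Type} (X : T -> nat -> word) w n := [seq X w i | i <- iota 0 n.+1].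
#[global] Arguments traj : simpl never.

(** The probability of the path [x] in a fixed environment. It involves the offspring numbers of all
    vertices of the path except the last. *)
Definition wt {R : realType} (beta : R) (kk : word -> nat) (x : seq word) : R :=
  (nth [::] x 0 == [::])%:R *
  \prod_(i < (size x).-1) trans beta (kk (nth [::] x i)) (nth [::] x i) (nth [::] x i.+1).

Section Walk.
Context {R : realType} {p : nat -> R} {q beta : R} {d : measure_display}
  {Omega : measurableType d} {P : probability Omega R}
  {nu : Omega -> word -> nat} {X : Omega -> nat -> word}.
Context {W : galton_watson_walk p q beta P nu X}.

Lemma measurable_nu : measurable_fun setT (nu : Omega -> env).
Proof. apply: measurable_to_env; exact: measurable_offspring. Qed.

Lemma size_traj w n : size (traj X w n) = n.+1.
Proof. by rewrite size_map size_iota. Qed.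

Lemma trajS w n : traj X w n.+1 = rcons (traj X w n) (X w n.+1).
Proof. by rewrite /traj -(addn1 n.+1) iotaD map_cat cats1 add0n. Qed.

Lemma nth_traj w n i : (i <= n)%N -> nth [::] (traj X w n) i = X w i.
Proof. by move=> i_n; rewrite (nth_map 0%N) ?size_iota ?ltnS // nth_iota. Qed.

Lemma last_traj w n : last [::] (traj X w n) = X w n.
Proof. by rewrite (last_nth [::]) size_traj /= nth_traj. Qed.

Lemma take_traj w n i : (i <= n)%N -> take i.+1 (traj X w n) = traj X w i.
Proof.
by move=> i_n; rewrite /traj -map_take take_iota (minn_idPl _).
Qed.

Lemma measurable_traj n s : measurable [set w | traj X w n = s].
Proof.
have [sn|sn] := eqVneq (size s) n.+1; last first.
  rewrite (_ : [set _ | _] = set0) //; apply/seteqP; split => // w /= ws.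
  by move: sn; rewrite -ws size_traj eqxx.
rewrite (_ : [set _ | _] = \bigcap_(i in `I_n.+1) [set w | X w i = nth [::] s i]).
  by apply: fin_bigcap_measurable => // i _; exact: measurable_walk.
apply/seteqP; split => [w <- i /= i_n|w h]; first by rewrite nth_traj.
apply: (@eq_from_nth _ [::]); rewrite size_traj // => i i_n.
by rewrite nth_traj //; exact: h.
Qed.

Lemma wt_rcons kk x y z :
  wt beta kk (rcons (rcons x y) z) = wt beta kk (rcons x y) * trans beta (kk y) y z.
Proof.
rewrite /wt !size_rcons /= big_ord_recr /= -!mulrA; congr (_ * _).
  by rewrite !nth_rcons !size_rcons /=; case: x.
rewrite !nth_rcons !size_rcons leqnn !ltnn !eqxx /=; congr (_ * _).
apply: eq_bigr => i _; rewrite !(nth_rcons _ (rcons x y)) !size_rcons.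
by rewrite !ltnS (ltnW (ltn_ord i)) ltn_ord.
Qed.

(** The endpoint of the path may lie outside [s], its offspring number not having influenced the
    walk yet. The independence of newly entered subtrees rests on this. *)
Lemma law_cyl s kk n x : uniq s -> size x = n.+1 -> {subset take n x <= s} ->
  P (nu @^-1` cyl s kk `&` [set w | traj X w n = x]) =
  ((\prod_(u <- s) p (kk u)) * wt beta kk x)%:E.
Proof.
move=> us sx xs; rewrite /wt sx mulrA -(@walk_law _ _ _ _ _ _ _ _ _ W n (nth [::] x)) //; last first.
  by move=> i i_n; apply: xs; rewrite -(nth_take _ i_n); apply: mem_nth; rewrite size_takel // sx.
congr (P _); apply/seteqP; split => [w [h1 <-]|w [h1 h2]]; split => //.
  by move=> i i_n; rewrite nth_traj.
apply: (@eq_from_nth _ [::]); rewrite size_traj ?sx // => i i_n.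
by rewrite nth_traj //; exact: h2.
Qed.

Lemma P_root : P [set w | X w 0%N = [::]] = 1%E.
Proof.
have := @walk_law _ _ _ _ _ _ _ _ _ W 0%N (fun=> [::]) [::] (fun=> 0%N) isT (fun _ => ltac:(done)).
rewrite big_nil big_ord0 eqxx !mulr1 => <-; congr (P _); apply/seteqP.
by split => [w h|w [_ h]] /=; [split => // -[]|exact: h].
Qed.

Lemma P_cyl s kk : uniq s -> P (nu @^-1` cyl s kk) = (\prod_(u <- s) p (kk u))%:E.
Proof.
move=> us; have -> : \prod_(u <- s) p (kk u) = \prod_(u <- s) p (kk u) * wt beta kk [:: [::]].
  by rewrite /wt big_ord0 !mulr1.
rewrite -(@law_cyl s kk 0%N [:: [::]]) //.
have mC : measurable (nu @^-1` cyl s kk).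
  by rewrite -[_ @^-1` _]setTI; apply: measurable_nu => //; exact: measurable_cyl.
have mT := measurable_traj 0 [:: [::]].
apply/eqP; rewrite eq_le; apply/andP; split; last first.
  by apply: le_measure; rewrite ?inE //; exact: measurableI.
rewrite [leLHS](measureDI _ mC mT) addeC -[leRHS]adde0 leeD2l //.
apply: (@le_trans _ _ (P (~` [set w | X w 0%N = [::]]))).
  apply: le_measure; rewrite ?inE //; first exact: measurableD.
    by apply: measurableC; exact: measurable_walk.
  by move=> w [_ h] h'; apply: h; rewrite /= /traj /= h'.
rewrite probability_setC; last exact: measurable_walk.
by rewrite P_root subee.
Qed.

End Walk.

(** * One step of the walk in a fixed tree *)

Definition nbrs (k : nat) (v : word) : seq word :=
  if v is [::] then (if k == 0%N then [:: [::]] else [seq rcons [::] j | j <- iota 0 k])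
  else parent v :: [seq rcons v j | j <- iota 0 k].

Lemma parent_rcons v j : parent (rcons v j) = v.
Proof. by rewrite /parent size_rcons /= -cats1 take_size_cat. Qed.

Lemma size_parent v : size (parent v) = (size v).-1.
Proof. by rewrite /parent size_takel // leq_pred. Qed.

Lemma is_child_rcons k v j : is_child k v (rcons v j) = (j < k)%N.
Proof. by rewrite /is_child size_rcons eqxx last_rcons -cats1 take_size_cat // eqxx. Qed.

#[local] Arguments trans : simpl never.

Section OneStep.
Context {R : realType}.
Variable beta : R.
Implicit Types (om : word -> nat) (h : word -> R) (v : word).

(** The expectation of [h] after one step in a fixed tree. It is a genuine average on extinct trees
    as well: at a childless root [nbrs] is the root itself, with transition probability 1. *)
Definition E1 om h v : R := \sum_(y <- nbrs (om v) v) trans beta (om v) v y * h y.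

Lemma nbrs_uniq k v : uniq (nbrs k v).
Proof.
have U : uniq [seq rcons v j | j <- iota 0 k].
  by rewrite map_inj_uniq ?iota_uniq // => i j /rcons_inj [].
case: v U => [|a v] U; first by rewrite /nbrs; case: eqP.
rewrite /nbrs cons_uniq U andbT; apply/negP => /mapP[j _ e].
by have := size_rcons (a :: v) j; rewrite -e size_parent /=; lia.
Qed.

Lemma transE_root k y : (0 < k)%N -> trans beta k [::] y = (if is_child k [::] y then k%:R^-1 else 0).
Proof. by rewrite /trans; case: k. Qed.

Lemma E1_root om h : (0 < om [::])%N ->
  E1 om h [::] = (\sum_(j <- iota 0 (om [::])) h [:: j]) / (om [::])%:R.
Proof.
move=> k0; rewrite /E1 /nbrs -[_ == _]negbK -lt0n k0 /= big_map mulr_suml.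
rewrite big_seq [RHS]big_seq; apply: eq_bigr => j; rewrite mem_iota add0n => /andP[_ jk].
by rewrite transE_root // -[[:: j]]/(rcons [::] j) is_child_rcons jk mulrC.
Qed.

Lemma E1_nonroot om h v : v != [::] ->
  E1 om h v = (h (parent v) + beta * \sum_(j <- iota 0 (om v)) h (rcons v j)) /
              (1 + beta * (om v)%:R).
Proof.
case: v => // a v _; rewrite /E1 /nbrs big_cons big_map mulrDl; congr (_ + _).
  by rewrite /trans eqxx mulrC.
rewrite mulr_sumr mulr_suml big_seq [RHS]big_seq; apply: eq_bigr => j.
rewrite mem_iota add0n => /andP[_ jk]; rewrite /trans is_child_rcons jk.
case: eqP => [e|_]; last by rewrite mulrAC.
by have := size_rcons (a :: v) j; rewrite e size_parent /=; lia.
Qed.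

Lemma E1_rootE om h : om [::] = 0%N -> E1 om h [::] = h [::].
Proof. by move=> k0; rewrite /E1 k0 /= big_seq1 /trans /= mul1r. Qed.

Hypothesis beta0 : 0 < beta.

Let den_gt0 k : 0 < 1 + beta * k%:R :> R.
Proof. by rewrite ltr_wpDr // mulr_ge0 // ltW. Qed.

Lemma trans_ge0 k v y : 0 <= trans beta k v y.
Proof.
rewrite /trans; case: v => [|a v]; first by case: ifP => //; case: ifP.
case: ifP => _; first by rewrite invr_ge0 ltW.
by case: ifP => // _; rewrite divr_ge0 // ltW.
Qed.

Lemma E1_le om h h' v : (forall y, y \in nbrs (om v) v -> h y <= h' y) -> E1 om h v <= E1 om h' v.
Proof.
move=> hh; rewrite /E1 big_seq [leRHS]big_seq; apply: ler_sum => y yn.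
by rewrite ler_wpM2l ?trans_ge0 // hh.
Qed.

Lemma E1_cst om c v : E1 om (fun=> c) v = c.
Proof.
have [->|v0] := eqVneq v [::]; last first.
  rewrite E1_nonroot // big_const_seq count_predT size_iota iter_addr_0.
  rewrite -(mulr_natr c) (_ : c + _ = c * (1 + beta * (om v)%:R)); last by ring.
  by rewrite mulfK // gt_eqF.
have [k0|k0] := posnP (om [::]); first by rewrite E1_rootE.
rewrite E1_root // big_const_seq count_predT size_iota iter_addr_0.
by rewrite -(mulr_natr c) mulfK // pnatr_eq0 -lt0n.
Qed.

Lemma E1_ge0 om h v : (forall y, 0 <= h y) -> 0 <= E1 om h v.
Proof. by move=> h0; apply: sumr_ge0 => y _; rewrite mulr_ge0 // trans_ge0. Qed.

Lemma E1_bound om h v c : (forall y, y \in nbrs (om v) v -> h y <= c) -> E1 om h v <= c.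
Proof. by move=> hc; rewrite -[leRHS](E1_cst om c v); exact: E1_le. Qed.

(** At the root there is no parent; [gp >= c] plays the part of its value. *)
Lemma E1_super om h v c gp :
  (v != [::] -> h (parent v) <= gp) -> (v = [::] -> (0 < om v)%N /\ c <= gp) ->
  gp + beta * \sum_(j <- iota 0 (om v)) h (rcons v j) <= (1 + beta * (om v)%:R) * c ->
  E1 om h v <= c.
Proof.
have [->|v0] := eqVneq v [::] => H1 H2 H.
  have [k0 cgp] := H2 erefl; rewrite E1_root // ler_pdivrMr ?ltr0n //.
  rewrite -(ler_pM2l beta0) -(lerD2l c).
  apply: (@le_trans _ _ (gp + beta * \sum_(j <- iota 0 (om [::])) h [:: j])).
    by rewrite lerD2r.
  by apply: (le_trans H); rewrite mulrDl mul1r lerD2l mulrAC mulrA.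
rewrite E1_nonroot // ler_pdivrMr // [leRHS]mulrC; apply: le_trans H.
by rewrite lerD2r H1.
Qed.

End OneStep.

(** * The Markov property *)

Section Walk.
Context {R : realType} {p : nat -> R} {q beta : R} {d : measure_display}
  {Omega : measurableType d} {P : probability Omega R}
  {nu : Omega -> word -> nat} {X : Omega -> nat -> word}.
Context {W : galton_watson_walk p q beta P nu X}.

Lemma bias_gt1 : 1 < beta.
Proof.
apply: le_lt_trans (bias_gt (galton_watson_walk := W)).
by rewrite invf_ge1 ?gf'q_gt0 // ltW // gf'q_lt1.
Qed.

Lemma bias_gt0 : 0 < beta.
Proof. exact: lt_trans bias_gt1. Qed.

Lemma measurable_preimage_nu (A : set env) : measurable A -> measurable (nu @^-1` A).
Proof. by move=> mA; rewrite -[_ @^-1` _]setTI; exact: measurable_nu. Qed.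

Lemma prod_glue (K s : seq word) kk k : uniq K -> uniq s -> {in s, forall u, u \notin K} ->
  \prod_(u <- undup (s ++ K)) p (glue s k kk u) =
  (\prod_(u <- s) p (k u)) * \prod_(u <- K) p (kk u).
Proof.
move=> uK us sK; rewrite undup_id; last first.
  rewrite cat_uniq us uK andbT /=; apply/hasPn => u uK'; apply/negP => /sK.
  by rewrite uK'.
rewrite big_cat /=; congr (_ * _).
  by rewrite big_seq [RHS]big_seq; apply: eq_bigr => u us'; rewrite /glue us'.
rewrite big_seq [RHS]big_seq; apply: eq_bigr => u uK'; rewrite /glue ifN //.
by apply/negP => /sK; rewrite uK'.
Qed.

Lemma eq_wt (kk kk' : word -> nat) x : {in take (size x).-1 x, kk =1 kk'} -> wt beta kk x = wt beta kk' x.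
Proof.
move=> e; rewrite /wt; congr (_ * _); apply: eq_bigr => i _.
congr (trans _ _ _ _); apply: e.
rewrite -(nth_take [::] (ltn_ord i)); apply: mem_nth.
by rewrite size_takel ?leq_pred.
Qed.

Let mC s kk : measurable (nu @^-1` cyl s kk).
Proof. apply: measurable_preimage_nu; exact: measurable_cyl. Qed.

Let mCT s kk n x : measurable (nu @^-1` cyl s kk `&` [set w | traj X w n = x]).
Proof. by apply: measurableI => //; exact: measurable_traj. Qed.

(** Since [K] contains the current vertex [v], the transition probability is constant on the atom;
    it therefore factors out jointly with every environment event [A]. *)
Lemma markov_atom K kk n x v y (A : set env) : uniq K -> size x = n ->
  {subset rcons x v <= K} -> measurable A ->
  P (nu @^-1` A `&` (nu @^-1` cyl K kk `&` [set w | traj X w n.+1 = rcons (rcons x v) y])) =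
  ((trans beta (kk v) v y)%:E *
   P (nu @^-1` A `&` (nu @^-1` cyl K kk `&` [set w | traj X w n = rcons x v])))%E.
Proof.
move=> uK sx xK mA.
have t0 : 0 <= trans beta (kk v) v y by apply: trans_ge0; exact: bias_gt0.
pose D1 := nu @^-1` cyl K kk `&` [set w | traj X w n.+1 = rcons (rcons x v) y].
pose D2 := nu @^-1` cyl K kk `&` [set w | traj X w n = rcons x v].
have mD1 : measurable D1 by exact: mCT.
have mD2 : measurable D2 by exact: mCT.
rewrite -/D1 -/D2.
have mn : measurable_fun setT (nu : Omega -> env) by exact: measurable_nu.
apply: eq_law_scale => // s l us.
rewrite /D1 /D2 !setIA -!preimage_setI.
have [H|[u [h1 h2 h3]]] := cyl_compat_dec s K l kk; last first.
  by rewrite (cylI0 h1 h2 h3) preimage_set0 !set0I !measure0 mule0.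
rewrite cylI // !law_cyl ?undup_uniq ?size_rcons ?sx //; last 2 first.
- move=> u /mem_take /xK uK'; rewrite mem_undup mem_cat uK' orbT //.
- rewrite -cats1 take_size_cat ?size_rcons ?sx //.
  by move=> u /xK uK'; rewrite mem_undup mem_cat uK' orbT.
rewrite wt_rcons -EFinM; congr (_%:E); rewrite mulrA mulrC; congr (trans _ _ _ _ * _).
have vK : v \in K by apply: xK; rewrite mem_rcons inE eqxx.
by rewrite /glue; case: ifP => // vs; exact: H.
Qed.

(** The weight of the path reads offspring numbers in [K] only, hence none in [B], and the product
    over the offspring numbers splits. *)
Lemma fresh_atom K kk n x B (A : set env) : uniq K -> size x = n.+1 ->
  {subset take n x <= K} -> {in K, forall u, ~~ B u} -> measurable A ->
  P ((restr B \o nu) @^-1` A `&` (nu @^-1` cyl K kk `&` [set w | traj X w n = x])) =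
  (P (nu @^-1` cyl K kk `&` [set w | traj X w n = x]) * P ((restr B \o nu) @^-1` A))%E.
Proof.
move=> uK sx xK KB mA.
pose D := nu @^-1` cyl K kk `&` [set w | traj X w n = x].
have mD : measurable D by exact: mCT.
rewrite -/D.
have fD : P D \is a fin_num by rewrite ge0_fin_numE // (le_lt_trans (probability_le1 _ mD)) ?ltry.
have t0 : 0 <= fine (P D) by exact: fine_ge0.
have mn : measurable_fun setT (restr B \o nu : Omega -> env).
  exact: (measurableT_comp (measurable_restr B) measurable_nu).
rewrite -[in RHS](fineK fD) -[X in (_ * P X)%E]setIT.
apply: eq_law_scale => // s l us.
rewrite fineK // setIT comp_preimage.
have [->|->] := preimage_restr_cyl B s l; last by rewrite preimage_set0 set0I !measure0 mule0.
rewrite setIA -preimage_setI.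
have sK : {in [seq u <- s | B u], forall u, u \notin K}.
  by move=> u; rewrite mem_filter => /andP[Bu _]; apply/negP => /KB; rewrite Bu.
rewrite cylI; last by move=> u /sK /negP.
have uf : uniq [seq u <- s | B u] by rewrite filter_uniq.
rewrite P_cyl // !law_cyl ?undup_uniq //; last first.
  by move=> u /xK uK'; rewrite mem_undup mem_cat uK' orbT.
rewrite prod_glue // -EFinM (@eq_wt _ kk); first by congr (_%:E); rewrite -mulrA [LHS]mulrC.
move=> u; rewrite sx /= => /xK uK'; rewrite /glue ifN //.
by apply/negP => /sK; rewrite uK'.
Qed.

(** The parameter [j] decides whether the offspring number of the current vertex is revealed: it is
    for the Markov property ([j = n.+1]), and it is not for the independence of the subtree of that
    vertex ([j = n]). *)
Lemma traj_atom (j n : nat) (t : seq word * seq nat) :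
  [set w | (traj X w n, [seq nu w u | u <- take j (traj X w n)]) = t] = set0 \/
  (size t.1 = n.+1 /\ exists kk,
   [set w | (traj X w n, [seq nu w u | u <- take j (traj X w n)]) = t] =
   nu @^-1` cyl (undup (take j t.1)) kk `&` [set w | traj X w n = t.1]).
Proof.
set S := [set w | _]; have [[w0 w0S]|nS] := pselect (S !=set0); last first.
  by left; apply/eqP; rewrite -[_ == _]negbK; apply/negP => /set0P.
right; move: w0S; rewrite /S /= => <- /=; split; first exact: size_traj.
exists (nu w0); apply/seteqP; split => w /=.
  move=> e; have e1 := congr1 fst e; have e2 := congr1 snd e; rewrite /= in e1 e2; split; [move=> u|by rewrite e1]; rewrite mem_undup -{1}e1 => uj.
  have [i il ->] : exists2 i, (i < size (take j (traj X w n)))%N & u = nth [::] (take j (traj X w n)) i.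
    by exists (index u (take j (traj X w n))); rewrite ?index_mem ?nth_index.
  have /(congr1 (fun s => nth 0%N s i)) := e2.
  by rewrite !(nth_map [::]) // -?e1 // => ->.
move=> [h e]; rewrite e; congr (_, _); apply/eq_in_map => u uj.
by apply: h; rewrite mem_undup.
Qed.

Lemma measurable_traj_atom j n t :
  measurable [set w | (traj X w n, [seq nu w u | u <- take j (traj X w n)]) = t].
Proof. by have [->|[_ [kk ->]]] := traj_atom j n t. Qed.

End Walk.

Lemma sum_trans (R : realType) (beta : R) k v : 0 < beta -> \sum_(y <- nbrs k v) trans beta k v y = 1.
Proof.
move=> b0; rewrite -[RHS](E1_cst b0 (fun=> k) 1 v) /E1.
by apply: eq_bigr => y _; rewrite mulr1.
Qed.

(** * Expectations of functionals of the tree and the path *)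

Section PathFunctionals.
Context {R : realType}.
Implicit Types (G : (word -> nat) -> seq word -> R).

(** Measurability is asked for each fixed path only; as there are countably many finite paths, this
    makes [G] measurable along the walk. *)
Definition adm G : Prop :=
  (forall om s, 0 <= G om s) /\ (forall s, measurable_fun setT (fun om : env => G om s)).

Variable beta : R.
Definition E1op G om s := E1 beta om (fun y => G om (rcons s y)) (last [::] s).

Lemma adm_E1op G : 0 < beta -> adm G -> adm (E1op G).
Proof.
move=> b0 [G0 mG]; split => [om s|s]; first exact: E1_ge0.
rewrite /E1op /E1.
apply: (@measurable_fun_count _ _ _ env R (fun om => om (last [::] s))
  (fun k om => \sum_(y <- nbrs k (last [::] s)) trans beta k (last [::] s) y * G om (rcons s y))).
  by move=> k; exact: measurable_coord.
by move=> k; apply: measurable_sum => y; apply: measurable_funM.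
Qed.

End PathFunctionals.

Section Expectation.
Context {R : realType} {d : measure_display} {Omega : measurableType d}.
Variables (P : probability Omega R) (nu : Omega -> word -> nat) (X : Omega -> nat -> word).

Definition Ex n (G : (word -> nat) -> seq word -> R) : \bar R :=
  (\int[P]_w (G (nu w) (traj X w n))%:E)%E.

End Expectation.

Section Walk.
Context {R : realType} {p : nat -> R} {q beta : R} {d : measure_display}
  {Omega : measurableType d} {P : probability Omega R}
  {nu : Omega -> word -> nat} {X : Omega -> nat -> word}.
Context {W : galton_watson_walk p q beta P nu X}.
Local Notation Ex := (Ex P nu X).
Implicit Types (G : (word -> nat) -> seq word -> R).

Lemma adm_measurable n G : adm G ->
  measurable_fun setT (fun w => (G (nu w) (traj X w n))%:E).
Proof.
move=> [G0 mG]; apply/measurable_EFinP.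
apply: (@measurable_fun_count _ _ _ Omega R (fun w => traj X w n) (fun s w => G (nu w) s)).
  by move=> s; exact: measurable_traj.
by move=> s; apply: (measurableT_comp (mG s)); exact: measurable_nu.
Qed.

Section Atom.
Variables (K : seq word) (kk : word -> nat) (n : nat) (x : seq word) (v : word).
Hypotheses (uK : uniq K) (sx : size x = n) (xK : {subset rcons x v <= K}).
Let D := nu @^-1` cyl K kk `&` [set w | traj X w n = rcons x v].
Let Dy y := nu @^-1` cyl K kk `&` [set w | traj X w n.+1 = rcons (rcons x v) y].
Let ys := nbrs (kk v) v.
Let U := \big[setU/set0]_(y <- ys) Dy y.

Let mcyl : measurable (nu @^-1` cyl K kk).
Proof. apply: measurable_preimage_nu; exact: measurable_cyl. Qed.
Let mD : measurable D.
Proof. by apply: measurableI => //; exact: measurable_traj. Qed.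
Let mDy y : measurable (Dy y).
Proof. by apply: measurableI => //; exact: measurable_traj. Qed.
Let mU : measurable U. Proof. exact: bigsetU_measurable. Qed.

Let DyD y : Dy y `<=` D.
Proof.
by move=> w [h]; rewrite /= trajS => /rcons_inj[e _]; split.
Qed.

Let UD : U `<=` D.
Proof.
rewrite /U; elim/big_ind : _ => [|A B hA hB|y _]; first exact: sub0set.
  by rewrite subUset.
exact: DyD.
Qed.

Let integral_U f : measurable_fun setT f -> (forall w, 0 <= f w)%E ->
  (\int[P]_(w in U) f w = \sum_(y <- ys) \int[P]_(w in Dy y) f w)%E.
Proof.
move=> mf f0; rewrite ge0_integral_bigsetU //; first exact: nbrs_uniq.
  apply/trivIsetP => y z _ _ yz; apply/seteqP; split => // w [[_ h1] [_ h2]].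
  by move: h1 h2 => /= -> /rcons_inj[e]; rewrite e eqxx in yz.
exact: measurable_funTS.
Qed.

Let scale_Dy g y : measurable_fun setT (g : env -> \bar R) -> (forall om, 0 <= g om)%E ->
  (\int[P]_(w in Dy y) g (nu w) = (trans beta (kk v) v y)%:E * \int[P]_(w in D) g (nu w))%E.
Proof.
move=> mg g0; apply: (integral_law_scale (Y := env)) => //.
- by apply: trans_ge0; exact: bias_gt0.
- exact: measurable_nu.
- exact: measurable_nu.
- by move=> A mA; exact: markov_atom.
Qed.

(** The transition probabilities to the vertices of [nbrs] add up to 1, so almost surely on [D] the
    next vertex is one of them. *)
Let PU : P (D `\` U) = 0%E.
Proof.
have e : P U = P D.
  have h := @integral_U (cst 1%E) (measurable_cst _) (fun=> lee01).
  rewrite integral_cst // mul1e in h; rewrite h.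
  under eq_bigr do rewrite (@scale_Dy (cst 1%E)) // integral_cst // mul1e.
  rewrite -[RHS]mul1e -(sum_trans (kk v) v bias_gt0) -sumEFin ge0_sume_distrl //.
  by move=> y _; rewrite lee_fin trans_ge0 // bias_gt0.
rewrite measureD //; last exact: (le_lt_trans (probability_le1 _ mD) (ltry _)).
rewrite (setIidr UD) [X in (_ - X)%E](_ : _ = P D); last exact: e.
by rewrite subee // ge0_fin_numE // (le_lt_trans (probability_le1 _ mD)) ?ltry.
Qed.

Lemma integral_markov_atom G : adm G ->
  (\int[P]_(w in D) (G (nu w) (traj X w n.+1))%:E =
   \int[P]_(w in D) (E1op beta G (nu w) (traj X w n))%:E)%E.
Proof.
move=> aG; have [G0 mG] := aG.
have mDU : measurable (D `\` U) by exact: measurableD.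
rewrite -[in LHS](setDUK UD) (ge0_integral_setU _ mU mDU); last 3 first.
- by apply: measurable_funTS; exact: adm_measurable.
- by move=> w _; rewrite lee_fin.
- by rewrite disj_set2E setDIK.
rewrite [X in (_ + X)%E]null_set_integral //; last first.
  by apply: measurable_funTS; exact: adm_measurable.
rewrite adde0 integral_U; [|exact: adm_measurable|by move=> w; rewrite lee_fin].
transitivity (\sum_(y <- ys) (trans beta (kk v) v y)%:E *
    \int[P]_(w in D) (G (nu w) (rcons (rcons x v) y))%:E)%E.
  apply: eq_bigr => y _.
  rewrite -(@scale_Dy (fun om => (G om (rcons (rcons x v) y))%:E)).
  - by apply: eq_integral => w; rewrite inE => -[_ /= ->].
  - by apply/measurable_EFinP; exact: mG.
  - by move=> om; rewrite lee_fin.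
transitivity (\int[P]_(w in D) \sum_(y <- ys) (trans beta (kk v) v y *
    G (nu w) (rcons (rcons x v) y))%:E)%E; last first.
  apply: eq_integral => w; rewrite inE => -[h /= e].
  rewrite /E1op /E1 e last_rcons (h v) ?sumEFin //.
  by apply: xK; rewrite mem_rcons inE eqxx.
have mGn y : measurable_fun D (fun w => (G (nu w) (rcons (rcons x v) y))%:E).
  apply: measurable_funTS; apply/measurable_EFinP.
  exact: (measurableT_comp (mG _) measurable_nu).
rewrite ge0_integral_sum //; last 2 first.
- by move=> y; under eq_fun do rewrite EFinM; apply: emeasurable_funM.
- by move=> y w _; rewrite lee_fin mulr_ge0 // trans_ge0 // bias_gt0.
apply: eq_bigr => y _; under [RHS]eq_integral do rewrite EFinM.
rewrite ge0_integralZl //.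
- by move=> w _; rewrite lee_fin.
- by rewrite lee_fin trans_ge0 // bias_gt0.
Qed.

End Atom.

Lemma markov n G : adm G -> Ex n.+1 G = Ex n (E1op beta G).
Proof.
move=> aG; have aE : adm (E1op beta G) by apply: adm_E1op => //; exact: bias_gt0.
apply: (eq_integral_atoms (T := (seq word * seq nat)%type)
  (phi := fun w => (traj X w n, [seq nu w u | u <- take n.+1 (traj X w n)]))).
- by move=> t; exact: measurable_traj_atom.
- exact: adm_measurable.
- exact: adm_measurable.
- by move=> w; rewrite lee_fin; case: aG.
- by move=> w; rewrite lee_fin; case: aE.
move=> t; have [->|[st [kk ->]]] := traj_atom (nu := nu) (X := X) n.+1 n t; first by rewrite !integral_set0.
case: t st => s l /= st; rewrite take_oversize ?st //.
case/lastP: s st => // x v; rewrite size_rcons => -[sx].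
apply: integral_markov_atom => //; first exact: undup_uniq.
by move=> u; rewrite mem_undup.
Qed.

End Walk.

(** * Valid paths, supermartingales and fresh subtrees *)

Definition step (om : word -> nat) (x y : word) : bool := y \in nbrs (om x) x.

Definition valid (om : word -> nat) (s : seq word) : bool :=
  if s is x :: s' then (x == [::]) && path (step om) x s' else false.

Lemma valid_rcons om s y : s != [::] ->
  valid om (rcons s y) = valid om s && step om (last [::] s) y.
Proof. by case: s => // x s _; rewrite /= rcons_path andbA. Qed.

Lemma measurable_valid s : measurable [set om : env | valid om s].
Proof.
elim/last_ind: s => [|s y IH].
  by rewrite (_ : [set _ | _] = set0) //; apply/seteqP; split.
have [->|s0] := eqVneq s [::].
  rewrite /= (_ : [set _ | _] = [set om : env | y == [::]]); last first.
    by apply/seteqP; split => om /=; rewrite andbT.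
  case: (y == [::]).
    by rewrite (_ : [set _ | _] = setT) //; apply/seteqP; split.
  by rewrite (_ : [set _ | _] = set0) //; apply/seteqP; split.
rewrite (_ : [set _ | _] = [set om : env | valid om s] `&` [set om : env | step om (last [::] s) y]).
  apply: measurableI => //.
  apply: (@measurable_count_set nat _ env (fun om => om (last [::] s))
    (fun k => [set om | y \in nbrs k (last [::] s)])) => k; first exact: measurable_coord.
  case: (y \in _).
    by rewrite (_ : [set _ | _] = setT) //; apply/seteqP; split.
  by rewrite (_ : [set _ | _] = set0) //; apply/seteqP; split.
by apply/seteqP; split => om /=; rewrite valid_rcons // => /andP.
Qed.

Lemma measurable_negb d (Y : measurableType d) (b : Y -> bool) :
  measurable [set y | b y] -> measurable [set y | ~~ b y].
Proof.
move=> mb; rewrite (_ : [set _ | _] = ~` [set y | b y]); first exact: measurableC.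
by apply/seteqP; split => y /= /negP.
Qed.

Lemma measurable_invalid s : measurable [set om : env | ~~ valid om s].
Proof. exact: (measurable_negb (measurable_valid s)). Qed.

Lemma measurable_natr d (Y : measurableType d) (R : realType) (b : Y -> bool) :
  measurable [set y | b y] -> measurable_fun setT (fun y => (b y)%:R : R).
Proof.
move=> mb; rewrite (_ : (fun y => _) = \1_[set y | b y]); first exact: measurable_indic.
by apply/funext => y; rewrite indicE; case: (boolP (b y)) => h;
   [rewrite mem_set|rewrite memNset //; apply/negP].
Qed.

Section Admissible.
Context {R : realType}.
Implicit Types (G : (word -> nat) -> seq word -> R) (b : (word -> nat) -> seq word -> bool).

Lemma adm_bool b : (forall s, measurable [set om : env | b om s]) ->
  adm (fun om s => (b om s)%:R : R).
Proof.
by move=> mb; split => [om s|s]; [exact: ler0n|exact: (measurable_natr (Y := env))].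
Qed.

Lemma admD G G' : adm G -> adm G' -> adm (fun om s => G om s + G' om s).
Proof.
move=> [G0 mG] [G0' mG']; split => [om s|s]; first exact: addr_ge0.
exact: (measurable_funD (mG s) (mG' s)).
Qed.

Lemma admM G G' : adm G -> adm G' -> adm (fun om s => G om s * G' om s).
Proof.
move=> [G0 mG] [G0' mG']; split => [om s|s]; first exact: mulr_ge0.
exact: (measurable_funM (mG s) (mG' s)).
Qed.

Lemma adm_cst (c : R) : 0 <= c -> adm (fun _ _ => c).
Proof. by move=> c0; split => // s; exact: measurable_cst. Qed.

Lemma adm_path (b : seq word -> bool) : adm (fun om s => (b s)%:R : R).
Proof. by split => [om s|s]; [exact: ler0n|exact: measurable_cst]. Qed.

Lemma adm_valid : adm (fun om s => (~~ valid om s)%:R : R).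
Proof.
apply: adm_bool => s; exact: measurable_invalid.
Qed.

Lemma adm_comp (f : seq word -> seq word) G : adm G -> adm (fun om s => G om (f s)).
Proof. by move=> [G0 mG]; split. Qed.

End Admissible.

Section Walk.
Context {R : realType} {p : nat -> R} {q beta : R} {d : measure_display}
  {Omega : measurableType d} {P : probability Omega R}
  {nu : Omega -> word -> nat} {X : Omega -> nat -> word}.
Context {W : galton_watson_walk p q beta P nu X}.
Local Notation Ex := (Ex P nu X).
Implicit Types (G : (word -> nat) -> seq word -> R) (b : (word -> nat) -> seq word -> bool).

Lemma Ex_ge0 n G : adm G -> (0 <= Ex n G)%E.
Proof. by move=> [G0 _]; apply: integral_ge0 => w _; rewrite lee_fin. Qed.

Lemma ExD n G G' : adm G -> adm G' ->
  Ex n (fun om s => G om s + G' om s) = (Ex n G + Ex n G')%E.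
Proof.
move=> aG aG'; rewrite /Ex -ge0_integralD //.
- by move=> w _; rewrite lee_fin; case: aG.
- exact: adm_measurable.
- by move=> w _; rewrite lee_fin; case: aG'.
- exact: adm_measurable.
Qed.

Lemma ExZ n c G : 0 <= c -> adm G -> Ex n (fun om s => c * G om s) = (c%:E * Ex n G)%E.
Proof.
move=> c0 aG; rewrite /Ex -ge0_integralZl //.
- exact: adm_measurable.
- by move=> w _; rewrite lee_fin; case: aG.
Qed.

Lemma Ex_bool n b : (forall s, measurable [set om : env | b om s]) ->
  Ex n (fun om s => (b om s)%:R) = P [set w | b (nu w) (traj X w n)].
Proof.
move=> mb; have mB : measurable [set w | b (nu w) (traj X w n)].
  apply: (@measurable_count_set _ _ _ (fun w => traj X w n)
    (fun s => [set w | b (nu w) s])) => s; first exact: measurable_traj.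
  exact: (measurable_preimage_nu (mb s)).
rewrite -[X in P X]setIT -integral_indic //; apply: eq_integral => w _.
rewrite indicE; case: (boolP (b _ _)) => h; first by rewrite mem_set.
by rewrite memNset //; apply/negP.
Qed.

Lemma Ex_take n m G : (n <= m)%N -> Ex m (fun om s => G om (take n.+1 s)) = Ex n G.
Proof. by move=> nm; apply: eq_integral => w _; rewrite take_traj. Qed.

Lemma Ex_le n G G' : adm G -> adm G' -> (forall om s, G om s <= G' om s) ->
  (Ex n G <= Ex n G')%E.
Proof.
move=> aG aG' H; apply: ge0_le_integral => //.
- by move=> w _; rewrite lee_fin; case: aG.
- exact: adm_measurable.
- exact: adm_measurable.
- by move=> w _; rewrite lee_fin.
Qed.

Lemma Ex_invalid n : Ex n (fun om s => (~~ valid om s)%:R) = 0%E.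
Proof.
have b0 : 0 < beta by exact: bias_gt0.
apply/eqP; rewrite eq_le Ex_ge0 ?andbT; last exact: adm_valid.
elim: n => [|n IH].
  have -> : Ex 0 (fun om s => (~~ valid om s)%:R) = P (~` [set w | X w 0%N = [::]]).
    rewrite Ex_bool; last exact: measurable_invalid.
    by congr (P _); apply/seteqP; split => w /=; rewrite /traj /= andbT => /eqP.
  rewrite probability_setC; last exact: measurable_walk.
  by rewrite P_root subee.
rewrite markov; last exact: adm_valid.
apply: le_trans IH; apply: Ex_le => [||om s] /=.
- exact: (adm_E1op b0 adm_valid).
- exact: adm_valid.
- apply: (E1_bound b0) => y yn; have [->|s0] := eqVneq s [::]; first by rewrite ler_nat leq_b1.
  by rewrite valid_rcons // /step yn andbT.
Qed.

(** The law of the walk says nothing surely, only with probability 1. This lemma lets the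
    combinatorial arguments be made for paths that do start at the root and follow edges. *)
Lemma Ex_le_valid n G G' : adm G -> adm G' ->
  (forall om s, size s = n.+1 -> valid om s -> G om s <= G' om s) ->
  (Ex n G <= Ex n G')%E.
Proof.
move=> aG aG' H.
apply: ae_ge0_le_integral => //.
- by move=> w _; rewrite lee_fin; case: aG.
- exact: adm_measurable.
- by move=> w _; rewrite lee_fin; case: aG'.
- exact: adm_measurable.
exists [set w | ~~ valid (nu w) (traj X w n)]; split.
- apply: (@measurable_count_set _ _ _ (fun w => traj X w n)
    (fun s => [set w | ~~ valid (nu w) s])) => s; first exact: measurable_traj.
  exact: (measurable_preimage_nu (measurable_invalid s)).
- rewrite -(Ex_invalid n) Ex_bool //.
  exact: measurable_invalid.
- move=> w /= h; apply/negP => v; apply: h => _; rewrite lee_fin; apply: H => //.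
  exact: size_traj.
Qed.

(** The Markov property telescopes: a potential that pays for the cost [c] at each step bounds the
    expected total cost. Starting at [n0] allows the potential to depend on the path up to that
    time, for instance on the vertex occupied then. *)
Lemma supermartingale n0 N Phi c : adm Phi -> adm c -> (n0 <= N)%N ->
  (forall om s, (n0 < size s)%N -> valid om s ->
     E1op beta Phi om s + c om s <= Phi om s) ->
  (\sum_(n0 <= j < N) Ex j c + Ex N Phi <= Ex n0 Phi)%E.
Proof.
move=> aP ac nN H; elim: N nN => [|N IH].
  by rewrite leqn0 => /eqP ->; rewrite big_geq // add0e.
rewrite leq_eqVlt => /predU1P[<-|]; first by rewrite big_geq // add0e.
rewrite ltnS => nN; rewrite big_nat_recr //=; apply: le_trans (IH nN).
have aE : adm (E1op beta Phi) by apply: adm_E1op => //; exact: bias_gt0.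
rewrite -addeA; apply: leeD2l; rewrite markov // addeC -ExD //.
by apply: Ex_le_valid => // [|om s sN v]; [exact: admD|apply: H => //; rewrite sN ltnS].
Qed.

Let mrn B : measurable_fun setT (restr B \o nu : Omega -> env).
Proof. exact: (measurableT_comp (measurable_restr B) measurable_nu). Qed.

Let Pfin (A : set Omega) : measurable A -> P A \is a fin_num.
Proof. by move=> mA; rewrite ge0_fin_numE // (le_lt_trans (probability_le1 _ mA)) ?ltry. Qed.

Lemma integral_restr (D : set Omega) B (g : env -> \bar R) :
  measurable D ->
  (forall A : set env, measurable A -> P ((restr B \o nu) @^-1` A `&` D) =
     (P D * P ((restr B \o nu) @^-1` A))%E) ->
  measurable_fun setT g -> (forall om, 0 <= g om)%E ->
  (\int[P]_(w in D) g (restr B (nu w)) = P D * \int[P]_w g (restr B (nu w)))%E.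
Proof.
move=> mD H mg g0.
rewrite -[X in (X * _)%E](fineK (Pfin mD)).
apply: (@integral_law_scale _ _ _ env R P D setT (restr B \o nu) (restr B \o nu)
  (fine (P D)) g) => //.
- exact: fine_ge0.
- by move=> A mA; rewrite setIT fineK ?Pfin //; exact: H.
Qed.

Section Fresh.
Variables (b : seq word -> bool) (Phi : word -> (word -> nat) -> R) (c : R) (n : nat).
Hypothesis b_fresh : forall s, size s = n.+1 -> b s ->
  {in take n s, forall u, ~~ prefix (last [::] s) u}.
Hypothesis Phi_ge0 : forall u om, 0 <= Phi u om.
Hypothesis mPhi : forall u, measurable_fun setT (Phi u : env -> R).
Hypothesis Phi_local : forall u om, Phi u (restr (prefix u) om) = Phi u om.
Hypothesis c0 : 0 <= c.

Lemma adm_fresh : adm (fun om s => (b s)%:R * Phi (last [::] s) om).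
Proof.
by apply: admM; [exact: adm_path|split => [om s|s]].
Qed.

Let atom_eq K kk s : uniq K -> size s = n.+1 -> K =i take n s ->
  let D := nu @^-1` cyl K kk `&` [set w | traj X w n = s] in
  (\int[P]_(w in D) ((b (traj X w n))%:R * Phi (last [::] (traj X w n)) (nu w))%:E =
   (b s)%:R%:E * (P D * \int[P]_w (Phi (last [::] s) (nu w))%:E))%E.
Proof.
move=> uK ss Ks D.
have mD : measurable D.
  apply: measurableI; last exact: measurable_traj.
  by apply: measurable_preimage_nu; exact: measurable_cyl.
transitivity (\int[P]_(w in D) ((b s)%:R * Phi (last [::] s) (nu w))%:E)%E.
  by apply: eq_integral => w; rewrite inE => -[_ e]; rewrite (e : traj X w n = s).
have [bs|_] := boolP (b s); last first.
  by rewrite mul0e; apply: integral0_eq => w _; rewrite mulr0n mul0r.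
rewrite mul1e.
transitivity (\int[P]_(w in D) (Phi (last [::] s) (restr (prefix (last [::] s)) (nu w)))%:E)%E.
  by apply: eq_integral => w _; rewrite mul1r Phi_local.
rewrite (@integral_restr D (prefix (last [::] s)) (fun om => (Phi (last [::] s) om)%:E)) //.
- by congr (_ * _)%E; apply: eq_integral => w _; rewrite Phi_local.
- move=> A mA; apply: fresh_atom => // u; rewrite Ks //.
  exact: b_fresh.
- exact/measurable_EFinP.
- by move=> om; rewrite lee_fin.
Qed.

Let atom_cst K kk s : uniq K -> size s = n.+1 -> K =i take n s ->
  let D := nu @^-1` cyl K kk `&` [set w | traj X w n = s] in
  (\int[P]_(w in D) (c * (b (traj X w n))%:R)%:E = (b s)%:R%:E * (P D * c%:E))%E.
Proof.
move=> uK ss Ks D.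
have mD : measurable D.
  apply: measurableI; last exact: measurable_traj.
  by apply: measurable_preimage_nu; exact: measurable_cyl.
transitivity (\int[P]_(w in D) (cst (c * (b s)%:R)%:E) w)%E.
  by apply: eq_integral => w; rewrite inE => -[_ e]; rewrite (e : traj X w n = s).
by rewrite integral_cst // EFinM muleC [(c%:E * _)%E]muleC muleCA.
Qed.

Let Kn (s : seq word) : undup (take n s) =i take n s.
Proof. by move=> u; rewrite mem_undup. Qed.

Let aCb : adm (fun om s => c * (b s)%:R).
Proof. by apply: admM; [exact: adm_cst|exact: adm_path]. Qed.

(** The law of the path up to time [n] only involves the offspring numbers of
    visited vertices, none of which lies in a subtree entered for the first
    time: that subtree is independent of the past. *)
Lemma fresh_le : (forall u, \int[P]_w (Phi u (nu w))%:E <= c%:E)%E ->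
  (Ex n (fun om s => ((b s)%:R * Phi (last [::] s) om)%R) <= c%:E * Ex n (fun om s => (b s)%:R%R))%E.
Proof.
move=> H; rewrite -(ExZ n c0 (adm_path b)).
apply: (le_integral_atoms (T := (seq word * seq nat)%type)
  (phi := fun w => (traj X w n, [seq nu w u | u <- take n (traj X w n)]))).
- by move=> t; exact: measurable_traj_atom.
- exact: (adm_measurable n adm_fresh).
- exact: (adm_measurable n aCb).
- by move=> w; rewrite lee_fin mulr_ge0.
- by move=> w; rewrite lee_fin mulr_ge0.
move=> t; have [->|[st [kk ->]]] := traj_atom (nu := nu) (X := X) n n t.
  by rewrite !integral_set0.
rewrite atom_eq ?undup_uniq // atom_cst ?undup_uniq //.
by apply: lee_wpmul2l; [rewrite lee_fin|apply: lee_wpmul2l].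
Qed.

Lemma fresh_ge : (forall u, c%:E <= \int[P]_w (Phi u (nu w))%:E)%E ->
  (c%:E * Ex n (fun om s => (b s)%:R%R) <= Ex n (fun om s => ((b s)%:R * Phi (last [::] s) om)%R))%E.
Proof.
move=> H; rewrite -(ExZ n c0 (adm_path b)).
apply: (le_integral_atoms (T := (seq word * seq nat)%type)
  (phi := fun w => (traj X w n, [seq nu w u | u <- take n (traj X w n)]))).
- by move=> t; exact: measurable_traj_atom.
- exact: (adm_measurable n aCb).
- exact: (adm_measurable n adm_fresh).
- by move=> w; rewrite lee_fin mulr_ge0.
- by move=> w; rewrite lee_fin mulr_ge0.
move=> t; have [->|[st [kk ->]]] := traj_atom (nu := nu) (X := X) n n t.
  by rewrite !integral_set0.
rewrite atom_eq ?undup_uniq // atom_cst ?undup_uniq //.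
by apply: lee_wpmul2l; [rewrite lee_fin|apply: lee_wpmul2l].
Qed.

End Fresh.

(** The law of the tree alone is read off at time 0: intersecting with the almost sure event that
    the walk starts at the root reduces the claim to [fresh_atom]. *)
Lemma indep_cyl K kk B (A : set env) : uniq K -> {in K, forall u, ~~ B u} -> measurable A ->
  P ((restr B \o nu) @^-1` A `&` nu @^-1` cyl K kk) =
  (P (nu @^-1` cyl K kk) * P ((restr B \o nu) @^-1` A))%E.
Proof.
move=> uK KB mA.
have root E : measurable E -> P (E `&` [set w | traj X w 0 = [:: [::]]]) = P E.
  move=> mE; apply/eqP; rewrite eq_le; apply/andP; split.
    apply: le_measure; rewrite ?inE //.
    by apply: measurableI => //; exact: measurable_traj.
  rewrite [leLHS](measureDI _ mE (measurable_traj 0 [:: [::]])) addeC -[leRHS]adde0 leeD2l //.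
  apply: (@le_trans _ _ (P (~` [set w | X w 0%N = [::]]))).
    apply: le_measure; rewrite ?inE //.
    - by apply: measurableD => //; exact: measurable_traj.
    - by apply: measurableC; exact: measurable_walk.
    - by move=> w [_ h] h'; apply: h; rewrite /= /traj /= h'.
  rewrite probability_setC; last exact: measurable_walk.
  by rewrite P_root subee.
have mK : measurable (nu @^-1` cyl K kk).
  by apply: measurable_preimage_nu; exact: measurable_cyl.
have mB : measurable ((restr B \o nu) @^-1` A).
  by rewrite -[_ @^-1` _]setTI; exact: mrn.
have := @fresh_atom _ _ _ _ _ _ _ _ _ W K kk 0%N [:: [::]] B A uK erefl _ KB mA.
rewrite setIA root ?root //; last exact: measurableI.
by apply => u.
Qed.

Lemma indep (A1 A2 : set env) (B1 B2 : pred word) : (forall u, B1 u -> ~~ B2 u) ->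
  measurable A1 -> measurable A2 ->
  P ((restr B2 \o nu) @^-1` A2 `&` (restr B1 \o nu) @^-1` A1) =
  (P ((restr B1 \o nu) @^-1` A1) * P ((restr B2 \o nu) @^-1` A2))%E.
Proof.
move=> B12 mA1 mA2.
have mD : measurable ((restr B2 \o nu) @^-1` A2).
  by rewrite -[_ @^-1` _]setTI; exact: mrn.
rewrite setIC -[X in (_ * X)%E](fineK (Pfin mD)) muleC -[X in (_ * P X)%E]setIT.
apply: eq_law_scale => // [|s k us]; first exact: fine_ge0.
rewrite setIT fineK ?Pfin // [(restr B1 \o nu) @^-1` _]comp_preimage.
have [->|->] := preimage_restr_cyl B1 s k; last by rewrite preimage_set0 set0I !measure0 mule0.
rewrite setIC indep_cyl ?filter_uniq //; first by rewrite muleC.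
by move=> u; rewrite mem_filter => /andP[/B12].
Qed.

Lemma integral_indep (A1 : set env) (B1 B2 : pred word) (g : env -> \bar R) :
  (forall u, B1 u -> ~~ B2 u) -> measurable A1 ->
  measurable_fun setT g -> (forall om, 0 <= g om)%E ->
  (\int[P]_(w in (restr B1 \o nu) @^-1` A1) g (restr B2 (nu w)) =
   P ((restr B1 \o nu) @^-1` A1) * \int[P]_w g (restr B2 (nu w)))%E.
Proof.
move=> B12 mA1 mg g0; apply: integral_restr => //.
- by rewrite -[_ @^-1` _]setTI; exact: mrn.
- by move=> A mA; exact: indep.
Qed.

End Walk.

(** * Finite subtrees *)

(** [ext om h u]: the subtree of [u] has no vertex at height [h] above [u]. *)
Fixpoint ext (om : word -> nat) (h : nat) (u : word) : bool :=
  if h is h'.+1 then all (fun j => ext om h' (rcons u j)) (iota 0 (om u)) else false.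

Definition alive (om : word -> nat) (u : word) : bool := `[< forall h, ~~ ext om h u >].

Lemma ext_le om h h' u : (h <= h')%N -> ext om h u -> ext om h' u.
Proof.
elim: h h' u => [|h IH] [|h'] u //=; rewrite ltnS => hh' /allP H.
by apply/allP => j jk; apply: IH (H j jk).
Qed.

Lemma alive_ext om u h : alive om u -> ~~ ext om h u.
Proof. by move=> /asboolP; apply. Qed.

Lemma deadP om u : reflect (exists h, ext om h u) (~~ alive om u).
Proof.
apply: (iffP idP) => [/asboolPn H|[h hu]]; last by apply/negP => /(alive_ext h); rewrite hu.
by apply: contrapT => N; apply: H => h; apply/negP => hu; apply: N; exists h.
Qed.

(** The step of König's lemma: there are finitely many children, so finite heights above each of
    them would have a maximum. *)
Lemma alive_child om u : alive om u -> exists2 j, (j < om u)%N & alive om (rcons u j).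
Proof.
move=> au; apply: contrapT => N.
suff /deadP : exists h, ext om h u by rewrite au.
have H j : (j < om u)%N -> exists h, ext om h (rcons u j).
  by move=> jk; apply/deadP/negP => aj; apply: N; exists j.
have [h hH] : exists h, forall j, (j < om u)%N -> ext om h (rcons u j).
  elim: (om u) {N} H => [|k IH] H; first by exists 0%N.
  have [h1 H1] := IH (fun j jk => H j (ltnW jk)).
  have [h2 H2] := H k (leqnn _).
  exists (maxn h1 h2) => j; rewrite ltnS leq_eqVlt => /predU1P[->|jk].
    by apply: ext_le H2; exact: leq_maxr.
  by apply: ext_le (H1 j jk); exact: leq_maxl.
by exists h.+1; apply/allP => j; rewrite mem_iota => /andP[_ jk]; exact: hH.
Qed.

Lemma alive_parent om u j : (j < om u)%N -> alive om (rcons u j) -> alive om u.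
Proof.
move=> jk aj; apply/asboolP => -[|h] //=; apply/negP => /allP /(_ j).
by rewrite mem_iota jk => /(_ isT); apply/negP; exact: alive_ext.
Qed.

Section Local.
Context {T : Type}.

Definition local (B : pred word) (g : (word -> nat) -> T) : Prop :=
  forall om om', (forall v, B v -> om v = om' v) -> g om = g om'.

Lemma local_restr B g : local B g -> forall om, g (restr B om) = g om.
Proof. by move=> H om; apply: H => v Bv; rewrite /restr Bv. Qed.

End Local.

Lemma prefix_rcons_trans (u v : word) j : prefix (rcons u j) v -> prefix u v.
Proof. by apply: prefix_trans; exact: prefix_rcons. Qed.

Lemma ext_local h u : local (prefix u) (fun om => ext om h u).
Proof.
elim: h u => [|h IH] u om om' e //=; rewrite (e u (prefix_refl u)).
by apply: eq_all => j; apply: IH => v /prefix_rcons_trans; exact: e.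
Qed.

Lemma alive_local u : local (prefix u) (fun om => alive om u).
Proof.
move=> om om' e; apply: asbool_equiv_eq; split => H h.
  by rewrite -(@ext_local h u _ _ e).
by rewrite (@ext_local h u _ _ e).
Qed.

Lemma measurable_all d (Y : measurableType d) (T : Type) (b : T -> Y -> bool) (l : seq T) :
  (forall j, measurable [set y | b j y]) -> measurable [set y | all (b^~ y) l].
Proof.
move=> mb; elim: l => [|j l IH] /=.
  by rewrite (_ : [set _ | _] = setT) //; apply/seteqP; split.
rewrite (_ : [set _ | _] = [set y | b j y] `&` [set y | all (b^~ y) l]).
  exact: measurableI.
by apply/seteqP; split => y /= /andP.
Qed.

Lemma measurable_ext h u : measurable [set om : env | ext om h u].
Proof.
elim: h u => [|h IH] u /=.
  by rewrite (_ : [set _ | _] = set0) //; apply/seteqP; split.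
apply: (@measurable_count_set nat _ env (fun om => om u)
  (fun k => [set om | all (fun j => ext om h (rcons u j)) (iota 0 k)])) => k.
  exact: measurable_coord.
by apply: (@measurable_all _ env nat (fun j om => ext om h (rcons u j))).
Qed.

Lemma measurable_alive u : measurable [set om : env | alive om u].
Proof.
rewrite (_ : [set _ | _] = \bigcap_h [set om : env | ~~ ext om h u]).
  apply: bigcapT_measurable => h.
  by apply: (@measurable_negb _ env); exact: measurable_ext.
by apply/seteqP; split => om /= => [/asboolP H h _|H]; [exact: H|apply/asboolP => h; exact: H].
Qed.

(** Expected time that the walk started at [u] spends in the subtree of [u],
    cut at height [h], before it moves to the parent of [u]. *)
Fixpoint eh {R : realType} (beta : R) (om : word -> nat) (h : nat) (u : word) : R :=
  if h is h'.+1 then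
    1 + beta * (om u)%:R + beta * \sum_(j <- iota 0 (om u)) eh beta om h' (rcons u j)
  else 0.

Section TrapTime.
Context {R : realType}.
Variable beta : R.
Hypothesis beta0 : 0 <= beta.

Lemma eh_ge0 om h u : 0 <= eh beta om h u.
Proof.
elim: h u => //= h IH u; apply: addr_ge0; last by rewrite mulr_ge0 // sumr_ge0.
by rewrite addr_ge0 // mulr_ge0.
Qed.

Lemma eh_local h u : local (prefix u) (fun om => eh beta om h u).
Proof.
elim: h u => [|h IH] u om om' e //=; rewrite (e u (prefix_refl u)).
congr (_ + _ * _); apply: eq_bigr => j _.
by apply: IH => v /prefix_rcons_trans; exact: e.
Qed.

Lemma measurable_sum_children (f : word -> env -> R) u :
  (forall v, measurable_fun setT (f v)) ->
  measurable_fun setT (fun om : env => \sum_(j <- iota 0 (om u)) f (rcons u j) om).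
Proof.
move=> mf; apply: (@measurable_fun_count nat _ _ env R (fun om => om u)
  (fun k om => \sum_(j <- iota 0 k) f (rcons u j) om)) => k; first exact: measurable_coord.
by apply: measurable_sum => j.
Qed.

Lemma measurable_deg u : measurable_fun setT (fun om : env => (om u)%:R : R).
Proof.
apply: (@measurable_fun_count nat _ _ env R (fun om => om u) (fun k om => k%:R)) => k.
  exact: measurable_coord.
exact: measurable_cst.
Qed.

Lemma measurable_eh h u : measurable_fun setT (fun om : env => eh beta om h u).
Proof.
elim: h u => [|h IH] u /=; first exact: measurable_cst.
apply: measurable_funD.
  by apply: measurable_funD; [exact: measurable_cst|apply: measurable_funM; [exact: measurable_cst|exact: measurable_deg]].
apply: measurable_funM; first exact: measurable_cst.
exact: (measurable_sum_children _ IH).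
Qed.

Lemma eh_stable om h h' u : ext om h u -> (h <= h')%N -> eh beta om h' u = eh beta om h u.
Proof.
elim: h h' u => [|h IH] [|h'] u //= /allP H hh'; congr (_ + _ * _).
by rewrite big_seq [RHS]big_seq; apply: eq_bigr => j jk; apply: IH => //; exact: H.
Qed.

(** The truncation is inactive on a subtree that has already died out at height [h], so the same [h]
    may appear on both sides. This is the equation that makes [trapV] harmonic inside a trap. *)
Lemma eh_rec om h u : ext om h u ->
  eh beta om h u = 1 + beta * (om u)%:R + beta * \sum_(j <- iota 0 (om u)) eh beta om h (rcons u j).
Proof. by move=> hu; rewrite -(eh_stable hu (leqnSn h)). Qed.

End TrapTime.

(** * Expectations over the tree *)

Lemma eseries_EFin (R : realType) (a : nat -> R) : (forall k, 0 <= a k) -> cvgn (series a) ->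
  (\sum_(k <oo) (a k)%:E = (limn (series a))%:E)%E.
Proof.
move=> a0 ca; rewrite -EFin_lim //; congr (limn _).
by apply/funext => n; rewrite /= /series /= sumEFin.
Qed.

Lemma prefix_rcons_nth (u v : word) j : prefix (rcons u j) v ->
  (size u < size v)%N /\ nth 0%N v (size u) = j.
Proof.
move=> /prefixP[t ->]; rewrite size_cat size_rcons nth_cat size_rcons ltnSn nth_rcons ltnn eqxx.
by split => //; rewrite addSn ltnS leq_addr.
Qed.

Section Environment.
Context {R : realType} {d : measure_display} {Omega : measurableType d}.
Variables (P : probability Omega R) (nu : Omega -> word -> nat).

Definition EE (g : (word -> nat) -> R) : \bar R := (\int[P]_w (g (nu w))%:E)%E.

End Environment.

Section Walk.
Context {R : realType} {p : nat -> R} {q beta : R} {d : measure_display}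
  {Omega : measurableType d} {P : probability Omega R}
  {nu : Omega -> word -> nat} {X : Omega -> nat -> word}.
Context {W : galton_watson_walk p q beta P nu X}.
Local Notation EE := (EE P nu).
Local Notation m1 := (limn (series (fun k => k%:R * p k))).
Implicit Types (g : (word -> nat) -> R) (a : (word -> nat) -> bool).
Local Notation menv g := (measurable_fun setT (g : env -> R)).

Lemma measurable_env_fun g : menv g -> measurable_fun setT (fun w => (g (nu w))%:E).
Proof. by move=> mg; apply/measurable_EFinP; exact: (measurableT_comp mg measurable_nu). Qed.

Lemma EE_ge0 g : (forall om, 0 <= g om) -> (0 <= EE g)%E.
Proof. by move=> g0; apply: integral_ge0 => w _; rewrite lee_fin. Qed.

Lemma EE_le g g' : (forall om, 0 <= g om) -> menv g -> menv g' ->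
  (forall om, g om <= g' om) -> (EE g <= EE g')%E.
Proof.
move=> g0 mg mg' H; apply: ge0_le_integral => //.
- by move=> w _; rewrite lee_fin.
- exact: measurable_env_fun.
- exact: measurable_env_fun.
- by move=> w _; rewrite lee_fin.
Qed.

Lemma EED g g' : (forall om, 0 <= g om) -> (forall om, 0 <= g' om) -> menv g -> menv g' ->
  EE (fun om => g om + g' om) = (EE g + EE g')%E.
Proof.
move=> g0 g0' mg mg'; rewrite /EE -ge0_integralD //.
- by move=> w _; rewrite lee_fin.
- exact: measurable_env_fun.
- by move=> w _; rewrite lee_fin.
- exact: measurable_env_fun.
Qed.

Lemma EEZ c g : 0 <= c -> (forall om, 0 <= g om) -> menv g ->
  EE (fun om => c * g om) = (c%:E * EE g)%E.
Proof.
move=> c0 g0 mg; rewrite /EE -ge0_integralZl //.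
- exact: measurable_env_fun.
- by move=> w _; rewrite lee_fin.
Qed.

Lemma EE_cst c : EE (fun=> c) = c%:E.
Proof.
rewrite /EE -[RHS]mule1 -(@probability_setT _ _ _ P).
exact: (@integral_cst _ _ _ P setT measurableT c%:E).
Qed.

Lemma EE_sum (I : Type) (l : seq I) (f : I -> (word -> nat) -> R) :
  (forall i om, 0 <= f i om) -> (forall i, menv (f i)) ->
  EE (fun om => \sum_(i <- l) f i om) = (\sum_(i <- l) EE (f i))%E.
Proof.
move=> f0 mf; elim: l => [|i l IH].
  by rewrite big_nil; apply: integral0_eq => w _; rewrite big_nil.
rewrite big_cons -IH -EED //.
- by apply: eq_integral => w _; rewrite big_cons.
- by move=> om; apply: sumr_ge0.
- exact: (@measurable_sum _ env R).
Qed.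

Let mset a : measurable [set om : env | a om] -> measurable [set w | a (nu w)].
Proof. exact: measurable_preimage_nu. Qed.

Lemma integral_boolM a g : measurable [set om : env | a om] ->
  EE (fun om => (a om)%:R * g om) = (\int[P]_(w in [set w | a (nu w)]) (g (nu w))%:E)%E.
Proof.
move=> ma; rewrite [RHS]integral_mkcond; apply: eq_integral => w _.
rewrite patchE; case: (boolP (a (nu w))) => h; first by rewrite mem_set // mul1r.
by rewrite memNset ?mul0r //; apply/negP.
Qed.

Lemma EE_bool a : measurable [set om : env | a om] ->
  EE (fun om => (a om)%:R) = P [set w | a (nu w)].
Proof.
move=> ma; transitivity (EE (fun om => (a om)%:R * 1)).
  by apply: eq_integral => w _; rewrite mulr1.
by rewrite integral_boolM // (@integral_cst _ _ _ P _ (mset ma) 1%E) mul1e.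
Qed.

Lemma EE_indep a g (B1 B2 : pred word) : (forall v, B1 v -> ~~ B2 v) ->
  measurable [set om : env | a om] -> local B1 a -> local B2 g ->
  (forall om, 0 <= g om) -> menv g ->
  EE (fun om => (a om)%:R * g om) = (EE (fun om => (a om)%:R) * EE g)%E.
Proof.
move=> B12 ma la lg g0 mg; rewrite integral_boolM // EE_bool //.
have e : [set w | a (nu w)] = (restr B1 \o nu) @^-1` [set om | a om].
  by apply/seteqP; split => w /=; rewrite (local_restr la).
have := @integral_indep _ _ _ _ _ _ _ _ _ W [set om : env | a om] B1 B2 (fun om => (g om)%:E) B12 ma.
rewrite -e => H.
transitivity (\int[P]_(w in [set w | a (nu w)]) (g (restr B2 (nu w)))%:E)%E.
  by apply: eq_integral => w _; rewrite (local_restr lg).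
rewrite H //; last by apply/measurable_EFinP.
by congr (_ * _)%E; apply: eq_integral => w _; rewrite (local_restr lg).
Qed.

Lemma measurable_degE u k : measurable [set om : env | om u == k].
Proof.
rewrite (_ : [set _ | _] = [set om : env | om u = k]); first exact: measurable_coord.
by apply/seteqP; split => om /= => [/eqP|->].
Qed.

Lemma EE_children u g : (forall om, 0 <= g om) -> menv g ->
  (EE g = \sum_(k <oo) EE (fun om => ((om u == k)%:R * g om)%R))%E.
Proof.
move=> g0 mg.
have UF : \bigcup_k [set w | nu w u == k] = setT.
  by apply/seteqP; split => // w _; exists (nu w u) => //=.
rewrite {1}/EE -UF ge0_integral_bigcup //.
- by apply: eq_eseriesr => k _; rewrite integral_boolM //; exact: measurable_degE.
- by move=> k; exact: (mset (measurable_degE u k)).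
- by rewrite UF; exact: measurable_env_fun.
- by move=> w _; rewrite lee_fin.
- apply/trivIsetP => i j _ _ ij; apply/seteqP; split => // w [/eqP wi /eqP wj].
  by move: ij; rewrite -wi -wj eqxx.
Qed.

Lemma EE_deg u k : EE (fun om => (om u == k)%:R) = (p k)%:E.
Proof.
rewrite EE_bool; last exact: measurable_degE.
transitivity (P (nu @^-1` cyl [:: u] (fun=> k))); last by rewrite P_cyl // big_seq1.
congr (P _); apply/seteqP; split => w /=.
  by move=> /eqP e v; rewrite inE => /eqP ->.
by move=> /(_ u); rewrite inE eqxx => /(_ isT) ->.
Qed.

Let dega u (ac : nat -> (word -> nat) -> bool) k l om := (om u == k) && all (ac^~ om) l.

Let measurable_dega u (ac : nat -> (word -> nat) -> bool) k l : (forall j, measurable [set om : env | ac j om]) ->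
  measurable [set om : env | dega u ac k l om].
Proof.
move=> ma; rewrite (_ : [set _ | _] = [set om : env | om u == k] `&` [set om : env | all (ac^~ om) l]).
  by apply: measurableI; [exact: measurable_degE|exact: (@measurable_all _ env)].
by apply/seteqP; split => om /= /andP.
Qed.

Let dega_pred u (l : seq nat) : pred word :=
  fun v => (v == u) || has (fun j => prefix (rcons u j) v) l.

Let dega_disj u l i : i \notin l -> forall v, dega_pred u l v -> ~~ prefix (rcons u i) v.
Proof.
move=> il v /orP[/eqP ->|/hasP[j jl /prefix_rcons_nth[_ e]]].
  by apply/negP => /prefix_rcons_nth[]; rewrite ltnn.
by apply/negP => /prefix_rcons_nth[_ e']; move: il; rewrite -e' e jl.
Qed.

Let dega_local u (ac : nat -> (word -> nat) -> bool) k l : (forall j, local (prefix (rcons u j)) (ac j)) ->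
  local (dega_pred u l) (dega u ac k l).
Proof.
move=> la om om' e; congr (_ && _); first by rewrite e // /dega_pred eqxx.
apply: eq_in_all => j jl; apply: la => v pv; apply: e.
by apply/orP; right; apply/hasP; exists j.
Qed.

(** The branching property: the subtrees of distinct children are independent of one another and of
    the degree of [u]. Children are added one at a time. In [EE_dega_fun] one further child carries
    a function instead of an event. *)
Lemma EE_dega u (ac : nat -> (word -> nat) -> bool) k l s : uniq l ->
  (forall j, measurable [set om : env | ac j om]) ->
  (forall j, local (prefix (rcons u j)) (ac j)) ->
  (forall j, EE (fun om => (ac j om)%:R) = s%:E) ->
  EE (fun om => ((om u == k) && all (ac^~ om) l)%:R) = (p k * s ^+ size l)%:E.
Proof.
move=> + ma la es; elim: l => [|i l IH] /=.
  by move=> _; rewrite mulr1 -(EE_deg u k); apply: eq_integral => w _; rewrite andbT.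
move=> /andP[il ul].
transitivity (EE (fun om => (dega u ac k l om)%:R * (ac i om)%:R)).
  apply: eq_integral => w _; congr (_%:E).
  by rewrite /dega; case: (_ == k); case: (ac i _); case: (all _ l); rewrite /= ?mulr1 ?mulr0.
rewrite (@EE_indep _ _ (dega_pred u l) (prefix (rcons u i))).
- by rewrite IH // es -EFinM exprSr mulrA.
- exact: dega_disj.
- exact: measurable_dega.
- exact: dega_local.
- by move=> om om' e; rewrite (la i om om' e).
- by move=> om.
- exact: (measurable_natr (Y := env)).
Qed.

Lemma EE_dega_fun u (ac : nat -> (word -> nat) -> bool) k l s i g : uniq l -> i \notin l ->
  (forall j, measurable [set om : env | ac j om]) ->
  (forall j, local (prefix (rcons u j)) (ac j)) ->
  (forall j, EE (fun om => (ac j om)%:R) = s%:E) ->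
  local (prefix (rcons u i)) g -> (forall om, 0 <= g om) -> menv g ->
  EE (fun om => ((om u == k) && all (ac^~ om) l)%:R * g om) = ((p k * s ^+ size l)%:E * EE g)%E.
Proof.
move=> ul il ma la es lg g0 mg; rewrite -(EE_dega k ul ma la es).
apply: (@EE_indep (dega u ac k l) _ (dega_pred u l) (prefix (rcons u i))) => //.
- exact: dega_disj.
- exact: measurable_dega.
- exact: dega_local.
Qed.

Lemma extp01 h : 0 <= extp p h <= 1.
Proof.
have /andP[h0 hq] : 0 <= extp p h <= q by exact: extp_bounds.
 rewrite h0 (le_trans hq) //.
have : 0 <= q <= 1 by exact: extinction01.
by case/andP.
Qed.

Lemma EE_ext h u : EE (fun om => (ext om h u)%:R) = (extp p h)%:E.
Proof.
elim: h u => [|h IH] u; first exact: (EE_cst 0).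
rewrite (EE_children u) //; last exact: (@measurable_natr _ env R _ (measurable_ext h.+1 u)).
transitivity (\sum_(k <oo) (p k * extp p h ^+ k)%:E)%E.
  apply: eq_eseriesr => k _.
  transitivity (EE (fun om => ((om u == k) && all (fun j => ext om h (rcons u j)) (iota 0 k))%:R)).
    apply: eq_integral => w _; congr (_%:E) => /=.
    by case: eqP => [->|_]; rewrite ?mul1r ?mul0r.
  rewrite (@EE_dega u (fun j om => ext om h (rcons u j)) k (iota 0 k) (extp p h)) ?size_iota ?iota_uniq //.
  - by move=> j; exact: measurable_ext.
  - by move=> j; exact: ext_local.
have /andP[h0 h1] := extp01 h.
rewrite eseries_EFin //; last by apply: is_cvg_gf; rewrite h0.
by move=> k; rewrite mulr_ge0 ?offspring_ge0 // exprn_ge0.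
Qed.

Lemma EE_alive u : EE (fun om => (alive om u)%:R) = (1 - q)%:E.
Proof.
rewrite EE_bool; last exact: measurable_alive.
pose F h := [set w | ext (nu w) h u].
have mF h : measurable (F h) by exact: (mset (measurable_ext h u)).
have mU : measurable (\bigcup_h F h) by exact: bigcupT_measurable.
have -> : [set w | alive (nu w) u] = ~` \bigcup_h F h.
  apply/seteqP; split => w /=; first by move=> /asboolP H [h _ Fh]; have := H h; rewrite [ext _ _ _]Fh.
  by move=> H; apply/asboolP => h; apply/negP => Fh; apply: H; exists h.
rewrite probability_setC // EFinB; congr (_ - _)%E.
have ndF : nondecreasing_seq F.
  by move=> i j ij; apply/subsetPset => w; exact: ext_le.
have c1 := nondecreasing_cvg_mu (mu := P) mF mU ndF.
have c2 : P \o F @ \oo --> q%:E.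
  rewrite (_ : P \o F = EFin \o extp p); first exact: (cvg_comp _ _ (cvg_extp (S := walk_supercritical))).
  by apply/funext => h; rewrite /= -(EE_ext h u) EE_bool //; exact: measurable_ext.
exact: (cvg_unique _ c1 c2).
Qed.

(** The events [alive], [ext] and the present one partition the space, an alive vertex having
    descendants at every height. *)
Lemma EE_dead_deep h u :
  EE (fun om => (~~ alive om u && ~~ ext om h u)%:R) = (q - extp p h)%:E.
Proof.
have mad : measurable [set om : env | ~~ alive om u && ~~ ext om h u].
  rewrite (_ : [set _ | _] = [set om : env | ~~ alive om u] `&` [set om : env | ~~ ext om h u]).
    by apply: measurableI; apply: (@measurable_negb _ env); [exact: measurable_alive|exact: measurable_ext].
  by apply/seteqP; split => om /= /andP.
have : EE (fun=> 1) = (EE (fun om => (alive om u)%:R%R) + EE (fun om => (ext om h u)%:R%R) +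
    EE (fun om => (~~ alive om u && ~~ ext om h u)%:R%R))%E.
  have m1 := @measurable_natr _ env R _ (measurable_alive u).
  have m2 := @measurable_natr _ env R _ (measurable_ext h u).
  rewrite -EED // -EED //.
  - apply: eq_integral => w _; congr (_%:E).
    have [aw|aw] := boolP (alive (nu w) u).
      by rewrite (negbTE (alive_ext h aw)) /= !addr0.
    by case: (ext _ _ _); rewrite /= ?addr0 ?add0r.
  - exact: (measurable_funD m1 m2).
  - exact: (@measurable_natr _ env R _ mad).
rewrite EE_cst EE_alive EE_ext; set z := EE _.
have z0 : (0 <= z)%E by exact: EE_ge0.
case: z z0 => [r _ /= | |] //.
by rewrite -!EFinD => -[e]; congr (_%:E); move: (extp p h) e => x e; lra.
Qed.

Lemma mean_ge0 : 0 <= m1.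
Proof. by apply: ltW; apply: lt_trans (offspring_mean_gt1 (supercritical := walk_supercritical)). Qed.

Lemma EE_mean u : EE (fun om => (om u)%:R) = m1%:E.
Proof.
rewrite (EE_children u) //; last exact: measurable_deg.
rewrite -eseries_EFin.
- apply: eq_eseriesr => k _; transitivity (EE (fun om => k%:R * (om u == k)%:R)).
    by apply: eq_integral => w _; congr (_%:E); case: eqP => [->|_]; rewrite ?mul1r ?mul0r ?mulr1 ?mulr0.
  rewrite EEZ // ?EE_deg //; exact: (@measurable_natr _ env R _ (measurable_degE u k)).
- by move=> k; rewrite mulr_ge0 // offspring_ge0.
- exact: offspring_cvg_mean.
Qed.

(** Wald's identity as an inequality: whether [u] has [k] children is independent of the subtree of
    each single child. *)
Lemma EE_sum_children (f : word -> (word -> nat) -> R) u c :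
  (forall v om, 0 <= f v om) -> (forall v, menv (f v)) ->
  (forall v, local (prefix v) (f v)) -> 0 <= c -> (forall v, EE (f v) <= c%:E)%E ->
  (EE (fun om => (\sum_(j <- iota 0 (om u)) f (rcons u j) om)%R) <= (m1 * c)%:E)%E.
Proof.
move=> f0 mf lf c0 fc.
have mS : menv (fun om => \sum_(j <- iota 0 (om u)) f (rcons u j) om).
  exact: measurable_sum_children.
rewrite (EE_children u) //; last by move=> om; exact: sumr_ge0.
have cc : cvgn (series (fun k => c * (k%:R * p k))).
  by apply: is_cvg_seriesZ; exact: offspring_cvg_mean.
have -> : m1 * c = limn (series (fun k => c * (k%:R * p k))).
  rewrite mulrC -[c * _]/(c *: _) -lim_seriesZ //; exact: offspring_cvg_mean.
rewrite -eseries_EFin //; last by move=> k; rewrite !mulr_ge0 // offspring_ge0.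
apply: lee_nneseries => [k _ _|k _].
  by apply: EE_ge0 => om; rewrite mulr_ge0 // sumr_ge0.
have mk := @measurable_natr _ env R _ (measurable_degE u k).
rewrite [leLHS](_ : _ =
    EE (fun om => \sum_(j <- iota 0 k) (om u == k)%:R * f (rcons u j) om)); last first.
  apply: eq_integral => w _; congr (_%:E).
  by case: eqP => [->|_]; rewrite ?mul0r ?mulr_sumr // big1 // => j _; rewrite mul0r.
rewrite EE_sum; last 2 first.
- by move=> j om; rewrite mulr_ge0.
- by move=> j; exact: (measurable_funM mk (mf _)).
apply: (@le_trans _ _ (\sum_(j <- iota 0 k) (p k * c)%:E)%E).
  apply: lee_sum => j _.
  have mt (i : nat) : measurable [set om : env | true].
    by rewrite (_ : [set _ | _] = setT) //; apply/seteqP; split.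
  have et (i : nat) : EE (fun om => true%:R) = 1%:E by exact: EE_cst.
  have lt (i : nat) : local (prefix (rcons u i)) (fun om => true) by [].
  have E := @EE_dega_fun u (fun _ _ => true) k [::] 1 j (f (rcons u j)) isT isT
    mt lt et (lf _) (f0 _) (mf _).
  rewrite [leLHS](_ : _ = EE (fun om => ((om u == k) && true)%:R * f (rcons u j) om)); last first.
    by apply: eq_integral => w _; rewrite andbT.
  rewrite E /= mulr1.
  by rewrite EFinM lee_wpmul2l // lee_fin offspring_ge0.
rewrite sumEFin big_const_seq count_predT size_iota iter_addr_0 lee_fin.
by rewrite -(mulr_natl (p k * c)) mulrA mulrC.
Qed.

(** Heights are counted from the child: when [u] is not deep, its finite subtrees reach at most
    depth [H] below [u] itself, as [trap_size] records. *)
Definition deep om H u :=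
  has (fun j => ~~ alive om (rcons u j) && ~~ ext om H (rcons u j)) (iota 0 (om u)).

Lemma measurable_dead_deep H v : measurable [set om : env | ~~ alive om v && ~~ ext om H v].
Proof.
rewrite (_ : [set _ | _] = [set om : env | ~~ alive om v] `&` [set om : env | ~~ ext om H v]).
  by apply: measurableI; apply: (@measurable_negb _ env); [exact: measurable_alive|exact: measurable_ext].
by apply/seteqP; split => om /= /andP.
Qed.

Lemma measurable_deep H u : measurable [set om : env | deep om H u].
Proof.
apply: (@measurable_count_set nat _ env (fun om => om u)
  (fun k => [set om | has (fun j => ~~ alive om (rcons u j) && ~~ ext om H (rcons u j)) (iota 0 k)])).
  by move=> k; exact: measurable_coord.
move=> k; under eq_set do rewrite -[has _ _]negbK -all_predC.
apply: (@measurable_negb _ env (fun om => all (fun j => ~~ (~~ alive om (rcons u j) && ~~ ext om H (rcons u j))) (iota 0 k))).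
apply: (@measurable_all _ env nat (fun j om => ~~ (~~ alive om (rcons u j) && ~~ ext om H (rcons u j)))) => j.
by apply: (@measurable_negb _ env); exact: measurable_dead_deep.
Qed.

Lemma deep_local H u : local (prefix u) (fun om => deep om H u).
Proof.
move=> om om' e; rewrite /deep (e u (prefix_refl u)); apply: eq_has => j.
by congr (~~ _ && ~~ _); [apply: alive_local|apply: ext_local] => v /prefix_rcons_trans; exact: e.
Qed.

Lemma EE_deep H u : (EE (fun om => (deep om H u)%:R) <= (m1 * (q - extp p H))%:E)%E.
Proof.
have /andP[_ hq] : 0 <= extp p H <= q by exact: extp_bounds.
have mf v := @measurable_natr _ env R _ (measurable_dead_deep H v).
apply: le_trans (@EE_sum_children
  (fun v om => (~~ alive om v && ~~ ext om H v)%:R) u (q - extp p H) _ _ _ _ _) => //.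
- apply: EE_le => //.
  + exact: (@measurable_natr _ env R _ (measurable_deep H u)).
  + exact: (@measurable_sum_children R (fun v om => (~~ alive om v && ~~ ext om H v)%:R) u mf).
  + move=> om; rewrite /deep; case: hasP => [[j jk dj]|_]; last exact: sumr_ge0.
    by rewrite (big_rem j) //= dj lerDl sumr_ge0.
- move=> v om om' e; congr ((~~ _ && ~~ _)%:R); [exact: alive_local|exact: ext_local].
- by rewrite subr_ge0.
- by move=> v; rewrite EE_dead_deep.
Qed.

Fixpoint Ebar (h : nat) : R :=
  if h is h'.+1 then (1 + beta * m1) + beta * gf' p q * Ebar h' else 0.

Lemma Ebar_ge0 h : 0 <= Ebar h.
Proof.
elim: h => //= h IH; apply: addr_ge0.
  by rewrite addr_ge0 // mulr_ge0 ?mean_ge0 // ltW // bias_gt0.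
by rewrite !mulr_ge0 // ltW // ?bias_gt0 // gf'q_gt0.
Qed.

Let b0 : 0 <= beta. Proof. by apply: ltW; exact: bias_gt0. Qed.

Lemma menv_trap h u : menv (fun om => (ext om h u)%:R * eh beta om h u).
Proof.
apply: measurable_funM; first exact: (@measurable_natr _ env R _ (measurable_ext h u)).
exact: measurable_eh.
Qed.

Lemma trap_ge0 h u om : 0 <= (ext om h u)%:R * eh beta om h u.
Proof. by rewrite mulr_ge0 // eh_ge0. Qed.

Lemma trap_local h u : local (prefix u) (fun om => (ext om h u)%:R * eh beta om h u).
Proof. by move=> om om' e; rewrite (@ext_local h u _ _ e) (@eh_local R beta h u _ _ e). Qed.

(** Given [k] children, one of them contributes its own time while the other [k - 1] must die out,
    which costs at most [q^(k-1)]. Summing [k p_k q^(k-1)] gives the factor [gf' p q] in [Ebar]. *)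
Lemma EE_trap h u : (EE (fun om => ((ext om h u)%:R * eh beta om h u)%R) <= (Ebar h)%:E)%E.
Proof.
elim: h u => [|h IH] u.
  rewrite /= (_ : EE _ = 0%E) //; apply: integral0_eq => w _; by rewrite mul0r.
have /andP[s0 sq] : 0 <= extp p h <= q by exact: extp_bounds.
have q01 : 0 <= q <= 1 by exact: extinction01.
have /andP[q0 q1] := q01.
have r0 : 0 <= gf' p q by apply: ltW; exact: gf'q_gt0.
rewrite (EE_children u); [|exact: trap_ge0|exact: menv_trap].
pose c1 k := (1 + beta * k%:R) * p k + beta * Ebar h * (k%:R * p k * q ^+ k.-1).
have cp : cvgn (series p) by apply/cvg_ex; exists 1; exact: offspring_sum.
have cm : cvgn (series (fun k => k%:R * p k)) by exact: offspring_cvg_mean.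
have cbm : cvgn (series (beta *: (fun k => k%:R * p k))) by exact: is_cvg_seriesZ.
have cr : cvgn (series (fun k => k%:R * p k * q ^+ k.-1)) by exact: is_cvg_gf'.
have cbr : cvgn (series ((beta * Ebar h) *: (fun k => k%:R * p k * q ^+ k.-1))).
  exact: is_cvg_seriesZ.
have c1E : c1 = p + beta *: (fun k => k%:R * p k) +
    (beta * Ebar h) *: (fun k => k%:R * p k * q ^+ k.-1).
  apply/funext => k; rewrite /c1.
  change ((1 + beta * k%:R) * p k + beta * Ebar h * (k%:R * p k * q ^+ k.-1) =
    p k + beta * (k%:R * p k) + beta * Ebar h * (k%:R * p k * q ^+ k.-1)).
  by ring.
have cc1 : cvgn (series c1).
  by rewrite c1E; apply: is_cvg_seriesD => //; exact: is_cvg_seriesD.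
have lc1 : limn (series c1) = Ebar h.+1.
  rewrite c1E lim_seriesD //; last exact: is_cvg_seriesD.
  rewrite lim_seriesD // !lim_seriesZ // (cvg_lim _ (offspring_sum (supercritical := walk_supercritical))) //.
  by rewrite /= -/(gf' p q); congr (_ + _); rewrite -[LHS]/(beta * Ebar h * gf' p q); ring.
rewrite -lc1 -eseries_EFin //; last first.
  by move=> k; rewrite /c1 addr_ge0 ?mulr_ge0 ?addr_ge0 ?mulr_ge0 ?offspring_ge0 ?Ebar_ge0 ?exprn_ge0.
apply: lee_nneseries => [k _ _|k _].
  by apply: EE_ge0 => om; rewrite mulr_ge0 // trap_ge0.
(* Child [j] keeps its own extinction indicator next to its time, so that the induction hypothesis
   applies to it; the others are listed by [rem]. *)
pose g j om := ((om u == k) && all (fun i => ext om h (rcons u i)) (rem j (iota 0 k)))%:R *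
  ((ext om h (rcons u j))%:R * eh beta om h (rcons u j)).
have mdeg := @measurable_natr _ env R _ (measurable_degE u k).
have mrem j : measurable [set om : env | (om u == k) && all (fun i => ext om h (rcons u i)) (rem j (iota 0 k))].
  rewrite (_ : [set _ | _] = [set om : env | om u == k] `&`
     [set om : env | all (fun i => ext om h (rcons u i)) (rem j (iota 0 k))]).
    apply: measurableI; first exact: measurable_degE.
    by apply: (@measurable_all _ env nat (fun i om => ext om h (rcons u i))) => i; exact: measurable_ext.
  by apply/seteqP; split => om /= /andP.
have mg j : menv (g j).
  apply: measurable_funM; last exact: menv_trap.
  exact: (@measurable_natr _ env R _ (mrem j)).
have g0 j om : 0 <= g j om by rewrite mulr_ge0 // trap_ge0.
apply: (@le_trans _ _ (EE (fun om => (1 + beta * k%:R) * (om u == k)%:R +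
    beta * \sum_(j <- iota 0 k) g j om))).
  apply: EE_le.
  - by move=> om; rewrite mulr_ge0 // trap_ge0.
  - by apply: measurable_funM => //; exact: menv_trap.
  - apply: measurable_funD; first by apply: measurable_funM => //; exact: measurable_cst.
    by apply: measurable_funM; [exact: measurable_cst|exact: (@measurable_sum _ env R)].
  move=> om; case: eqP => [e|ne]; last first.
    by rewrite mul0r mulr0 add0r mulr_ge0 // sumr_ge0.
  rewrite mul1r mulr1 /= e; case: (boolP (all _ _)) => A; last first.
    rewrite mul0r; apply: addr_ge0; last by rewrite mulr_ge0 // sumr_ge0.
    by rewrite addr_ge0 // mulr_ge0.
  rewrite mul1r lerD2l ler_wpM2l // big_seq [leRHS]big_seq.
  apply: ler_sum => j jk; rewrite /g e eqxx /=.
  rewrite (_ : all _ (rem j _) = true); last first.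
    by apply/allP => i /mem_rem; exact: (allP A).
  by rewrite (allP A j jk) !mul1r.
rewrite EED //; last 4 first.
- by move=> om; rewrite mulr_ge0 // addr_ge0 // mulr_ge0.
- by move=> om; rewrite mulr_ge0 // sumr_ge0.
- by apply: measurable_funM => //; exact: measurable_cst.
- by apply: measurable_funM; [exact: measurable_cst|exact: (@measurable_sum _ env R)].
rewrite EEZ //; last by rewrite addr_ge0 // mulr_ge0.
rewrite EE_deg EEZ //; last 2 first.
- by move=> om; exact: sumr_ge0.
- exact: (@measurable_sum _ env R).
rewrite EE_sum // /c1 [leRHS]EFinD [X in (_ <= X + _)%E]EFinM; apply: leeD => //.
apply: (@le_trans _ _ (beta%:E * \sum_(j <- iota 0 k) (p k * q ^+ k.-1 * Ebar h)%:E)%E).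
  apply: lee_wpmul2l; first by rewrite lee_fin.
  rewrite big_seq [leRHS]big_seq; apply: lee_sum => j jk.
  have -> : EE (g j) = ((p k * extp p h ^+ size (rem j (iota 0 k)))%:E *
      EE (fun om => ((ext om h (rcons u j))%:R * eh beta om h (rcons u j))%R))%E.
    apply: (@EE_dega_fun u (fun i om => ext om h (rcons u i)) k (rem j (iota 0 k)) (extp p h) j).
    - by rewrite rem_uniq // iota_uniq.
    - by rewrite rem_filter ?iota_uniq // mem_filter /= eqxx.
    - by move=> i; exact: measurable_ext.
    - by move=> i; exact: ext_local.
    - by move=> i; exact: EE_ext.
    - exact: trap_local.
    - exact: trap_ge0.
    - exact: menv_trap.
  rewrite size_rem // size_iota [leRHS]EFinM; apply: lee_pmul.
  - by rewrite lee_fin mulr_ge0 ?offspring_ge0 // exprn_ge0.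
  - by apply: EE_ge0 => om; exact: trap_ge0.
  - by rewrite lee_fin ler_wpM2l ?offspring_ge0 // lerXn2r ?nnegrE.
  - exact: IH.
rewrite sumEFin big_const_seq count_predT size_iota iter_addr_0 -EFinM lee_fin -mulr_natl.
rewrite le_eqVlt; apply/orP; left; apply/eqP; ring.
Qed.

(** Bounds the time spent at [u] and in the finite subtrees attached to it:
    [(beta - 1)^-1] bounds the expected number of returns to a backbone vertex,
    up to the factor coming from its degree. *)
Definition tau om H u : R := (1 + beta * (om u)%:R +
  beta * \sum_(j <- iota 0 (om u)) ((ext om H (rcons u j))%:R * eh beta om H (rcons u j))) / (beta - 1).

Let b1 : 0 < beta - 1. Proof. by rewrite subr_gt0; exact: bias_gt1. Qed.

Lemma tau_ge0 om H u : 0 <= tau om H u.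
Proof.
apply: divr_ge0; last exact: ltW.
apply: addr_ge0; first by rewrite addr_ge0 // mulr_ge0.
by rewrite mulr_ge0 // sumr_ge0 // => j _; exact: trap_ge0.
Qed.

Lemma menv_tau H u : menv (fun om => tau om H u).
Proof.
apply: measurable_funM; last exact: measurable_cst.
apply: measurable_funD.
  apply: measurable_funD; first exact: measurable_cst.
  by apply: measurable_funM; [exact: measurable_cst|exact: measurable_deg].
apply: measurable_funM; first exact: measurable_cst.
exact: (@measurable_sum_children R (fun v om => (ext om H v)%:R * eh beta om H v) u (menv_trap H)).
Qed.

Lemma tau_local H u : local (prefix u) (fun om => tau om H u).
Proof.
move=> om om' e; rewrite /tau (e u (prefix_refl u)); congr ((_ + _ * _) / _).
apply: eq_bigr => j _; apply: trap_local => v /prefix_rcons_trans; exact: e.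
Qed.

Lemma EE_tau H u : (EE (fun om => tau om H u) <=
  ((1 + beta * m1 + beta * (m1 * Ebar H)) / (beta - 1))%:E)%E.
Proof.
have mS := @measurable_sum_children R (fun v om => (ext om H v)%:R * eh beta om H v) u (menv_trap H).
have S0 om : 0 <= \sum_(j <- iota 0 (om u)) ((ext om H (rcons u j))%:R * eh beta om H (rcons u j)).
  by apply: sumr_ge0 => j _; exact: trap_ge0.
have mD : menv (fun om => beta * (om u)%:R).
  by apply: measurable_funM; [exact: measurable_cst|exact: measurable_deg].
have mbS : menv (fun om => beta * \sum_(j <- iota 0 (om u)) ((ext om H (rcons u j))%:R * eh beta om H (rcons u j))).
  by apply: measurable_funM => //; exact: measurable_cst.
have -> : EE (fun om => tau om H u) = EE (fun om => (beta - 1)^-1 * (1 + beta * (om u)%:R +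
  beta * \sum_(j <- iota 0 (om u)) ((ext om H (rcons u j))%:R * eh beta om H (rcons u j)))).
  by apply: eq_integral => w _; rewrite /tau mulrC.
have m1D : menv (fun om => 1 + beta * (om u)%:R) by apply: measurable_funD => //; exact: measurable_cst.
rewrite EEZ; last 3 first.
- by rewrite invr_ge0 ltW.
- by move=> om; rewrite !addr_ge0 ?mulr_ge0.
- exact: measurable_funD.
rewrite mulrC EFinM; apply: lee_wpmul2l; first by rewrite lee_fin invr_ge0 ltW.
rewrite EED //; last 2 first.
- by move=> om; rewrite addr_ge0 // mulr_ge0.
- by move=> om; rewrite mulr_ge0.
rewrite [leRHS]EFinD; apply: leeD.
  rewrite EED //; last by move=> om; rewrite mulr_ge0.
  by rewrite EE_cst EEZ // ?EE_mean //; exact: measurable_deg.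
rewrite EEZ // EFinM; apply: lee_wpmul2l; first by rewrite lee_fin.
apply: (@EE_sum_children (fun v om => (ext om H v)%:R * eh beta om H v)).
- by move=> v om; exact: trap_ge0.
- exact: menv_trap.
- exact: trap_local.
- exact: Ebar_ge0.
- exact: EE_trap.
Qed.

(** The recursion for [Ebar] is solved explicitly. The hypothesis on the bias says that its ratio
    exceeds 1, so that the highest traps dominate the mean time. *)
Lemma Ebar_le : exists2 C, 0 < C & forall h, Ebar h <= C * (beta * gf' p q) ^+ h.
Proof.
have r0 : 0 < gf' p q by exact: gf'q_gt0.
have br : 1 < beta * gf' p q by rewrite mulrC -ltr_pdivrMl // mulr1; exact: bias_gt.
have A0 : 0 < 1 + beta * m1 by rewrite ltr_wpDr // mulr_ge0 // mean_ge0.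
set b := beta * gf' p q in br *; set A := 1 + beta * m1 in A0.
have b10 : 0 < b - 1 by rewrite subr_gt0.
exists (A / (b - 1)); first by rewrite divr_gt0.
suff H h : Ebar h = A / (b - 1) * b ^+ h - A / (b - 1).
  by move=> h; rewrite H gerBl divr_ge0 // ltW.
elim: h => [|h IH] /=; first by rewrite mulr1 subrr.
rewrite IH -/A -/b exprS; field.
by rewrite gt_eqF.
Qed.

End Walk.

(** * The backbone and its potentials *)

Lemma rcons_neq (T : eqType) (s : seq T) x : (rcons s x == s) = false.
Proof. by apply/eqP => /(congr1 size)/eqP; rewrite size_rcons gtn_eqF. Qed.

Definition intree (om : word -> nat) (x : word) : bool :=
  all (fun i => nth 0%N x i < om (take i x))%N (iota 0 (size x)).

Lemma take_rcons_le (x : word) j i : (i <= size x)%N -> take i (rcons x j) = take i x.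
Proof.
move=> ix; rewrite -cats1 take_cat ltn_neqAle ix andbT.
by case: eqP => // ->; rewrite subnn take0 cats0 take_size.
Qed.

Lemma intree_rcons om x j : intree om (rcons x j) = intree om x && (j < om x)%N.
Proof.
rewrite /intree size_rcons -addn1 iotaD all_cat /= add0n andbT; congr (_ && _).
  apply: eq_in_all => i; rewrite mem_iota add0n => /andP[_ ix].
  by rewrite nth_rcons ix take_rcons_le // ltnW.
by rewrite nth_rcons ltnn eqxx take_rcons_le // take_size.
Qed.

Lemma mem_nbrs k v y : y \in nbrs k v ->
  [\/ v != [::] /\ y = parent v, exists2 j, (j < k)%N & y = rcons v j |
      [/\ v = [::], y = [::] & k = 0%N]].
Proof.
case: v => [|a v].
  rewrite /nbrs; case: eqP => [->|_]; first by rewrite inE => /eqP ->; apply: Or33.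
  by move=> /mapP[j]; rewrite mem_iota => /andP[_ jk] ->; apply: Or32; exists j.
rewrite /nbrs inE => /predU1P[->|/mapP[j]]; first by apply: Or31.
by rewrite mem_iota => /andP[_ jk] ->; apply: Or32; exists j.
Qed.

Lemma intree_nbrs om v y : intree om v -> y \in nbrs (om v) v -> intree om y.
Proof.
move=> iv /mem_nbrs[[v0 ->]|[j jk ->]|[_ -> _]] //; last by rewrite intree_rcons iv.
by case/lastP: v v0 iv => // v j _; rewrite parent_rcons intree_rcons => /andP[].
Qed.

Section Backbone.
Variable al : word -> bool.

(** The predicate [al] is left abstract because it has two instances: [alive], and, inside a finite
    trap, the property of lying on a branch of maximal depth. *)
Definition bbk (x : word) : bool := all (fun i => al (take i x)) (iota 0 (size x).+1).

(** Depth of the last backbone vertex on the path from the root to [x]. *)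
Definition lvl (x : word) : nat := (\sum_(i <- iota 1 (size x)) bbk (take i x))%N.

(** The backbone vertex to which the trap containing [x] is attached. *)
Definition proj (x : word) : word := take (lvl x) x.

Lemma bbk_rcons x j : bbk (rcons x j) = bbk x && al (rcons x j).
Proof.
rewrite /bbk size_rcons -addn1 iotaD all_cat add0n [all _ (iota _ 1)]/= andbT.
rewrite take_oversize ?size_rcons //; congr (_ && _); apply: eq_in_all => i.
by rewrite mem_iota add0n ltnS => /andP[_ ix]; rewrite take_rcons_le.
Qed.

Lemma bbk_nil : bbk [::] = al [::]. Proof. by rewrite /bbk /= andbT. Qed.

Lemma bbk_al x : bbk x -> al x.
Proof. by move=> /allP /(_ (size x)); rewrite mem_iota take_size ltnSn => /(_ isT). Qed.

Lemma bbk_prefix u x : prefix u x -> bbk x -> bbk u.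
Proof.
move=> /prefixP[t ->]; elim/last_ind: t => [|t j IH]; first by rewrite cats0.
by rewrite -rcons_cat bbk_rcons => /andP[/IH].
Qed.

Lemma lvl_rcons x j : lvl (rcons x j) = (lvl x + bbk (rcons x j))%N.
Proof.
rewrite /lvl size_rcons -[(size x).+1]addn1 iotaD big_cat big_seq1 add1n take_oversize ?size_rcons //.
congr (_ + _)%N; rewrite big_seq [RHS]big_seq; apply: eq_bigr => i.
by rewrite mem_iota add1n ltnS => /andP[_ ix]; rewrite take_rcons_le.
Qed.

Lemma lvl_nil : lvl [::] = 0%N. Proof. by rewrite /lvl big_nil. Qed.

Lemma lvl_bbk x : bbk x -> lvl x = size x.
Proof.
elim/last_ind: x => [|x j IH]; first by rewrite lvl_nil.
by move=> bx; rewrite lvl_rcons bx size_rcons IH ?addn1 //; move: bx; rewrite bbk_rcons => /andP[].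
Qed.

Lemma lvl_le_size x : (lvl x <= size x)%N.
Proof.
elim/last_ind: x => [|x j IH]; first by rewrite lvl_nil.
by rewrite lvl_rcons size_rcons -addn1 leq_add // leq_b1.
Qed.

Lemma lvl_child_dead x j : ~~ bbk (rcons x j) -> lvl (rcons x j) = lvl x.
Proof. by move=> b; rewrite lvl_rcons (negbTE b) addn0. Qed.

Lemma proj_child_dead x j : ~~ bbk (rcons x j) -> proj (rcons x j) = proj x.
Proof. by move=> b; rewrite /proj lvl_child_dead // take_rcons_le // lvl_le_size. Qed.

Lemma proj_bbk x : bbk x -> proj x = x.
Proof. by move=> b; rewrite /proj lvl_bbk // take_size. Qed.

Lemma bbk_proj x : al [::] -> bbk (proj x).
Proof.
move=> a0; elim/last_ind: x => [|x j IH]; first by rewrite /proj lvl_nil bbk_nil.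
by have [b|b] := boolP (bbk (rcons x j)); [rewrite proj_bbk|rewrite proj_child_dead].
Qed.

Lemma prefix_proj x : prefix (proj x) x.
Proof. exact: prefix_take. Qed.

Lemma size_proj x : size (proj x) = lvl x.
Proof. by rewrite size_takel // lvl_le_size. Qed.

Lemma lvl_ge_prefix u x : prefix u x -> bbk u -> (size u <= lvl x)%N.
Proof.
move=> /prefixP[t ->] bu; elim/last_ind: t => [|t j IH]; first by rewrite cats0 lvl_bbk.
by rewrite -rcons_cat lvl_rcons (leq_trans IH) // leq_addr.
Qed.

Lemma prefix_eq_size (u v x : word) : prefix u x -> prefix v x -> size u = size v -> u = v.
Proof.
by move=> /prefixP[t ->] /prefixP[t' e] s; have := congr1 (take (size u)) e;
   rewrite take_size_cat // s take_size_cat.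
Qed.

Lemma proj_eq u x : prefix u x -> bbk u -> lvl x = size u -> proj x = u.
Proof.
by move=> pu bu e; apply: (prefix_eq_size (prefix_proj x) pu); rewrite size_proj.
Qed.

(** A trap can be left only through the vertex it is attached to, and that vertex has the same level
    as the whole trap. *)
Lemma lvl_off_nbrs k x y : al [::] -> ~~ bbk x -> y \in nbrs k x -> lvl y = lvl x.
Proof.
move=> a0 nb /mem_nbrs[[x0 ->]|[j _ ->]|[e _ _]].
- by case/lastP: x nb x0 => // x j nb _; rewrite parent_rcons lvl_child_dead.
- by rewrite lvl_child_dead // bbk_rcons (negbTE nb).
- by move: nb; rewrite e bbk_nil a0.
Qed.

Lemma proj_off_nbrs k x y : al [::] -> ~~ bbk x -> y \in nbrs k x -> proj y = proj x.
Proof.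
move=> a0 nb /mem_nbrs[[x0 ->]|[j _ ->]|[e _ _]].
- by case/lastP: x nb x0 => // x j nb _; rewrite parent_rcons proj_child_dead.
- by rewrite proj_child_dead // bbk_rcons (negbTE nb).
- by move: nb; rewrite e bbk_nil a0.
Qed.

End Backbone.

(** * Superharmonic functions of the current vertex *)

Section Potentials.
Context {R : realType}.
Variable beta : R.
Hypothesis beta1 : 1 < beta.
Let b0 : 0 < beta. Proof. exact: lt_trans beta1. Qed.
Let bi0 : 0 < beta^-1. Proof. by rewrite invr_gt0. Qed.
Let bi1 : beta^-1 <= 1. Proof. by rewrite invf_le1 // ltW. Qed.

Lemma sum_iota_le (h : nat -> R) k j0 c c' : (j0 < k)%N -> h j0 <= c' ->
  (forall j, (j < k)%N -> h j <= c) -> \sum_(j <- iota 0 k) h j <= (k%:R - 1) * c + c'.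
Proof.
move=> jk hj hc.
have jin : j0 \in iota 0 k by rewrite mem_iota.
rewrite (big_rem j0) //= addrC; apply: lerD => //.
apply: (@le_trans _ _ (\sum_(j <- rem j0 (iota 0 k)) c)).
  rewrite big_seq [leRHS]big_seq; apply: ler_sum => j /mem_rem.
  by rewrite mem_iota => /andP[_ /hc].
rewrite big_const_seq count_predT size_rem // size_iota iter_addr_0.
by rewrite -(mulr_natl c) -subn1 natrB // (leq_trans _ jk).
Qed.

(** Superharmonicity of [beta^-lvl] at a vertex with a backbone child. *)
Lemma E1_decreasing om (h : word -> R) x c j0 : x != [::] -> 0 <= c ->
  h (parent x) <= beta * c -> (j0 < om x)%N -> h (rcons x j0) <= beta^-1 * c ->
  (forall j, (j < om x)%N -> h (rcons x j) <= c) -> E1 beta om h x <= c.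
Proof.
move=> x0 c0 hp jk hj hc; apply: (@E1_super R beta b0 om h x c (beta * c)) => //.
  by move=> e; rewrite e in x0.
have S := @sum_iota_le (fun j => h (rcons x j)) (om x) j0 c (beta^-1 * c) jk hj hc.
(* The excess at the parent is compensated exactly by the backbone child, so the bound is
   independent of the degree of [x]. *)
apply: (@le_trans _ _ (beta * c + beta * (((om x)%:R - 1) * c + beta^-1 * c))).
  by rewrite lerD2l ler_pM2l.
rewrite le_eqVlt; apply/orP; left; apply/eqP; field.
by rewrite gt_eqF.
Qed.

Section Crossing.
Variables (al : word -> bool) (om : word -> nat) (l : nat).
Hypothesis al0 : al [::].
Hypothesis al_child : forall x, bbk al x -> exists2 j, (j < om x)%N & al (rcons x j).
Hypothesis l0 : (0 < l)%N.

Let B : R := 2 / (beta - 1).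
Let B0 : 0 < B. Proof. by rewrite divr_gt0 // subr_gt0. Qed.
Let BB : B * beta = B + 2.
Proof. by rewrite /B; field; rewrite gt_eqF // subr_gt0. Qed.

(** Bounds the expected number of future crossings of level [l] of the backbone;
    [B] is the constant for which each crossing decreases it by one. *)
Definition crossW (x : word) : R :=
  if (lvl al x < l)%N then 1 + 2 / (beta - 1) else 2 / (beta - 1) * beta^-1 ^+ (lvl al x - l).

Definition cross (x y : word) : bool := (lvl al x < l)%N != (lvl al y < l)%N.

Lemma crossW_ge0 x : 0 <= crossW x.
Proof.
by rewrite /crossW -/B; case: ifP => _; [apply: addr_ge0|apply: mulr_ge0]; rewrite ?exprn_ge0 // ltW.
Qed.

Lemma crossW_le x : crossW x <= 1 + 2 / (beta - 1).
Proof.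
rewrite /crossW -/B; case: ifP => _ //; apply: (@le_trans _ _ B); last by rewrite lerDr.
by rewrite ler_piMr ?exprn_ile1 // ltW.
Qed.

Lemma crossW_super x :
  E1 beta om (fun y => crossW y + (cross x y)%:R) x <= crossW x.
Proof.
have [bx|nb] := boolP (bbk al x); last first.
  apply: (E1_bound b0) => y /(lvl_off_nbrs al0 nb) e.
  by rewrite /crossW /cross e eqxx addr0.
have [j0 j0k aj0] := al_child bx.
have lx := lvl_bbk bx.
have lc j : lvl al (rcons x j) = (size x + al (rcons x j))%N.
  by rewrite lvl_rcons bbk_rcons bx lx.
have lp : x != [::] -> (lvl al (parent x)).+1 = size x.
  case/lastP: x bx {j0k aj0 lx lc} => // x j; rewrite bbk_rcons => /andP[bx _] _.
  by rewrite parent_rcons size_rcons lvl_bbk.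
have [xl|lx'] := ltnP (size x) l.
  have WA : crossW x = 1 + B by rewrite /crossW lx xl.
  rewrite WA; apply: (E1_bound b0) => y /mem_nbrs[[x0 ->]|[j _ ->]|[-> -> _]].
  - have pl : (lvl al (parent x) < l)%N by rewrite -ltnS (lp x0) ltnS ltnW.
    by rewrite /crossW /cross lx xl pl eqxx addr0.
  - rewrite /crossW /cross lx xl lc -/B.
    case: (al (rcons x j)); last by rewrite addn0 xl addr0.
    rewrite addn1; case: ltnP => lS; first by rewrite addr0.
    have -> : ((size x).+1 - l = 0)%N by apply/eqP; rewrite subn_eq0.
    (* Going up to level [l], the potential drops from [1 + B] to [B], which pays for the
       crossing. *)
    by rewrite expr0 mulr1 addrC.
  - by rewrite /crossW /cross lvl_nil l0 eqxx addr0.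
have x0 : x != [::] by move: (leq_trans l0 lx'); case: (x).
have WA : crossW x = B * beta^-1 ^+ (size x - l) by rewrite /crossW lx ltnNge lx'.
rewrite WA; set c := B * _.
have c0 : 0 <= c by rewrite mulr_ge0 ?exprn_ge0 // ltW.
apply: (@E1_decreasing _ _ _ _ j0) => //.
- rewrite /crossW /cross lx [(size x < l)%N]ltnNge lx' /= -/B.
  move: (lp x0) lx' => <-; rewrite leq_eqVlt => /predU1P[e|lS].
    (* Going down from level [l] costs the new potential [1 + B] plus one crossing, and
       [B + 2 = B * beta] is all that superharmonicity allows at the parent. *)
    by rewrite /c -(lp x0) -e leqnn subnn expr0 mulr1 /= [leRHS]mulrC BB; lra.
  rewrite ltnNge -ltnS lS /= addr0 /c -(lp x0) subSn // exprS.
  by rewrite [leRHS](_ : _ = B * beta^-1 ^+ (lvl al (parent x) - l)) //; field; rewrite gt_eqF.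
- rewrite /crossW /cross lx lc aj0 addn1 !ltnNge lx' (leqW lx') /= addr0.
  by rewrite subSn // exprS /c mulrCA.
- move=> j _; rewrite /crossW /cross lx lc !ltnNge lx' (leq_trans lx') ?leq_addr //= addr0.
  rewrite /c -/B; case: (al _); last by rewrite addn0.
  by rewrite addn1 subSn // ler_wpM2l ?(ltW B0) // exprS ler_piMl // exprn_ge0 // ltW.
Qed.

End Crossing.

Section Trap.
Variables (om : word -> nat) (H : nat) (u : word).
Hypothesis al0 : alive om [::].
Hypothesis bu : bbk (alive om) u.
Hypothesis nd : ~~ deep om H u.
Local Notation al := (alive om).
Local Notation T := (tau (beta := beta) om H u).

(** Bounds the expected remaining time in the trap attached to [u]. *)
Definition trapV (x : word) : R :=
  if prefix u x then
    if proj al x == u then T + \sum_(i <- iota (size u).+1 (size x - size u)) eh beta om H (take i x)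
    else T * beta^-1 ^+ (lvl al x - size u)
  else T.

End Trap.

End Potentials.

Section Potentials.
Context {R : realType}.
Variable beta : R.
Hypothesis beta1 : 1 < beta.
Let b0 : 0 < beta. Proof. exact: lt_trans beta1. Qed.
Let bi0 : 0 < beta^-1. Proof. by rewrite invr_gt0. Qed.
Let bi1 : beta^-1 <= 1. Proof. by rewrite invf_le1 // ltW. Qed.
Let bm1 : 0 < beta - 1. Proof. by rewrite subr_gt0. Qed.

Lemma prefix_parent (u x : word) : prefix u x -> u != x -> prefix u (parent x).
Proof.
case/lastP: x => [|x j]; first by case: u.
rewrite parent_rcons => /prefixP[t e] ux; case/lastP: t e => [|t i].
  by rewrite cats0 => e; move: ux; rewrite e eqxx.
by rewrite -rcons_cat => /rcons_inj[-> _]; exact: prefix_prefix.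
Qed.

Lemma prefix_take_le (u x : word) i : prefix u x -> (size u <= i)%N -> prefix u (take i x).
Proof. by rewrite !prefixE => /eqP e ui; rewrite take_takel ?e. Qed.

Lemma size_parent_lt (x : word) : x != [::] -> (size (parent x) < size x)%N.
Proof. by case/lastP: x => // x j _; rewrite parent_rcons size_rcons. Qed.

Lemma parent_nprefix (x : word) : x != [::] -> ~~ prefix x (parent x).
Proof. by move=> /size_parent_lt; rewrite ltnNge; apply: contraNN; exact: size_prefix. Qed.

Section Trap.
Variables (om : word -> nat) (H : nat) (u : word).
Hypothesis al0 : alive om [::].
Hypothesis bu : bbk (alive om) u.
Hypothesis nd : ~~ deep om H u.
Local Notation al := (alive om).
Local Notation T := (tau (beta := beta) om H u).
Local Notation trapVu := (trapV beta om H u).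

Let T0 : 0 <= T.
Proof.
apply: divr_ge0; last exact: ltW.
apply: addr_ge0; first by rewrite addr_ge0 // mulr_ge0 // ltW.
apply: mulr_ge0; first exact: ltW.
by apply: sumr_ge0 => j _; rewrite mulr_ge0 // eh_ge0 // ltW.
Qed.

Lemma trapV_ge0 x : 0 <= trapVu x.
Proof.
rewrite /trapV; case: ifP => _ //; case: ifP => _; last by rewrite mulr_ge0 // exprn_ge0 // ltW.
by rewrite addr_ge0 // sumr_ge0 // => i _; rewrite eh_ge0 // ltW.
Qed.

Lemma trap_height x : intree om x -> prefix u x -> proj al x = u -> x != u ->
  ext om (H.+1 - (size x - size u)) x.
Proof.
elim/last_ind: x => [|x j IH].
  by move=> _ /prefixP[t]; case: (u).
rewrite intree_rcons => /andP[ix jx] pu pj xu.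
have nb : ~~ bbk al (rcons x j).
  by apply/negP => /proj_bbk e; move: xu; rewrite -pj e eqxx.
have pux : prefix u x by rewrite -(parent_rcons x j); apply: prefix_parent => //; rewrite eq_sym.
have sux := size_prefix pux.
rewrite proj_child_dead // in pj.
rewrite size_rcons [((size x).+1 - _)%N]subSn //.
have [e|xu'] := eqVneq x u.
  have na : ~~ al (rcons x j) by move: nb; rewrite bbk_rcons e bu.
  rewrite e subnn subSS subn0 -e; apply: contraNT nd => ne; apply/hasP; exists j; first by rewrite mem_iota -e.
  by rewrite -e na.
rewrite subnS; move: (IH ix pux pj xu'); case: (H.+1 - (size x - size u))%N => // h /allP /(_ j).
by rewrite mem_iota jx => /(_ isT).
Qed.

Lemma trap_ext x : intree om x -> prefix u x -> proj al x = u -> x != u -> ext om H x.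
Proof.
move=> ix pu pj xu; apply: ext_le (trap_height ix pu pj xu).
have sux := size_prefix pu.
suff : (0 < size x - size u)%N by case: (size x - size u)%N => // k _; rewrite subSS leq_subr.
rewrite subn_gt0 ltn_neqAle sux andbT; apply: contra xu => /eqP e.
by apply/eqP/esym; apply: (prefix_eq_size pu (prefix_refl x)).
Qed.

Lemma trap_size x : intree om x -> proj al x = u -> (size x <= size u + H)%N.
Proof.
move=> ix pj; have pu : prefix u x by rewrite -pj prefix_proj.
have [->|xu] := eqVneq x u; first exact: leq_addr.
have := trap_height ix pu pj xu; case E : (H.+1 - (size x - size u))%N => [//|k] _.
have : (0 < H.+1 - (size x - size u))%N by rewrite E.
by rewrite subn_gt0 ltnS leq_subLR.
Qed.

(** Inside the trap equality holds, since the time to climb back to [u] is the sum of [eh] over the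
    vertices on the way. At [u] itself the drift towards a backbone child gains [(beta - 1) T], and
    [tau] is defined so that this pays for the step and for the excursions into the finite subtrees.
    Further up the backbone the potential decays geometrically, and outside the subtree of [u] it is
    constant. *)
Lemma trapV_super x : intree om x ->
  E1 beta om trapVu x + (proj al x == u)%:R <= trapVu x.
Proof.
move=> ix; rewrite -lerBrDr.
have Vu : trapVu u = T.
  by rewrite /trapV prefix_refl proj_bbk // eqxx subnn big_nil addr0.
have Vout y : ~~ prefix u y -> trapVu y = T by move=> /negbTE e; rewrite /trapV e.
have Tsum : T * (beta - 1) = 1 + beta * (om u)%:R +
    beta * \sum_(j <- iota 0 (om u)) ((ext om H (rcons u j))%:R * eh beta om H (rcons u j)).
  by rewrite /tau divfK // gt_eqF.
have [pux|npux] := boolP (prefix u x); last first.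
  rewrite (_ : proj al x == u = false) ?subr0; last first.
    by apply: contraNF npux => /eqP <-; exact: prefix_proj.
  rewrite Vout //; apply: (E1_bound b0) => y /mem_nbrs[[x0 ->]|[j _ ->]|[e -> _]].
  - by rewrite Vout //; apply: contraNN npux => /prefix_trans; apply; exact: prefix_take.
  - have [pu|npu] := boolP (prefix u (rcons x j)); last by rewrite Vout.
    have [->|ne] := eqVneq (rcons x j) u; first by rewrite Vu.
    by move: npux; rewrite -(parent_rcons x j) prefix_parent // eq_sym.
  - by rewrite -e Vout.
have [pj|pj] := eqVneq (proj al x) u; last first.
  rewrite subr0.
  have lu : (size u < lvl al x)%N.
    rewrite ltn_neqAle lvl_ge_prefix // andbT; apply: contra pj => /eqP e.
    by apply/eqP; apply: proj_eq.
  have VT : trapVu x = T * beta^-1 ^+ (lvl al x - size u).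
    by rewrite /trapV pux (negbTE pj).
  have [bx|nb] := boolP (bbk al x); last first.
    rewrite VT; apply: (E1_bound b0) => y yn.
    have ly := lvl_off_nbrs al0 nb yn; have py := proj_off_nbrs al0 nb yn.
    have puy : prefix u y.
      have pup : prefix u (proj al x) by apply: prefix_take_le => //; exact: ltnW.
      by apply: (prefix_trans pup); rewrite -py; exact: prefix_proj.
    by rewrite /trapV puy py (negbTE pj) ly.
  have lx := lvl_bbk bx; rewrite lx in lu.
  have x0 : x != [::] by case: (x) lu.
  have ux : u != x by apply: contraTneq lu => ->; rewrite ltnn.
  have Vbb y : bbk al y -> prefix u y -> trapVu y = T * beta^-1 ^+ (size y - size u).
    move=> b pu; rewrite /trapV pu proj_bbk // lvl_bbk //; case: eqVneq => // ->.
    by rewrite subnn big_nil addr0 expr0 mulr1.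
  have [j0 j0k aj0] := alive_child (bbk_al bx).
  have c0 : 0 <= trapVu x by exact: trapV_ge0.
  have Vx := Vbb x bx pux.
  apply: (@E1_decreasing R beta beta1 om _ x _ j0) => //.
  - rewrite Vbb; last exact: prefix_parent.
    + rewrite Vx size_parent -(prednK (leq_ltn_trans (leq0n _) lu)) /=.
      have us : (size u <= (size x).-1)%N by rewrite -ltnS (prednK (leq_ltn_trans (leq0n _) lu)).
      rewrite subSn // exprS le_eqVlt; apply/orP; left; apply/eqP; field.
      by rewrite gt_eqF.
    + by apply: bbk_prefix bx; exact: prefix_take.
  - rewrite Vbb; last exact: (prefix_trans pux (prefix_rcons _ _)).
    + by rewrite Vx size_rcons subSn 1?ltnW // exprS mulrCA.
    + by rewrite bbk_rcons bx.
  - move=> j jk; have pj' : prefix u (rcons x j) by exact: (prefix_trans pux (prefix_rcons _ _)).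
    have [b|nb] := boolP (bbk al (rcons x j)).
      rewrite Vbb // Vx size_rcons ler_wpM2l //.
      by rewrite subSn 1?ltnW // exprS ler_piMl // exprn_ge0 // ltW.
    by rewrite /trapV pj' proj_child_dead // (negbTE pj) lvl_child_dead // pux.
pose g j := (ext om H (rcons x j))%:R * eh beta om H (rcons x j).
have Vchild j y : prefix u y -> proj al y = u -> ~~ bbk al (rcons y j) ->
    trapVu (rcons y j) = trapVu y + eh beta om H (rcons y j).
  move=> pu pr nb; have su := size_prefix pu.
  rewrite /trapV pu (prefix_trans pu (prefix_rcons _ _)) proj_child_dead // pr eqxx.
  rewrite size_rcons subSn // -[(size y - size u).+1]addn1 iotaD big_cat big_seq1 /=.
  rewrite addSn subnKC // [take _ (rcons y j)]take_oversize ?size_rcons // -addrA; congr (_ + (_ + _)).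
  rewrite big_seq [RHS]big_seq; apply: eq_bigr => i; rewrite mem_iota => /andP[_].
  by rewrite addSn subnKC // ltnS => iy; rewrite take_rcons_le.
have [xu|xu] := eqVneq x u.
  have [j0 j0k aj0] := alive_child (bbk_al bu).
  rewrite xu Vu; apply: (@E1_super R beta b0 om trapVu u (T - 1) T).
  - by move=> u0; rewrite Vout // parent_nprefix.
  - by move=> _; split; [exact: leq_ltn_trans j0k|rewrite gerBl].
  have S := @sum_iota_le R (fun j => trapVu (rcons u j) - g j) (om u) j0 T (beta^-1 * T) j0k.
  have g0 j : 0 <= g j by rewrite mulr_ge0 // eh_ge0 // ltW.
  have {}S : \sum_(j <- iota 0 (om u)) (trapVu (rcons u j) - g j) <= ((om u)%:R - 1) * T + beta^-1 * T.
    apply: S => [|j jk]; rewrite lerBlDr.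
      have bj : bbk al (rcons u j0) by rewrite bbk_rcons bu.
      rewrite /trapV prefix_rcons proj_bbk // lvl_bbk // size_rcons.
      rewrite (_ : rcons u j0 == u = false); last first.
        exact: rcons_neq.
      by rewrite subSn // subnn expr1 mulrC lerDl.
    have [b|nb] := boolP (bbk al (rcons u j)).
      rewrite /trapV prefix_rcons proj_bbk // lvl_bbk // size_rcons.
      rewrite (_ : rcons u j == u = false); last first.
        exact: rcons_neq.
      rewrite subSn // subnn expr1; apply: (@le_trans _ _ T); last by rewrite lerDl.
      by rewrite ler_piMr.
    rewrite Vchild ?prefix_refl ?proj_bbk // Vu lerD2l /g xu.
    have na : ~~ al (rcons u j) by move: nb; rewrite bbk_rcons bu.
    have -> : ext om H (rcons u j).
      apply: contraNT nd => ne; apply/hasP; exists j; first by rewrite mem_iota.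
      by rewrite na.
    by rewrite mul1r.
  rewrite big_split /= sumrN lerBlDr in S.
  have E : \sum_(j <- iota 0 (om u)) g j =
      \sum_(j <- iota 0 (om u)) ((ext om H (rcons u j))%:R * eh beta om H (rcons u j)).
    by rewrite /g xu.
  rewrite -E in Tsum; have := ler_pM2l b0; move=> /(_ _ _) M; move: S; rewrite -M {M}.
  move: Tsum; move: (\sum_(j <- _) g j) => G; move: (\sum_(j <- _) _) => Sv; move: T (om u)%:R => t k e.
  rewrite !mulrDr mulrBl mul1r mulrA divff ?gt_eqF // !mul1r => h.
  by nra.
have ex := trap_ext ix pux pj xu.
have x0 : x != [::] by apply: contraNneq xu => x0; move: pux; rewrite x0; case: (u).
have nb : ~~ bbk al x by apply: contraNN xu => /proj_bbk <-; apply/eqP.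
apply: (@E1_super R beta b0 om trapVu x _ (trapVu x - eh beta om H x)).
- move=> _; case/lastP: x x0 nb pux pj xu ex {ix g} => // x j _ nb pux pj xu ex.
  rewrite parent_rcons Vchild ?addrK //; last by rewrite -(proj_child_dead nb).
  by rewrite -(parent_rcons x j); apply: prefix_parent => //; rewrite eq_sym.
- by move=> e; move: x0; rewrite e.
have -> : \sum_(j <- iota 0 (om x)) trapVu (rcons x j) =
    (om x)%:R * trapVu x + \sum_(j <- iota 0 (om x)) eh beta om H (rcons x j).
  under eq_bigr do rewrite Vchild // ?bbk_rcons ?(negbTE nb) //.
  rewrite big_split /= big_const_seq count_predT size_iota iter_addr_0.
  by rewrite -(mulr_natl (trapVu x)).
rewrite {1}(eh_rec beta ex) le_eqVlt; apply/orP; left; apply/eqP.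
rewrite [nat_of_bool true]/=; move: (trapVu x) (\sum_(j <- _) _) => v Sv; ring.
Qed.

End Trap.

Section Stay.
Variables (om : word -> nat) (H : nat) (c : word).
Hypothesis c_nil : c != [::].
Hypothesis ic : intree om c.
Hypothesis hc : ext om H.+1 c.
Hypothesis nhc : ~~ ext om H c.
Let L := (size c + H)%N.

(** Vertices having a descendant at the level of the deepest descendants of [c]. *)
Let al x := ~~ ext om (L - size x) x.

(** All ancestors of [c] share its deepest descendants. This puts the whole way from the root to [c]
    on the substitute backbone. *)
Let al_prefix y t : c = y ++ t -> al y.
Proof.
elim: t y => [|j t IH] y e.
  by move: nhc; rewrite e cats0 /al /L e cats0 addKn.
have e' : c = rcons y j ++ t by rewrite cat_rcons.
have aj := IH _ e'.
have jy : (j < om y)%N.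
  move: ic; rewrite /intree => /allP /(_ (size y)).
  rewrite mem_iota e size_cat /= add0n -addSnnS leq_addr => /(_ isT).
  by rewrite nth_cat ltnn subnn take_size_cat.
have sy : (size y < L)%N by rewrite /L e size_cat /= -addnA addnS ltnS leq_addr.
rewrite /al -(subnSK sy) /=; apply/negP => /allP /(_ j).
by rewrite mem_iota jy => /(_ isT); apply/negP; move: aj; rewrite /al size_rcons.
Qed.

Let bc : bbk al c.
Proof. by apply/allP => i _; apply: (al_prefix (t := drop i c)); rewrite cat_take_drop. Qed.

Let al0 : al [::]. Proof. exact: (al_prefix (t := c)). Qed.

(** Since the subtree of [c] is finite, its branches reaching maximal depth play
    the part of the backbone, along which the walk drifts away from [c]. *)
Definition stayW (x : word) : R :=
  if prefix c x then beta^-1 ^+ ((lvl al x).+1 - size c) else 1.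

Lemma stayW_ge0 x : 0 <= stayW x.
Proof. by rewrite /stayW; case: ifP => // _; rewrite exprn_ge0 // ltW. Qed.

Lemma stayW_start : stayW c = beta^-1.
Proof. by rewrite /stayW prefix_refl lvl_bbk // subSn // subnn. Qed.

Lemma trap_depth x : intree om x -> prefix c x -> ext om (H.+1 - (size x - size c)) x.
Proof.
elim/last_ind: x => [|x j IH]; first by move=> _; rewrite prefixs0 => /eqP e; move: c_nil; rewrite e.
rewrite intree_rcons => /andP[ix jx] px.
have [e|ne] := eqVneq c (rcons x j); first by rewrite -e subnn subn0.
have px' : prefix c x by rewrite -(parent_rcons x j); exact: prefix_parent.
have sx := size_prefix px'.
move: (IH ix px'); rewrite size_rcons [((size x).+1 - _)%N]subSn // subnS.
case: (H.+1 - (size x - size c))%N => // m /= /allP /(_ j).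
by rewrite mem_iota jx => /(_ isT).
Qed.

(** Superharmonicity fails only at the deepest vertices of the substitute backbone, which are
    leaves: the walk must step back to the parent, where the value is [beta^-H]. Since the value is
    [beta^-1] at [c] and 1 outside, leaving within [t] steps has probability at most
    [beta^-1 + t beta^-H]. *)
Lemma stayW_super x : intree om x -> prefix c x ->
  E1 beta om stayW x <= stayW x + beta^-1 ^+ H.
Proof.
move=> ix px; have dx := trap_depth ix px; have sx := size_prefix px.
have dH : (size x - size c <= H)%N.
  by rewrite leqNgt; apply/negP => hd; move: dx; rewrite (eqP hd).
have d0 : 0 <= beta^-1 ^+ H by rewrite exprn_ge0 // ltW.
have x0 : x != [::] by case: (x) sx c_nil => //; case: (c).
have [bx|nb] := boolP (bbk al x); last first.
  apply: (@le_trans _ _ (stayW x)); last by rewrite lerDl.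
  apply: (E1_bound b0) => y yn; have ly := lvl_off_nbrs al0 nb yn.
  suff py : prefix c y by rewrite /stayW py px ly.
  case: (mem_nbrs yn) => [[_ ->]|[j _ ->]|[e]]; last by rewrite e in x0.
    by apply: prefix_parent => //; apply: contraNneq nb => <-.
  by rewrite (prefix_trans px) // prefix_rcons.
have lx := lvl_bbk bx.
have Wx : stayW x = beta^-1 ^+ ((size x).+1 - size c) by rewrite /stayW px lx.
have Wp : stayW (parent x) = beta^-1 ^+ (size x - size c).
  have [<-|ne] := eqVneq c x; first by rewrite /stayW (negbTE (parent_nprefix c_nil)) subnn.
  rewrite /stayW prefix_parent // lvl_bbk; last by apply: bbk_prefix bx; exact: prefix_take.
  by rewrite size_parent prednK //; case: (x) x0.
move: dH; rewrite leq_eqVlt => /predU1P[e|lt].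
  have k0 : om x = 0%N.
    move: dx; rewrite e subSn // subnn /=; case: (om x) => //.
  apply: (E1_bound b0) => y; rewrite k0.
  have -> : nbrs 0 x = [:: parent x] by case: (x) x0.
  by rewrite inE => /eqP ->; rewrite Wp e lerDr stayW_ge0.
apply: (@le_trans _ _ (stayW x)); last by rewrite lerDl.
have [j jk aj] : exists2 j, (j < om x)%N & al (rcons x j).
  have sxL : (size x < L)%N by rewrite /L -ltn_subLR.
  have := bbk_al bx; rewrite /al -(subnSK sxL) /= -has_predC => /hasP[j].
  by rewrite mem_iota => /andP[_ jk] nj; exists j => //; rewrite size_rcons.
have pxj i : prefix c (rcons x i) by rewrite (prefix_trans px) // prefix_rcons.
apply: (@E1_decreasing R beta beta1 om _ x _ j) => //.
- exact: stayW_ge0.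
- by rewrite Wp Wx subSn // exprS mulrA divff ?mul1r // gt_eqF.
- by rewrite /stayW pxj lvl_rcons bbk_rcons bx aj lx px addn1 [in leLHS]subSn 1?leqW // exprS.
- move=> i ik; rewrite /stayW pxj px lvl_rcons lx.
  by apply: ler_wiXn2l => //; [exact: ltW|rewrite leq_sub2r // ltnS leq_addr].
Qed.

End Stay.
End Potentials.

(** * First visits and level crossings *)

Section PrefixDetermined.
Variables (al al' : word -> bool) (x : word).
Hypothesis e : forall i, (i <= size x)%N -> al (take i x) = al' (take i x).

Lemma eq_bbk_take k : (k <= size x)%N -> bbk al (take k x) = bbk al' (take k x).
Proof.
move=> kx; apply: eq_in_all => i; rewrite size_takel // mem_iota add0n ltnS => /andP[_ ik].
by rewrite take_takel // e // (leq_trans ik).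
Qed.

Lemma eq_bbk : bbk al x = bbk al' x.
Proof. by have := eq_bbk_take (leqnn _); rewrite take_size. Qed.

Lemma eq_lvl : lvl al x = lvl al' x.
Proof.
rewrite /lvl big_seq [RHS]big_seq; apply: eq_bigr => i.
by rewrite mem_iota add1n ltnS => /andP[_ ix]; rewrite eq_bbk_take.
Qed.

Lemma eq_proj : proj al x = proj al' x.
Proof. by rewrite /proj eq_lvl. Qed.

End PrefixDetermined.

(** [lvl], [proj] and [bbk] at [x] depend on [om] through the finite vector
    [alvec] only, which makes them measurable. *)
Definition alvec (a : (word -> nat) -> word -> bool) (x : word) (om : word -> nat) : seq bool :=
  [seq a om (take i x) | i <- iota 0 (size x).+1].

Definition vecal (v : seq bool) : word -> bool := fun y => nth false v (size y).

Lemma vecal_alvec a x om i : (i <= size x)%N ->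
  a om (take i x) = vecal (alvec a x om) (take i x).
Proof.
move=> ix; rewrite /vecal size_takel // (nth_map 0%N) ?size_iota ?ltnS //.
by rewrite nth_iota.
Qed.

Lemma measurable_alvec (a : (word -> nat) -> word -> bool) (x : word) (v : seq bool) : (forall y, measurable [set om : env | a om y]) ->
  measurable [set om : env | alvec a x om = v].
Proof.
move=> ma; rewrite /alvec; elim: (iota _ _) v => [|i l IH] [|b v] /=.
- by rewrite (_ : [set _ | _] = setT) //; apply/seteqP; split.
- by rewrite (_ : [set _ | _] = set0) //; apply/seteqP; split.
- by rewrite (_ : [set _ | _] = set0) //; apply/seteqP; split.
rewrite (_ : [set _ | _] = [set om : env | a om (take i x) = b] `&`
    [set om : env | [seq a om (take i x) | i <- l] = v]); last first.
  by apply/seteqP; split => om /= [-> ->].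
apply: measurableI; last exact: IH.
case: b; first exact: ma.
rewrite (_ : [set _ | _] = [set om : env | ~~ a om (take i x)]).
  exact: (@measurable_negb _ env).
by apply/seteqP; split => om /= => [->|/negbTE].
Qed.

Lemma measurable_cstb d (Y : measurableType d) (b : bool) : measurable [set _ : Y | b].
Proof.
case: b; first by rewrite (_ : [set _ | _] = setT) //; apply/seteqP; split.
by rewrite (_ : [set _ | _] = set0) //; apply/seteqP; split.
Qed.

Lemma measurable_vec_bool (a : (word -> nat) -> word -> bool) (x : word) (F : (word -> bool) -> bool) :
  (forall y, measurable [set om : env | a om y]) ->
  (forall al al', (forall i, (i <= size x)%N -> al (take i x) = al' (take i x)) -> F al = F al') ->
  measurable [set om : env | F (a om)].
Proof.
move=> ma HF.
rewrite (_ : [set _ | _] = [set om : env | F (vecal (alvec a x om))]).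
  apply: (@measurable_count_set (seq bool) _ env (alvec a x) (fun v => [set om | F (vecal v)])) => v.
    exact: measurable_alvec.
  exact: measurable_cstb.
by apply/seteqP; split => om /=; rewrite (HF _ _ (fun i => @vecal_alvec a x om i)).
Qed.

Lemma measurable_vec_fun (R : realType) (a : (word -> nat) -> word -> bool) (x : word) (F : (word -> bool) -> env -> R) :
  (forall y, measurable [set om : env | a om y]) ->
  (forall al al' om, (forall i, (i <= size x)%N -> al (take i x) = al' (take i x)) -> F al om = F al' om) ->
  (forall al, measurable_fun setT (F al)) ->
  measurable_fun setT (fun om : env => F (a om) om).
Proof.
move=> ma HF mF.
rewrite (_ : (fun om => _) = (fun om => F (vecal (alvec a x om)) om)); last first.
  by apply/funext => om; exact: (HF _ _ om (fun i => @vecal_alvec a x om i)).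
apply: (@measurable_fun_count (seq bool) _ _ env R (alvec a x) (fun v om => F (vecal v) om)) => v.
  exact: measurable_alvec.
exact: mF.
Qed.

Definition mb (b : (word -> nat) -> seq word -> bool) : Prop :=
  forall s, measurable [set om : env | b om s].

Lemma mb_and b b' : mb b -> mb b' -> mb (fun om s => b om s && b' om s).
Proof.
move=> h h' s; rewrite (_ : [set _ | _] = [set om : env | b om s] `&` [set om : env | b' om s]).
  exact: measurableI.
by apply/seteqP; split => om /= /andP.
Qed.

Lemma mb_neg b : mb b -> mb (fun om s => ~~ b om s).
Proof. by move=> h s; exact: (@measurable_negb _ env). Qed.

Lemma mb_path (b : seq word -> bool) : mb (fun om s => b s).
Proof. by move=> s; exact: measurable_cstb. Qed.

Lemma mb_alive (f : seq word -> word) : mb (fun om s => alive om (f s)).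
Proof. by move=> s; exact: measurable_alive. Qed.

Lemma mb_deep H (f : seq word -> word) : mb (fun om s => deep om H (f s)).
Proof. by move=> s; exact: measurable_deep. Qed.

Lemma mb_bbk (f : seq word -> word) : mb (fun om s => bbk (alive om) (f s)).
Proof.
move=> s; apply: (@measurable_vec_bool alive (f s) (fun al => bbk al (f s))).
  exact: measurable_alive.
by move=> al al' e; exact: eq_bbk.
Qed.

Lemma mb_lvl (f : seq word -> word) (Q : nat -> seq word -> bool) :
  mb (fun om s => Q (lvl (alive om) (f s)) s).
Proof.
move=> s; apply: (@measurable_vec_bool alive (f s) (fun al => Q (lvl al (f s)) s)).
  exact: measurable_alive.
by move=> al al' e; rewrite (eq_lvl e).
Qed.

Lemma mb_proj (f g : seq word -> word) : mb (fun om s => proj (alive om) (f s) == g s).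
Proof. exact: (mb_lvl f (fun k s => take k (f s) == g s)). Qed.

Definition prev (s : seq word) : word := nth [::] s (size s - 2).

Lemma prev_rcons s y : s != [::] -> prev (rcons s y) = last [::] s.
Proof.
case/lastP: s => // s x _; rewrite /prev !size_rcons subn2 /= last_rcons.
by rewrite !nth_rcons !size_rcons leqnn ltnn eqxx.
Qed.

(** Along a valid path this amounts to a first visit to the last vertex, a subtree being entered
    through its root. The form with prefixes is the one that independence requires. *)
Definition fresh (s : seq word) : bool := all (fun v => ~~ prefix (last [::] s) v) (take (size s).-1 s).

Lemma fresh_rcons s y : fresh (rcons s y) = all (fun v => ~~ prefix y v) s.
Proof. by rewrite /fresh size_rcons last_rcons -cats1 take_size_cat. Qed.

Lemma valid_intree om s : valid om s -> all (intree om) s.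
Proof.
elim/last_ind: s => [//|s y IH].
have [->|s0] := eqVneq s [::]; first by rewrite /= andbT => /eqP ->.
rewrite valid_rcons // => /andP[/IH h st]; rewrite all_rcons h andbT.
apply: intree_nbrs st; apply: (allP h).
by case: (s) s0 => // x s' _; rewrite /= mem_last.
Qed.

Lemma valid_last_intree om s : valid om s -> intree om (last [::] s).
Proof.
move=> v; apply: (allP (valid_intree v)); case: s v => // x s _.
by rewrite /= mem_last.
Qed.

Lemma alive_bbk om x : intree om x -> alive om x -> bbk (alive om) x.
Proof.
elim/last_ind: x => [|x j IH]; first by rewrite bbk_nil.
rewrite intree_rcons bbk_rcons => /andP[ix jx] ax; rewrite ax andbT.
by apply: IH => //; exact: alive_parent ax.
Qed.

(** From outside, the subtree of [u] can be entered only at [u], so the first time spent in it is a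
    fresh visit to [u]. *)
Lemma first_visit om s u j : valid om s -> (j < size s)%N -> prefix u (nth [::] s j) ->
  exists2 i, (i <= j)%N & nth [::] s i = u /\ fresh (take i.+1 s).
Proof.
elim/last_ind: s j => [//|s y IH] j.
have [->|s0] := eqVneq s [::].
  rewrite /= andbT => /eqP ->; case: j => // _; rewrite prefixs0 => /eqP ->.
  by exists 0%N.
move=> v js pu.
have vs : valid om s by move: v; rewrite valid_rcons // => /andP[].
have [js'|js'] := ltnP j (size s).
  rewrite nth_rcons js' in pu; have [i ij [e f]] := IH j vs js' pu.
  have is' := leq_ltn_trans ij js'.
  by exists i => //; rewrite nth_rcons is' -cats1 takel_cat.
have [/hasP[x xs px]|nh] := boolP (has (prefix u) s).
  have ks : (index x s < size s)%N by rewrite index_mem.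
  have [|i ij [e f]] := IH (index x s) vs ks; first by rewrite nth_index.
  have is' := leq_ltn_trans ij ks.
  exists i; first exact: leq_trans (ltnW is') js'.
  by rewrite nth_rcons is' -cats1 takel_cat.
have js2 : j = size s by apply/eqP; rewrite eqn_leq js' andbT -ltnS -(size_rcons s y).
rewrite js2 nth_rcons ltnn eqxx in pu.
have ls : last [::] s \in s by case: (s) s0 => // x s' _; rewrite /= mem_last.
have npl : ~~ prefix u (last [::] s) by move/hasPn: nh; apply.
have yu : y = u.
  move: v; rewrite valid_rcons // => /andP[_ /mem_nbrs[[x0 e]|[k _ e]|[e e' _]]].
  - by move: npl; rewrite (prefix_trans pu) // e; exact: prefix_take.
  - rewrite e in pu *; apply/esym/eqP; apply: contraNT npl => ne.
    by rewrite -(parent_rcons (last [::] s) k) prefix_parent.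
  - by move: npl; rewrite e -e' pu.
exists (size s); first by rewrite js2.
rewrite nth_rcons ltnn eqxx take_oversize ?size_rcons //; split => //.
by rewrite fresh_rcons yu; apply/allP => x /(hasPn nh).
Qed.

Section Walk.
Context {R : realType} {p : nat -> R} {q beta : R} {d : measure_display}
  {Omega : measurableType d} {P : probability Omega R}
  {nu : Omega -> word -> nat} {X : Omega -> nat -> word}.
Context {W : galton_watson_walk p q beta P nu X}.
Local Notation Ex := (Ex P nu X).
Implicit Types (G : (word -> nat) -> seq word -> R) (b : (word -> nat) -> seq word -> bool).

Let beta1 : 1 < beta. Proof. exact: bias_gt1. Qed.
Let b0 : 0 < beta. Proof. exact: bias_gt0. Qed.

Lemma Ex_sum (I : Type) (l : seq I) n (F : I -> (word -> nat) -> seq word -> R) :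
  (forall i, adm (F i)) ->
  Ex n (fun om s => \sum_(i <- l) F i om s) = (\sum_(i <- l) Ex n (F i))%E.
Proof.
move=> aF; elim: l => [|i l IH].
  by rewrite big_nil; apply: integral0_eq => w _; rewrite big_nil.
rewrite big_cons -IH -ExD //.
- by apply: eq_integral => w _; rewrite big_cons.
- split => [om s|s]; first by apply: sumr_ge0 => k _; case: (aF k).
  by apply: (@measurable_sum _ env R) => k; case: (aF k).
Qed.

Lemma adm_mb b : mb b -> adm (fun om s => (b om s)%:R : R).
Proof. exact: adm_bool. Qed.

Lemma adm_crossW l : adm (fun om s => crossW beta (alive om) l (last [::] s)).
Proof.
split => [om s|s]; first exact: crossW_ge0.
apply: (@measurable_vec_fun R alive (last [::] s) (fun al om => crossW beta al l (last [::] s))).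
- exact: measurable_alive.
- by move=> al al' om e; rewrite /crossW (eq_lvl e).
- by move=> al; exact: measurable_cst.
Qed.

Definition crossb (l : nat) om (s : seq word) := cross (alive om) l (prev s) (last [::] s).

Lemma mb_cross l : mb (crossb l).
Proof.
move=> s.
have h := mb_lvl prev (fun k s => (k < l)%N).
have h' := mb_lvl (last [::]) (fun k s => (k < l)%N).
have H := mb_neg (mb_and (mb_neg (mb_and h (mb_neg h'))) (mb_neg (mb_and (mb_neg h) h'))).
rewrite (_ : [set _ | _] = [set om : env | ~~ (~~ ((lvl (alive om) (prev s) < l)%N &&
    ~~ (lvl (alive om) (last [::] s) < l)%N) && ~~ (~~ (lvl (alive om) (prev s) < l)%N &&
    (lvl (alive om) (last [::] s) < l)%N))]); first exact: H.
by apply/seteqP; split => om; rewrite /crossb /cross /=; do 2 case: (_ < _)%N.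
Qed.

(** The event [b] belongs to the past of [n0], so it stays frozen while the potential evolves. Used
    from time 0 to bound all crossings of a level, and from the first time at backbone level [2 n]
    with [l = n], when the potential is already of order [beta^-n], to bound backtracking. *)
Lemma cross_count n0 N l b : mb b -> (0 < l)%N -> (n0 <= N)%N ->
  (\sum_(n0 <= j < N)
     Ex j.+1 (fun om s => (b om (take n0.+1 s) && alive om [::] && crossb l om s)%:R%R) <=
   Ex n0 (fun om s => ((b om s && alive om [::])%:R * crossW beta (alive om) l (last [::] s))%R))%E.
Proof.
move=> hb l0 nN.
pose bb om s := b om (take n0.+1 s) && alive om [::].
have hbb : mb bb by apply: mb_and; [move=> s; exact: hb|exact: (mb_alive (fun=> [::]))].
pose Phi om s := (bb om s)%:R * crossW beta (alive om) l (last [::] s).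
pose c0 om s := (bb om s && crossb l om s)%:R : R.
have aPhi : adm Phi by apply: admM; [exact: adm_mb|exact: adm_crossW].
have ac0 : adm c0 by apply: adm_mb; apply: mb_and => //; exact: mb_cross.
have aE : adm (E1op beta c0) by exact: adm_E1op.
have := supermartingale (W := W) aPhi aE nN.
have e0 : Ex n0 Phi = Ex n0 (fun om s => ((b om s && alive om [::])%:R * crossW beta (alive om) l (last [::] s))%R).
  by apply: eq_integral => w _; rewrite /Phi /bb take_oversize // size_traj.
rewrite e0 => SM.
apply: le_trans (SM _); last first.
  move=> om s ns v; rewrite /Phi /c0 /E1op.
  have s0 : s != [::] by case: (s) ns.
  have bbr y : bb om (rcons s y) = bb om s.
    by rewrite /bb -cats1 takel_cat.
  have [bs|nb] := boolP (bb om s); last first.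
    rewrite mul0r -[leRHS]addr0; apply: lerD; apply: (E1_bound b0) => y _.
      by rewrite bbr (negbTE nb) mul0r.
    by rewrite bbr (negbTE nb).
  have a0 : alive om [::] by move: bs => /andP[].
  rewrite mul1r -[leLHS](_ : E1 beta om (fun y => crossW beta (alive om) l y +
      (cross (alive om) l (last [::] s) y)%:R) (last [::] s) = _).
    apply: crossW_super => // x bx; exact: (alive_child (bbk_al bx)).
  rewrite /E1 -big_split; apply: eq_bigr => y _ /=.
  by rewrite bbr bs mul1r -mulrDr last_rcons /crossb prev_rcons // last_rcons.
rewrite -[leLHS]adde0; apply: leeD; last exact: Ex_ge0.
rewrite le_eqVlt; apply/orP; left; apply/eqP; apply: eq_bigr => j _.
by rewrite -markov.
Qed.

Definition C1 : R := (1 + 2 / (beta - 1)) / (1 - q).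

Let q1 : 0 < 1 - q. Proof. by rewrite subr_gt0; exact: q_lt1. Qed.

Let A1 : 1 <= 1 + 2 / (beta - 1).
Proof. by rewrite lerDl divr_ge0 // subr_ge0 ltW. Qed.

Lemma C1_ge1 : 1 <= C1.
Proof.
rewrite /C1 ler_pdivlMr // mul1r; apply: le_trans A1.
by rewrite gerBl ltW //; exact: q_gt0.
Qed.

Let freshl l s := fresh s && (size (last [::] s) == l).

Lemma fresh_not_prefix n s : size s = n.+1 -> fresh s ->
  {in take n s, forall u, ~~ prefix (last [::] s) u}.
Proof. by move=> ss /allP h u; rewrite -[n]/(n.+1.-1) -ss => /h. Qed.

(** An alive vertex of the tree has alive ancestors, so a fresh visit to it crosses its backbone
    level; this bounds the alive fresh vertices. A fresh vertex is alive with probability [1 - q]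
    independently of the past, hence the quotient in [C1]. *)
Lemma fresh_count_level l N : (0 < l)%N ->
  (\sum_(0 <= j < N.+1) Ex j (fun om s => (freshl l s)%:R%R) <= C1%:E)%E.
Proof.
move=> l0; rewrite big_nat_recl //.
rewrite [X in (X + _)%E](_ : _ = 0%E) ?add0e; last first.
  apply/eqP; rewrite eq_le; apply/andP; split; last by apply: Ex_ge0; exact: adm_path.
  rewrite -(_ : Ex 0 (fun _ _ => 0) = 0%E); last by apply: integral0_eq.
  apply: Ex_le_valid => [||om s]; [exact: adm_path|exact: adm_cst|].
  case: s => // x [|//] _ /=; rewrite andbT => /eqP ->.
  by rewrite /freshl /= eq_sym (negbTE (lt0n_neq0 l0)) ?andbF.
have key : (\sum_(0 <= j < N)
    Ex j.+1 (fun om s => ((freshl l s)%:R * (alive om (last [::] s))%:R)%R) <=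
    (1 + 2 / (beta - 1))%:E)%E.
  have := @cross_count 0%N N l (fun _ _ => true) (mb_path (fun=> true)) l0 (leq0n _).
  move=> H; apply: le_trans (le_trans H _).
    apply: lee_sum => j _; apply: Ex_le_valid => [||om s sj v].
    - by apply: admM; [exact: adm_path|apply: adm_mb; exact: mb_alive].
    - by apply: adm_mb; apply: mb_and (mb_cross l); apply: mb_and; [exact: mb_path|exact: (mb_alive (fun=> [::]))].
    have [/andP[fs /eqP sl]|_] := boolP (freshl l s); last by rewrite mul0r.
    have [ay|_] := boolP (alive om (last [::] s)); last by rewrite mulr0.
    rewrite mul1r ler1n lt0b andTb.
    case/lastP: s sj v fs sl ay => // s y; rewrite size_rcons => -[ss].
    have s0 : s != [::] by case: (s) ss.
    rewrite last_rcons /crossb prev_rcons // => v fs sl ay.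
    have iy : intree om y by have := valid_last_intree v; rewrite last_rcons.
    have byy := alive_bbk iy ay.
    have a0 : alive om [::] by rewrite -bbk_nil; apply: bbk_prefix byy; exact: prefix0s.
    rewrite a0 /=.
    have ls : last [::] s \in s by case: (s) s0 => // x s' _; rewrite /= mem_last.
    move: v; rewrite valid_rcons // => /andP[_ /mem_nbrs[[x0 e]|[k _ e]|[_ e _]]].
    - by move: fs; rewrite fresh_rcons e => /allP /(_ _ ls); rewrite prefix_take.
    - rewrite last_rcons /cross (lvl_bbk byy) sl ltnn.
      have bx : bbk (alive om) (last [::] s) by move: byy; rewrite e bbk_rcons => /andP[].
      by rewrite (lvl_bbk bx) -sl e size_rcons ltnSn.
    - by move: l0; rewrite -sl e.
  apply: (@le_trans _ _ (Ex 0 (fun _ _ => 1 + 2 / (beta - 1)))).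
    apply: Ex_le => [||om s].
    - by apply: admM; [apply: adm_mb; apply: mb_and; [exact: mb_path|exact: (mb_alive (fun=> [::]))]|exact: adm_crossW].
    - by apply: adm_cst; rewrite (le_trans ler01 A1).
    apply: le_trans (crossW_le beta1 (alive om) l (last [::] s)).
    by apply: ler_piMl; [exact: crossW_ge0|rewrite lern1 leq_b1].
  by rewrite (_ : Ex 0 _ = EE P nu (fun=> 1 + 2 / (beta - 1))) // EE_cst.
rewrite -(@lee_pmul2l _ (1 - q)%:E) ?lte_fin //.
rewrite -EFinM mulrCA divff ?mulr1 ?gt_eqF //.
apply: le_trans key; rewrite ge0_sume_distrr; last by move=> j _; apply: Ex_ge0; exact: adm_path.
apply: lee_sum => j _.
apply: (@fresh_ge _ _ _ _ _ _ _ _ _ W (freshl l) (fun u om => (alive om u)%:R)) => //.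
- by move=> s ss /andP[fs _]; exact: fresh_not_prefix.
- by move=> u; exact: (@measurable_natr _ env R _ (measurable_alive u)).
- by move=> u om; rewrite (local_restr (@alive_local u)).
- exact: ltW.
- by move=> u; have := EE_alive (W := W) u; rewrite /EE => ->.
Qed.

Lemma fresh_count n N :
  (\sum_(0 <= j < N.+1) Ex j (fun om s => (fresh s && (size (last [::] s) < n)%N)%:R%R) <=
   (n%:R * C1)%:E)%E.
Proof.
elim: n => [|n IH].
  rewrite mul0r big1 // => j _; rewrite (_ : Ex j _ = Ex j (fun _ _ => 0)).
    by apply: integral0_eq.
  by apply: eq_integral => w _; rewrite andbF.
rewrite -natr1 mulrDl mul1r EFinD.
apply: (@le_trans _ _ (\sum_(0 <= j < N.+1) Ex j (fun om s => (fresh s && (size (last [::] s) < n)%N)%:R%R) +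
   \sum_(0 <= j < N.+1) Ex j (fun om s => (freshl n s)%:R%R))%E).
  rewrite -big_split /=; apply: lee_sum => j _; rewrite -ExD; [|exact: adm_path|exact: adm_path].
  apply: Ex_le => [||om s]; [exact: adm_path|by apply: admD; exact: adm_path|].
  rewrite /freshl ltnS leq_eqVlt; case: (fresh s) => //=; last by rewrite addr0.
  by case: eqP => [->|_] /=; rewrite ?ltnn ?add0r ?addr0.
apply: leeD => //.
(* The root is a prefix of every word, so it is fresh at time 0 only; its single visit is covered by
   [1 <= C1]. *)
have [->|n0] := posnP n; last exact: fresh_count_level.
apply: (@le_trans _ _ 1%E); last by rewrite lee_fin C1_ge1.
rewrite big_nat_recl // [X in (_ + X)%E]big1 ?adde0.
  apply: (@le_trans _ _ (Ex 0 (fun _ _ => 1))).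
    by apply: Ex_le => [||om s]; [exact: adm_path|exact: adm_cst|rewrite lern1 leq_b1].
  by rewrite (_ : Ex 0 _ = EE P nu (fun=> 1)) // EE_cst.
move=> j _; apply/eqP; rewrite eq_le; apply/andP; split; last by apply: Ex_ge0; exact: adm_path.
rewrite -(_ : Ex j.+1 (fun _ _ => 0) = 0%E); last by apply: integral0_eq.
apply: Ex_le_valid => [||om s sj v]; [exact: adm_path|exact: adm_cst|].
rewrite /freshl; case: s sj v => // x [//|y s] _ _; rewrite /fresh size_eq0.
by case: eqP => [->|_]; rewrite ?andbF //= prefix0s.
Qed.

End Walk.

(** * Hitting times are not too large *)

Section Walk.
Context {R : realType} {p : nat -> R} {q beta : R} {d : measure_display}
  {Omega : measurableType d} {P : probability Omega R}
  {nu : Omega -> word -> nat} {X : Omega -> nat -> word}.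
Context {W : galton_watson_walk p q beta P nu X}.
Local Notation Ex := (Ex P nu X).
Local Notation m1 := (limn (series (fun k => k%:R * p k))).
Local Notation r := (gf' p q).

Let beta1 : 1 < beta. Proof. exact: bias_gt1. Qed.
Let b0 : 0 < beta. Proof. exact: bias_gt0. Qed.

Section TrapTime.
Variables (n H : nat).

Definition freshn (s : seq word) := fresh s && (size (last [::] s) < n)%N.

Definition good_trap om (u : word) := [&& alive om [::], bbk (alive om) u & ~~ deep om H u].

(** Traps are indexed by the time [i] of the first visit to their base vertex: sums then run over a
    finite range, and the base is fresh at time [i]. *)
Definition in_trap i om s :=
  (freshn (take i.+1 s) && good_trap om (nth [::] s i)) && (proj (alive om) (last [::] s) == nth [::] s i).

Lemma mb_good_trap (f : seq word -> word) : mb (fun om s => good_trap om (f s)).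
Proof.
apply: mb_and; first exact: (mb_alive (fun=> [::])).
by apply: mb_and; [exact: mb_bbk|apply: mb_neg; exact: mb_deep].
Qed.

Lemma mb_in_trap i : mb (in_trap i).
Proof.
apply: mb_and; last exact: mb_proj.
by apply: mb_and; [exact: (mb_path (fun s => freshn (take i.+1 s)))|exact: mb_good_trap].
Qed.

Definition taubar : R := (1 + beta * m1 + beta * (m1 * Ebar (p := p) (q := q) (beta := beta) H)) / (beta - 1).

Lemma taubar_ge0 : 0 <= taubar.
Proof.
have M : 0 <= m1 by exact: mean_ge0.
have E : 0 <= Ebar (p := p) (q := q) (beta := beta) H by exact: Ebar_ge0.
rewrite /taubar divr_ge0 //; last by rewrite subr_ge0 ltW.
by rewrite !addr_ge0 // !mulr_ge0 // ltW.
Qed.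

Lemma adm_trapV i : adm (fun om s => trapV beta om H (nth [::] s i) (last [::] s)).
Proof.
split => [om s|s]; first exact: trapV_ge0.
set u := nth _ _ _; set x := last _ _.
pose F (al : word -> bool) (om : word -> nat) : R :=
  if prefix u x then
    if proj al x == u then tau (beta := beta) om H u + \sum_(i <- iota (size u).+1 (size x - size u)) eh beta om H (take i x)
    else tau (beta := beta) om H u * beta^-1 ^+ (lvl al x - size u)
  else tau (beta := beta) om H u.
apply: (@measurable_vec_fun R alive x F).
- exact: measurable_alive.
- by move=> al al' om e; rewrite /F (eq_lvl e) (eq_proj e).
move=> al; rewrite /F; case: (prefix u x); last exact: (@menv_tau R beta H _).
case: (proj al x == u).
  apply: measurable_funD; first exact: (@menv_tau R beta H _).
  by apply: (@measurable_sum _ env R) => j; exact: measurable_eh.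
by apply: measurable_funM; [exact: (@menv_tau R beta H _)|exact: measurable_cst].
Qed.

(** The supermartingale starts at the first visit, where [trapV] equals [tau]. That quantity depends
    on the fresh subtree only, so its average factors out. *)
Lemma trap_time i N : (i <= N)%N ->
  (\sum_(i <= j < N) Ex j (fun om s => (in_trap i om s)%:R%R) <=
   taubar%:E * Ex i (fun om s => (freshn s)%:R%R))%E.
Proof.
move=> iN.
pose g om s := freshn (take i.+1 s) && good_trap om (nth [::] s i).
have hg : mb g.
  by apply: mb_and; [exact: (mb_path (fun s => freshn (take i.+1 s)))|exact: mb_good_trap].
pose Phi om s := (g om s)%:R * trapV beta om H (nth [::] s i) (last [::] s).
have aPhi : adm Phi by apply: admM; [exact: adm_mb|exact: adm_trapV].
have aC : adm (fun om s => (in_trap i om s)%:R : R) by apply: adm_mb; exact: mb_in_trap.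
have SM := supermartingale (W := W) aPhi aC iN.
apply: (@le_trans _ _ (Ex i Phi)).
  apply: le_trans (SM _).
    by rewrite -[leLHS]adde0; apply: leeD => //; exact: Ex_ge0.
  move=> om s si v; rewrite /Phi /E1op.
  have gr y : g om (rcons s y) = g om s.
    by rewrite /g nth_rcons si -cats1 takel_cat.
  have nr y : nth [::] (rcons s y) i = nth [::] s i by rewrite nth_rcons si.
  rewrite /in_trap -/(g om s); have [gs|ngs] := boolP (g om s); last first.
    rewrite mul0r -[leRHS]addr0; apply: lerD => //; apply: (E1_bound b0) => y _.
    by rewrite gr (negbTE ngs) mul0r.
  have /and3P[a0 bu nd] : good_trap om (nth [::] s i) by case/andP: gs.
  rewrite mul1r andTb -[X in X + _](_ : E1 beta om (trapV beta om H (nth [::] s i)) (last [::] s) = _).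
    by apply: trapV_super => //; exact: valid_last_intree v.
  by rewrite /E1; apply: eq_bigr => y _; rewrite gr gs nr last_rcons mul1r.
apply: (@le_trans _ _ (Ex i (fun om s => ((freshn s)%:R * tau (beta := beta) om H (last [::] s))%R))).
  have atau : adm (fun om s => tau (beta := beta) om H (last [::] s)).
    by split => [om s|s]; [exact: (tau_ge0 (W := W))|exact: (@menv_tau R beta H _)].
  apply: Ex_le_valid => // [|om s si v].
    by apply: admM => //; exact: adm_path.
  rewrite /Phi /g take_oversize ?si // (_ : nth [::] s i = last [::] s); last by rewrite (last_nth [::]); case: (s) si => // x s' [<-].
  case: (freshn s); last by rewrite !mul0r.
  rewrite mul1r; have [/and3P[_ bu _]|_] := boolP (good_trap _ _); last by rewrite mul0r tau_ge0.
  by rewrite mul1r /trapV prefix_refl proj_bbk // eqxx subnn big_nil addr0.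
apply: (@fresh_le _ _ _ _ _ _ _ _ _ W freshn (fun u om => tau (beta := beta) om H u)).
- by move=> s ss /andP[fs _]; exact: fresh_not_prefix.
- by move=> u om; exact: (tau_ge0 (W := W)).
- by move=> u; exact: (@menv_tau R beta H _).
- by move=> u om; exact: (local_restr (@tau_local R beta H u) om).
- exact: taubar_ge0.
- by move=> u; have := EE_tau (W := W) H u; rewrite /EE.
Qed.

Definition meets_deep N om s :=
  has (fun i => freshn (take i.+1 s) && deep om H (nth [::] s i)) (iota 0 N.+1).

Lemma mb_meets_deep N : mb (meets_deep N).
Proof.
rewrite /meets_deep => s; elim: (iota _ _) => [|i l IH] /=; first exact: measurable_cstb.
have h := mb_neg (mb_and (mb_neg (mb_and (mb_path (fun s => freshn (take i.+1 s))) (mb_deep H (nth [::]^~ i)))) (mb_neg (fun=> IH))) s.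
rewrite (_ : [set _ | _] = [set om : env | ~~ (~~ (freshn (take i.+1 s) && deep om H (nth [::] s i)) &&
   ~~ has (fun i => freshn (take i.+1 s) && deep om H (nth [::] s i)) l)]); first exact: h.
by apply/seteqP; split => om /=; rewrite negb_and !negbK.
Qed.

Lemma deep_count N : (Ex N (fun om s => (meets_deep N om s)%:R%R) <=
  (m1 * (q - extp p H) * (n%:R * C1 (q := q) (beta := beta)))%:E)%E.
Proof.
have M : 0 <= m1 by exact: mean_ge0.
have qe : 0 <= q - extp p H.
  have /andP[_ h] : 0 <= extp p H <= q by exact: extp_bounds.
  by rewrite subr_ge0.
pose F (i : nat) om s := (freshn s)%:R * (deep om H (last [::] s))%:R : R.
have aF i : adm (F i).
  by apply: admM; [exact: adm_path|apply: adm_mb; exact: mb_deep].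
have aFt i : adm (fun om s => F i om (take i.+1 s)) by apply: (adm_comp (take i.+1)).
apply: (@le_trans _ _ (\sum_(i <- iota 0 N.+1) Ex N (fun om s => F i om (take i.+1 s)))%E).
  rewrite -Ex_sum //; apply: Ex_le_valid => [||om s sN v].
  - by apply: adm_mb; exact: mb_meets_deep.
  - split => [om s|s]; first by apply: sumr_ge0 => i _; case: (aFt i).
    by apply: (@measurable_sum _ env R) => i; case: (aFt i).
  rewrite /meets_deep; case: hasP => [[i iN h]|_]; last by apply: sumr_ge0 => i _; case: (aFt i).
  rewrite (big_rem i) //= (_ : F i om _ = 1).
    by rewrite lerDl; apply: sumr_ge0 => k _; case: (aFt k).
  have si : (i < size s)%N by move: iN; rewrite mem_iota sN.
  move: h => /andP[fs dp]; rewrite /F fs (last_nth [::]) (_ : nth _ _ _ = nth [::] s i) ?dp ?mul1r //.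
  by rewrite size_takel //= nth_take.
rewrite [leLHS](_ : _ = \sum_(0 <= i < N.+1) Ex i (F i))%E; last first.
  rewrite /index_iota subn0 big_seq [RHS]big_seq; apply: eq_bigr => i.
  by rewrite mem_iota add0n ltnS => /andP[_ iN]; rewrite Ex_take.
apply: (@le_trans _ _ (\sum_(0 <= i < N.+1) (m1 * (q - extp p H))%:E * Ex i (fun om s => (freshn s)%:R%R))%E).
  apply: lee_sum => i _.
  apply: (@fresh_le _ _ _ _ _ _ _ _ _ W freshn (fun u om => (deep om H u)%:R)) => //.
  - by move=> s ss /andP[fs _]; exact: fresh_not_prefix.
  - by move=> u; exact: (@measurable_natr _ env R _ (measurable_deep H u)).
  - by move=> u om; rewrite (local_restr (@deep_local H u)).
  - exact: mulr_ge0.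
  - by move=> u; have := EE_deep (W := W) H u; rewrite /EE.
rewrite -ge0_sume_distrr; last by move=> i _; apply: Ex_ge0; exact: adm_path.
rewrite [leRHS]EFinM; apply: lee_wpmul2l; first by rewrite lee_fin mulr_ge0.
exact: fresh_count.
Qed.

Definition below om (s : seq word) := alive om [::] && all (fun v => size v < n)%N s.

Lemma mb_below : mb below.
Proof. by apply: mb_and; [exact: (mb_alive (fun=> [::]))|exact: mb_path]. Qed.

(** Before level [n] is reached, every time step is spent in the trap of a vertex
    below level [n], and few such vertices are ever visited. *)
Lemma below_le N : (Ex N (fun om s => (below om s)%:R%R) <=
  (n%:R * C1 (q := q) (beta := beta) * (m1 * (q - extp p H) + taubar / N.+1%:R))%:E)%E.
Proof.
have C0 : 0 <= C1 (q := q) (beta := beta) by apply: le_trans (C1_ge1 (W := W)).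
pose Bd om s := below om s && ~~ meets_deep N om s.
have mBd : mb Bd by apply: mb_and; [exact: mb_below|apply: mb_neg; exact: mb_meets_deep].
rewrite mulrDr EFinD.
apply: (@le_trans _ _ (Ex N (fun om s => (meets_deep N om s)%:R%R) + Ex N (fun om s => (Bd om s)%:R%R))%E).
  rewrite -ExD; [|by apply: adm_mb; exact: mb_meets_deep|exact: adm_mb].
  apply: Ex_le => [||om s]; first by apply: adm_mb; exact: mb_below.
    by apply: admD; apply: adm_mb => //; exact: mb_meets_deep.
  by rewrite /Bd; case: (below _ _); case: (meets_deep _ _ _); rewrite /= ?addr0 ?add0r ?lexx ?ler01 ?addr_ge0.
apply: leeD.
  by apply: le_trans (deep_count N) _; rewrite lee_fin mulrC.
have N0 : 0 < N.+1%:R :> R by rewrite ltr0n.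
(* On the event [Bd] all [N.+1] instants are spent in traps, so [N.+1] times its probability is at
   most the expected total time in traps. *)
rewrite -(@lee_pmul2l _ N.+1%:R%:E) ?lte_fin // -EFinM.
have -> : N.+1%:R * (n%:R * C1 (q := q) (beta := beta) * (taubar / N.+1%:R)) =
    n%:R * C1 (q := q) (beta := beta) * taubar.
  by field; rewrite addrC natr1 gt_eqF.
pose c i j om s := (i <= j)%N && in_trap i om (take j.+1 s).
have mc i j : mb (c i j).
  by apply: mb_and; [exact: (mb_path (fun=> (i <= j)%N))|move=> s; exact: mb_in_trap].
have ac i j : adm (fun om s => (c i j om s)%:R : R) by exact: adm_mb.
have aS i : adm (fun om s => \sum_(j <- iota 0 N.+1) (c i j om s)%:R : R).
  split => [om s|s]; first by apply: sumr_ge0.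
  by apply: (@measurable_sum _ env R) => j; case: (ac i j).
rewrite -(ExZ N (ltW N0) (adm_mb mBd)).
apply: (@le_trans _ _ (Ex N (fun om s => (\sum_(i <- iota 0 N.+1) \sum_(j <- iota 0 N.+1) (c i j om s)%:R)%R))).
  apply: Ex_le_valid => [||om s sN v].
  - by apply: admM; [exact: adm_cst|exact: adm_mb].
  - split => [om s|s]; first by apply: sumr_ge0 => i _; apply: sumr_ge0.
    by apply: (@measurable_sum _ env R) => i; case: (aS i).
  have [/andP[/andP[a0 /allP bel] nd]|_] := boolP (Bd om s); last first.
    by rewrite mulr0; apply: sumr_ge0 => i _; apply: sumr_ge0.
  rewrite mulr1 exchange_big /= -[X in X%:R](size_iota 0) -sum1_size natr_sum.
  rewrite big_seq [leRHS]big_seq; apply: ler_sum => j; rewrite mem_iota add0n => /andP[_ jN].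
  have js : (j < size s)%N by rewrite sN.
  have ij := allP (valid_intree v) _ (mem_nth [::] js).
  (* The trap occupied at time [j] is attached to [u]. As an ancestor of the current vertex, [u]
     lies below level [n], and it was first visited at some [i <= j]. *)
  set u := proj (alive om) (nth [::] s j).
  have pu : prefix u (nth [::] s j) by exact: prefix_proj.
  have [i ile [iu fi]] := first_visit v js pu.
  have iN : i \in iota 0 N.+1 by rewrite mem_iota add0n (leq_ltn_trans ile).
  rewrite (big_rem i) //= (_ : c i j om s = true) ?lerDl ?sumr_ge0 //.
  have fn : freshn (take i.+1 s).
    rewrite /freshn fi (last_nth [::]) size_takel ?(leq_ltn_trans ile) //= nth_take // iu.
    by apply: leq_ltn_trans (bel _ (mem_nth [::] js)); exact: size_prefix.
  have ndi : ~~ deep om H (nth [::] s i).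
    by apply: contraNN nd => h; apply/hasP; exists i => //; rewrite fn.
  have ns k : (k <= j)%N -> nth [::] (take j.+1 s) k = nth [::] s k by move=> kj; rewrite nth_take.
  have lj : last [::] (take j.+1 s) = nth [::] s j.
    by rewrite (last_nth [::]) size_takel // -[nth _ (_ :: _) _]/(nth [::] (take j.+1 s) j) ns.
  by rewrite /c ile /in_trap lj take_takel // fn /good_trap a0 ns // ndi iu bbk_proj // -/u eqxx.
rewrite Ex_sum // [_ * taubar]mulrC.
apply: (@le_trans _ _ (\sum_(0 <= i < N.+1) taubar%:E * Ex i (fun om s => (freshn s)%:R%R))%E).
  rewrite /index_iota subn0 big_seq [leRHS]big_seq; apply: lee_sum => i.
  rewrite mem_iota add0n ltnS => /andP[_ iN]; rewrite Ex_sum //.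
  apply: le_trans (trap_time (leqW iN)).
  rewrite le_eqVlt; apply/orP; left; apply/eqP.
  rewrite -[iota 0 N.+1]/(index_iota 0 N.+1) (@big_cat_nat _ _ _ i) //=; last exact: leqW.
  rewrite big_nat_cond big1 ?add0e.
    rewrite big_nat [RHS]big_nat; apply: eq_bigr => j /andP[ij jN].
    by rewrite /c ij -(@Ex_take _ _ _ P nu X j N (fun om s => (in_trap i om s)%:R)).
  move=> j; rewrite andbT => /andP[_ ji].
  by apply: integral0_eq => w _; rewrite /c leqNgt ji.
rewrite -ge0_sume_distrr; last by move=> i _; apply: Ex_ge0; exact: adm_path.
rewrite [leRHS]EFinM; apply: lee_wpmul2l; first by rewrite lee_fin taubar_ge0.
exact: fresh_count.
Qed.

End TrapTime.

End Walk.

(** * Hitting times are not too small *)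

Lemma nth_size_last (s : seq word) i : size s = i.+1 -> nth [::] s i = last [::] s.
Proof. by move=> e; rewrite -nth_last e. Qed.

Definition first_at (l : nat) (s : seq word) : bool :=
  (size (last [::] s) == l) && all (fun v => size v < l)%N (take (size s).-1 s).

Lemma first_at_fresh l s : first_at l s -> fresh s.
Proof.
move=> /andP[/eqP sl /allP h]; apply/allP => v /h vl; apply/negP => /size_prefix.
by rewrite sl leqNgt vl.
Qed.

Lemma first_at_rcons l s y : first_at l (rcons s y) = (size y == l) && all (fun v => size v < l)%N s.
Proof. by rewrite /first_at last_rcons size_rcons -cats1 take_size_cat. Qed.

Lemma first_at_take l s i : (i < size s)%N ->
  first_at l (take i.+1 s) = (size (nth [::] s i) == l) && all (fun v => size v < l)%N (take i s).
Proof. by move=> si; rewrite (take_nth [::]) // first_at_rcons. Qed.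

Lemma first_at_exists om s l j : valid om s -> (j < size s)%N -> (l <= size (nth [::] s j))%N ->
  exists2 i, (i <= j)%N & first_at l (take i.+1 s).
Proof.
elim/last_ind: s j => [//|s y IH] j v js lj.
have [s0|s0] := eqVneq s [::].
  move: v js lj; rewrite s0 /= andbT => /eqP ->; case: j => // _; rewrite leqn0 => /eqP ->.
  by exists 0%N.
have vs : valid om s by move: v; rewrite valid_rcons // => /andP[].
have [js'|js'] := ltnP j (size s).
  rewrite nth_rcons js' in lj; have [i ij f] := IH j vs js' lj.
  by exists i => //; rewrite -cats1 takel_cat // (leq_ltn_trans ij).
have [/hasP[x xs px]|nh] := boolP (has (fun v => l <= size v)%N s).
  have ks : (index x s < size s)%N by rewrite index_mem.
  have [|i ij f] := IH (index x s) vs ks; first by rewrite nth_index.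
  exists i; first exact: leq_trans (ltnW (leq_ltn_trans ij ks)) js'.
  by rewrite -cats1 takel_cat // (leq_ltn_trans ij).
have js2 : j = size s by apply/eqP; rewrite eqn_leq js' andbT -ltnS -(size_rcons s y).
rewrite js2 nth_rcons ltnn eqxx in lj.
have ls : last [::] s \in s by case: (s) s0 => // x s' _; rewrite /= mem_last.
have nl : (size (last [::] s) < l)%N by move/hasPn: nh => /(_ _ ls); rewrite -ltnNge.
exists (size s); first by rewrite js2.
rewrite take_oversize ?size_rcons // first_at_rcons eqn_leq lj andbT; apply/andP; split.
  move: v; rewrite valid_rcons // => /andP[_ /mem_nbrs[[_ e]|[k _ e]|[_ e _]]]; rewrite e //.
    by rewrite size_parent (leq_trans (leq_pred _)) // ltnW.
  by rewrite size_rcons.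
by apply/allP => x /(hasPn nh); rewrite -ltnNge.
Qed.

Lemma first_at_mono s l l' i i' : (i < size s)%N -> (i' < size s)%N -> (l <= l')%N ->
  first_at l (take i.+1 s) -> first_at l' (take i'.+1 s) -> (i <= i')%N.
Proof.
move=> si si' ll'; rewrite !first_at_take // => /andP[_ /allP h] /andP[/eqP e _].
rewrite leqNgt; apply/negP => ii'.
have : nth [::] s i' \in take i s.
  by rewrite -(nth_take [::] ii'); apply: mem_nth; rewrite size_takel // ltnW.
by move=> /h; rewrite e ltnNge ll'.
Qed.

Lemma sum_excl (R : numDomainType) (T : eqType) (rs : seq T) (b : T -> bool) : uniq rs ->
  (forall x y, x \in rs -> y \in rs -> b x -> b y -> x = y) ->
  \sum_(x <- rs) (b x)%:R <= 1 :> R.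
Proof.
elim: rs => [|x rs IH] /=; first by rewrite big_nil ler01.
move=> /andP[xr ur] H; rewrite big_cons; have [bx|_] := boolP (b x); last first.
  by rewrite add0r; apply: IH => // y z yr zr; apply: H; rewrite inE ?yr ?zr orbT.
rewrite big_seq big1 ?addr0 // => y yr; case: (boolP (b y)) => // by_.
by move: xr; rewrite (H x y _ _ bx by_) ?yr // inE ?eqxx // yr orbT.
Qed.

Definition exact_height om H c : bool := ext om H.+1 c && ~~ ext om H c.

Section Walk.
Context {R : realType} {p : nat -> R} {q beta : R} {d : measure_display}
  {Omega : measurableType d} {P : probability Omega R}
  {nu : Omega -> word -> nat} {X : Omega -> nat -> word}.
Context {W : galton_watson_walk p q beta P nu X}.
Local Notation Ex := (Ex P nu X).
Local Notation EE := (EE P nu).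

Let beta1 : 1 < beta. Proof. exact: bias_gt1. Qed.
Let b0 : 0 < beta. Proof. exact: bias_gt0. Qed.
Let bi0 : 0 < beta^-1. Proof. by rewrite invr_gt0. Qed.

Lemma measurable_event n b : mb b -> measurable [set w | b (nu w) (traj X w n)].
Proof.
move=> mb; apply: (@measurable_count_set _ _ _ (fun w => traj X w n)
  (fun s => [set w | b (nu w) s])) => s; first exact: measurable_traj.
exact: (measurable_preimage_nu (mb s)).
Qed.

Lemma measurable_exact H c : measurable [set om : env | exact_height om H c].
Proof.
have h : mb (fun om (_ : seq word) => ext om H.+1 c && ~~ ext om H c).
  by apply: mb_and; [move=> s; exact: measurable_ext|apply: mb_neg => s; exact: measurable_ext].
exact: (h [::]).
Qed.

Lemma exact_local H c : local (prefix c) (fun om => exact_height om H c).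
Proof.
by move=> om om' e; congr (_ && ~~ _); exact: ext_local.
Qed.

Lemma EE_exact H c : EE (fun om => (exact_height om H c)%:R) = (extp p H.+1 - extp p H)%:E.
Proof.
have mx := @measurable_natr _ env R _ (measurable_exact H c).
have me := @measurable_natr _ env R _ (measurable_ext H c).
have : EE (fun om => (ext om H.+1 c)%:R) =
    (EE (fun om => (ext om H c)%:R%R) + EE (fun om => (exact_height om H c)%:R%R))%E.
  rewrite -EED //; apply: eq_integral => w _; congr (_%:E); rewrite /exact_height.
  have [e|e] := boolP (ext (nu w) H c); last by rewrite andbT add0r.
  by rewrite (ext_le (leqnSn H) e) addr0.
rewrite !EE_ext; set z := EE _.
have z0 : (0 <= z)%E by exact: EE_ge0.
case: z z0 => [x _ | |] //.
rewrite -EFinD => -[e]; congr (_%:E); have -> : extp p H.+1 = extp p H + x by exact: e.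
by rewrite addrAC subrr add0r.
Qed.

Section Trial.
Variables (k0 H t l i : nat).
Hypotheses (k0_gt0 : (0 < k0)%N) (l_gt0 : (0 < l)%N).

(** A trial at level [l]: upon its first visit to level [l] at time [i], the walk
    enters a subtree of height exactly [H] and stays there for [t] steps. *)
Definition bait om (u : word) := (om u == k0) && exact_height om H (rcons u 0%N).

Lemma measurable_bait u : measurable [set om : env | bait om u].
Proof.
have h : mb (fun om (_ : seq word) => (om u == k0) && exact_height om H (rcons u 0%N)).
  by apply: mb_and; [move=> s; exact: measurable_degE|move=> s; exact: measurable_exact].
exact: (h [::]).
Qed.

Lemma EE_bait u : EE (fun om => (bait om u)%:R) = (p k0 * (extp p H.+1 - extp p H))%:E.
Proof.
have mt (j : nat) : measurable [set om : env | true] by exact: measurable_cstb.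
have et (j : nat) : EE (fun om => true%:R) = 1%:E by exact: EE_cst.
have lt (j : nat) : local (prefix (rcons u j)) (fun om => true) by [].
have := @EE_dega_fun _ _ _ _ _ _ _ _ _ W u (fun _ _ => true) k0 [::] 1 0%N
  (fun om => (exact_height om H (rcons u 0%N))%:R) isT isT mt lt et _ _ _.
rewrite /= mulr1 EE_exact -EFinM => <- //.
- by apply: eq_integral => w _; rewrite andbT /bait; case: (_ == _) => /=; rewrite ?mul1r ?mul0r.
- by move=> om om' e; rewrite (exact_local H e).
- exact: (@measurable_natr _ env R _ (measurable_exact H _)).
Qed.

Definition start om s := first_at l s && bait om (last [::] s).

Definition enter om s := start om (take i.+1 s) && (nth [::] s i.+1 == rcons (nth [::] s i) 0%N).

Definition stayed (s : seq word) := all (prefix (rcons (nth [::] s i) 0%N)) (drop i.+1 s).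

Definition trial om s := enter om (take i.+2 s) && stayed s.

Lemma mb_start : mb start.
Proof. by apply: mb_and; [exact: mb_path|move=> s; exact: measurable_bait]. Qed.

Lemma mb_enter : mb enter.
Proof. by apply: mb_and; [move=> s; exact: mb_start|exact: (mb_path (fun s => nth [::] s i.+1 == _))]. Qed.

Lemma mb_trial : mb trial.
Proof. by apply: mb_and; [move=> s; exact: mb_enter|exact: mb_path]. Qed.

Lemma start_ge : ((p k0 * (extp p H.+1 - extp p H))%:E * Ex i (fun om s => (first_at l s)%:R%R) <=
  Ex i (fun om s => (start om s)%:R%R))%E.
Proof.
have e0 : 0 <= extp p H.+1 - extp p H by rewrite subr_ge0; exact: extp_nondecreasing.
apply: (@le_trans _ _ (Ex i (fun om s => ((first_at l s)%:R * (bait om (last [::] s))%:R)%R))).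
  apply: (@fresh_ge _ _ _ _ _ _ _ _ _ W (first_at l) (fun u om => (bait om u)%:R)) => //.
  - by move=> s ss /first_at_fresh; exact: fresh_not_prefix.
  - by move=> u; exact: (@measurable_natr _ env R _ (measurable_bait u)).
  - move=> u om; rewrite /bait /restr prefix_refl -/(restr (prefix u) om).
    rewrite (_ : exact_height (restr _ _) _ _ = exact_height om H (rcons u 0%N)) //.
    by apply: exact_local => v /prefix_rcons_trans pv; rewrite /restr pv.
  - by rewrite mulr_ge0 // offspring_ge0.
  - by move=> u; have := EE_bait u; rewrite /EE => ->.
apply: Ex_le => [||om s].
- apply: admM; first exact: adm_path.
  by split => [om s|s]; [exact: ler0n|exact: (@measurable_natr _ env R _ (measurable_bait _))].
- by apply: adm_mb; exact: mb_start.
- by rewrite /start; case: (first_at l s); rewrite ?mul0r ?mul1r.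
Qed.

(** The degree [k0] is prescribed by the bait so that the step into child 0 has a fixed positive
    probability; [0 < l] excludes the root, whose transitions have another form. *)
Lemma enter_ge : ((beta / (1 + beta * k0%:R))%:E * Ex i (fun om s => (start om s)%:R%R) <=
  Ex i.+1 (fun om s => (enter om s)%:R%R))%E.
Proof.
have B0 : 0 <= beta / (1 + beta * k0%:R).
  by rewrite divr_ge0 ?(ltW b0) // addr_ge0 // mulr_ge0 // ltW.
have ae : adm (fun om s => (enter om s)%:R : R) by apply: adm_mb; exact: mb_enter.
have ast : adm (fun om s => (start om s)%:R : R) by apply: adm_mb; exact: mb_start.
rewrite markov // -ExZ //; apply: Ex_le_valid.
- by apply: admM => //; exact: adm_cst.
- exact: adm_E1op.
move=> om s si v.
have [st|_] := boolP (start om s); last by rewrite mulr0; apply: E1_ge0.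
rewrite mulr1; set u := last [::] s.
have [/andP[/eqP sl _] /andP[/eqP uk _]] := andP st.
have u0 : u != [::] by rewrite -size_eq0 -lt0n /u sl.
have cn : rcons u 0%N \in nbrs (om u) u.
  rewrite uk; case: (u) u0 => // a w _; rewrite inE; apply/orP; right.
  by apply/mapP; exists 0%N => //; rewrite mem_iota.
rewrite /E1op /E1 -/u (bigD1_seq _ cn (nbrs_uniq _ _)) /=.
have -> : enter om (rcons s (rcons u 0%N)) = true.
  rewrite /enter -cats1 take_size_cat // st nth_cat si ltnn subnn /= nth_cat si ltnSn.
  by rewrite (nth_size_last si) -/u eqxx.
have -> : trans beta (om u) u (rcons u 0%N) = beta / (1 + beta * k0%:R).
  rewrite uk /trans; case: (u) u0 => // a w _.
  have -> : (rcons (a :: w) 0%N == parent (a :: w)) = false.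
    by apply/negP => /eqP /(congr1 size); rewrite size_rcons size_parent /=; lia.
  by rewrite is_child_rcons k0_gt0.
by rewrite mulr1 lerDl; apply: sumr_ge0 => y _; rewrite mulr_ge0 // trans_ge0.
Qed.

Let G2 := Ex i.+1 (fun om s => (enter om s)%:R).

(** The potential [stayW], frozen at 1 once the walk has left the trap, so that its expectation
    dominates the probability of having left. *)
Let Psi om s : R := (enter om (take i.+2 s))%:R *
  (if stayed s then stayW beta om H (rcons (nth [::] s i) 0%N) (last [::] s) else 1).

Let aPsi : adm Psi.
Proof.
apply: admM; first by apply: adm_mb => s; exact: mb_enter.
split => [om s|s]; first by case: ifP => // _; exact: stayW_ge0.
case: (stayed s); last exact: measurable_cst.
set c := rcons _ _; set x := last _ _.
pose a om (y : word) := ~~ ext om ((size c + H) - size y) y.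
apply: (@measurable_vec_fun R a x (fun al _ => if prefix c x then beta^-1 ^+ ((lvl al x).+1 - size c) else 1)).
- by move=> y; apply: (@measurable_negb _ env); exact: measurable_ext.
- by move=> al al' om e; rewrite (eq_lvl e).
- by move=> al; exact: measurable_cst.
Qed.

Lemma enter_facts om s : valid om s -> (i.+1 < size s)%N -> enter om (take i.+2 s) ->
  [/\ intree om (rcons (nth [::] s i) 0%N), exact_height om H (rcons (nth [::] s i) 0%N) &
      nth [::] s i.+1 = rcons (nth [::] s i) 0%N].
Proof.
move=> v is1; rewrite /enter take_takel // !nth_take // => /andP[/andP[f /andP[_ ex]] /eqP e].
have li : last [::] (take i.+1 s) = nth [::] s i.
  by rewrite (take_nth [::]) ?last_rcons // ltnW.
rewrite li in ex; split => //; rewrite -e.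
by apply: (allP (valid_intree v)); exact: mem_nth.
Qed.

Let Psi_start : (Ex i.+1 Psi <= (beta^-1)%:E * G2)%E.
Proof.
have ae : adm (fun om s => (enter om s)%:R : R) by apply: adm_mb; exact: mb_enter.
rewrite -ExZ ?(ltW bi0) //; apply: Ex_le_valid => // [|om s si v].
  by apply: admM => //; apply: adm_cst; exact: ltW.
have is1 : (i.+1 < size s)%N by rewrite si.
rewrite /Psi take_oversize ?si //; have [en|_] := boolP (enter om s); last by rewrite mul0r mulr0.
have [ic /andP[hc nhc] e] : [/\ intree om (rcons (nth [::] s i) 0%N), exact_height om H (rcons (nth [::] s i) 0%N) &
      nth [::] s i.+1 = rcons (nth [::] s i) 0%N] by apply: enter_facts => //; rewrite take_oversize // si.
have ls : last [::] s = rcons (nth [::] s i) 0%N.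
  by rewrite -e nth_size_last.
rewrite mulr1 mul1r (_ : stayed s = true); last first.
  by rewrite /stayed (drop_nth [::]) // drop_oversize ?si //= e prefix_refl.
by rewrite ls stayW_start.
Qed.

Let Psi_step j : (Ex (i.+1 + j).+1 Psi <= Ex (i.+1 + j) Psi + (beta^-1 ^+ H)%:E * G2)%E.
Proof.
have ae : adm (fun om s => (enter om (take i.+2 s))%:R : R) by apply: adm_mb => s; exact: mb_enter.
have bH : 0 <= beta^-1 ^+ H by rewrite exprn_ge0 // ltW.
rewrite /G2 -(@Ex_take _ _ _ P nu X i.+1 (i.+1 + j) (fun om s => (enter om s)%:R)) ?leq_addr //.
rewrite -ExZ // -ExD //; last by apply: admM => //; exact: adm_cst.
rewrite markov //; apply: Ex_le_valid.
- exact: adm_E1op.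
- by apply: admD => //; apply: admM => //; exact: adm_cst.
move=> om s sj v; have is1 : (i.+1 < size s)%N by rewrite sj ltnS leq_addr.
have er y : enter om (take i.+2 (rcons s y)) = enter om (take i.+2 s).
  by rewrite -cats1 takel_cat.
have nr y : nth [::] (rcons s y) i = nth [::] s i by rewrite nth_rcons ltnW.
have sr y : stayed (rcons s y) = stayed s && prefix (rcons (nth [::] s i) 0%N) y.
  by rewrite /stayed nr drop_rcons ?all_rcons 1?andbC // ltnW.
rewrite /E1op /Psi; have [en|nen] := boolP (enter om (take i.+2 s)); last first.
  rewrite mul0r mulr0 addr0; apply: (E1_bound b0) => y _.
  by rewrite er (negbTE nen) mul0r.
have [ic /andP[hc nhc] _] := enter_facts v is1 en.
rewrite mul1r mulr1; have [st|nst] := boolP (stayed s); last first.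
  apply: (@le_trans _ _ 1); last by rewrite lerDl.
  by apply: (E1_bound b0) => y _; rewrite er en sr (negbTE nst) mul1r.
set c := rcons _ _ in ic hc nhc *.
rewrite [leLHS](_ : _ = E1 beta om (stayW beta om H c) (last [::] s)).
  apply: stayW_super => //; first by rewrite /c; case: (nth _ _ _).
    exact: valid_last_intree v.
  move: st => /allP; apply.
  by rewrite -[last _ s](congr1 (last [::]) (cat_take_drop i.+1 s)) last_cat; case: (drop i.+1 s) (size_drop i.+1 s) => [|y s']; [move=> /esym/eqP; rewrite subn_eq0 leqNgt is1|move=> _; exact: (mem_last y s')].
rewrite /E1; apply: eq_bigr => y _; congr (_ * _).
rewrite er en sr st nr last_rcons mul1r andTb -/c; case: ifP => // np.
by rewrite /stayW np.
Qed.

Let Psi_le j : (Ex (i.+1 + j) Psi <= (beta^-1 + j%:R * beta^-1 ^+ H)%:E * G2)%E.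
Proof.
have g0 : (0 <= G2)%E by apply: Ex_ge0; apply: adm_mb; exact: mb_enter.
have bH : 0 <= beta^-1 ^+ H by rewrite exprn_ge0 // ltW.
elim: j => [|j IH]; first by rewrite addn0 mul0r addr0; exact: Psi_start.
rewrite addnS; apply: le_trans (Psi_step j) _.
rewrite -natr1 mulrDl mul1r addrA [in leRHS]EFinD ge0_muleDl ?lee_fin //; last first.
  by apply: addr_ge0 (ltW bi0) _; exact: mulr_ge0.
by apply: leeD.
Qed.

(** The probability of leaving is at most [beta^-1] plus the left side of the hypothesis, hence at
    most 1 minus [(1 - beta^-1) / 2]: half of the gap between [beta^-1] and 1 remains for
    staying. *)
Lemma trial_ge : t%:R * beta^-1 ^+ H <= (1 - beta^-1) / 2 ->
  (((1 - beta^-1) / 2 * (beta / (1 + beta * k0%:R) * (p k0 * (extp p H.+1 - extp p H))))%:E *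
     Ex i (fun om s => (first_at l s)%:R%R) <= Ex (i.+1 + t) (fun om s => (trial om s)%:R%R))%E.
Proof.
move=> tH; have me := mb_enter; have mt := mb_trial.
have k1 : 0 < (1 - beta^-1) / 2 by rewrite divr_gt0 // subr_gt0 invf_lt1.
have B0 : 0 <= beta / (1 + beta * k0%:R).
  by rewrite divr_ge0 ?(ltW b0) // addr_ge0 // mulr_ge0 // ltW.
have G2E : G2 = P [set w | enter (nu w) (traj X w i.+1)] by exact: Ex_bool.
have [g gE] : exists g, G2 = g%:E.
  exists (fine G2); rewrite fineK // G2E; apply: fin_num_measure.
  exact: measurable_event.
have stg := start_ge; have eng := enter_ge; rewrite -/G2 in eng.
have kE : (1 - beta^-1) / 2 = 1 - beta^-1 - (1 - beta^-1) / 2 by move: (beta^-1) => b; lra.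
set B := beta / _ in B0 eng *; set e := p k0 * _ in stg *; set kap := (1 - _) / 2 in tH k1 kE *.
have -> : (kap * (B * e))%:E = (kap%:E * (B%:E * e%:E))%E by rewrite -!EFinM.
rewrite -!muleA; apply: (@le_trans _ _ (kap%:E * G2)%E).
  apply: lee_wpmul2l; first by rewrite lee_fin ltW.
  by apply: le_trans eng; apply: lee_wpmul2l; rewrite ?lee_fin.
have aet : adm (fun om s => (enter om (take i.+2 s))%:R : R) by apply: adm_mb => s; exact: me.
have : (G2 <= Ex (i.+1 + t) (fun om s => (trial om s)%:R%R) + Ex (i.+1 + t) Psi)%E.
  rewrite /G2 -(@Ex_take _ _ _ P nu X i.+1 (i.+1 + t) (fun om s => (enter om s)%:R)) ?leq_addr //.
  rewrite -ExD //; last exact: adm_mb.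
  apply: Ex_le => // [|om s]; first by apply: admD => //; exact: adm_mb.
  rewrite /trial /Psi; case: (enter _ _); rewrite ?mul0r ?addr0 // mul1r andTb.
  by case: (stayed s); rewrite ?add0r ?lerDl // stayW_ge0.
move=> /le_trans/(_ (leeD (le_refl _) (Psi_le t))); rewrite gE.
have : (0 <= Ex (i.+1 + t) (fun om s => (trial om s)%:R%R))%E by apply: Ex_ge0; exact: adm_mb.
case: (Ex _ _) => [z| |] // _; last by move=> _; exact: leey.
rewrite -!EFinM -EFinD !lee_fin => h.
have g0 : 0 <= g by rewrite -lee_fin -gE; apply: Ex_ge0; exact: adm_mb.
have : (beta^-1 + t%:R * beta^-1 ^+ H) * g <= (beta^-1 + kap) * g.
  by rewrite ler_wpM2r // lerD2l.
by move=> h'; rewrite kE; lra.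
Qed.

End Trial.

(** During a successful trial the next level is first reached inside a finite
    subtree, which has no room for another one of height [H]. *)
Lemma trial_excl k0 H t om s l i l' i' : valid om s -> (t + i.+1 < size s)%N -> (t + i'.+1 < size s)%N ->
  (0 < l)%N -> (l < l')%N -> (i <= t)%N -> (i' <= t)%N ->
  trial k0 H l i om (take (i.+1 + t).+1 s) -> ~~ trial k0 H l' i' om (take (i'.+1 + t).+1 s).
Proof.
move=> v si si' l0 ll it it' tr; apply/negP => tr'.
have facts j lj : (t + j.+1 < size s)%N -> trial k0 H lj j om (take (j.+1 + t).+1 s) ->
  [/\ first_at lj (take j.+1 s), intree om (rcons (nth [::] s j) 0%N),
      exact_height om H (rcons (nth [::] s j) 0%N), nth [::] s j.+1 = rcons (nth [::] s j) 0%N &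
      forall m, (j.+1 <= m <= j.+1 + t)%N -> prefix (rcons (nth [::] s j) 0%N) (nth [::] s m)].
  move=> js /andP[en /allP st].
  have ts : take j.+2 (take (j.+1 + t).+1 s) = take j.+2 s by rewrite take_takel // addSn !ltnS leq_addr.
  rewrite ts in en.
  have j2 : (j.+1 < size s)%N by rewrite (leq_ltn_trans _ js) // leq_addl.
  have [ic ex e] := enter_facts v j2 en.
  have f : first_at lj (take j.+1 s) by move: en => /andP[/andP[]]; rewrite take_takel.
  split => // m /andP[jm mt].
  have nj : nth [::] (take (j.+1 + t).+1 s) j = nth [::] s j by rewrite nth_take // addSn !ltnS -addnS leq_addr.
  rewrite -nj; apply: st; rewrite -(nth_take [::] (_ : m < (j.+1 + t).+1)%N) // -(subnKC jm) -nth_drop.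
  apply: mem_nth; have sT : size (take (j.+1 + t).+1 s) = (j.+1 + t).+1 by apply: size_takel; rewrite addnC.
  by rewrite size_drop sT ltn_sub2r ?ltnS ?leq_addr.
have [f ic /andP[hc _] _ pp] := facts i l si tr.
have [f' ic' /andP[_ nhc'] e' _] := facts i' l' si' tr'.
have ks : (i < size s)%N := leq_ltn_trans (leq_trans (leqnSn i) (leq_addl t _)) si.
have ks' : (i' < size s)%N := leq_ltn_trans (leq_trans (leqnSn i') (leq_addl t _)) si'.
have sz : size (nth [::] s i) = l by move: f; rewrite first_at_take // => /andP[/eqP].
have sz' : size (nth [::] s i') = l' by move: f'; rewrite first_at_take // => /andP[/eqP].
have ii : (i <= i')%N := first_at_mono ks ks' (ltnW ll) f f'.
have ne : i != i' by apply/eqP => e; move: ll; rewrite -sz -sz' e ltnn.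
(* As [i' <= t], the second entrance happens while the first trial still holds the walk in its
   trap. *)
have px : prefix (rcons (nth [::] s i) 0%N) (rcons (nth [::] s i') 0%N).
  by rewrite -e'; apply: pp; rewrite ltnS ii addSn ltnS (leq_trans it') // leq_addl.
have cn : rcons (nth [::] s i) 0%N != [::] by case: (nth _ _ _).
(* The second subtree starts [l' - l >= 1] generations deeper inside a tree of height [H], so it
   cannot have height [H] too. *)
move/negP: nhc'; apply; apply: ext_le (trap_depth cn hc ic' px).
by rewrite !size_rcons sz sz' subSS leq_subLR -addn1 addnC leq_add2r subn_gt0.
Qed.

(** Whether level [n] is reached by time [t] is not known at the first visit to level [l]. The
    trials therefore require only that level [l] is reached by time [t], which is implied and is
    determined by the past; this is still enough for them to be disjoint. *)
Lemma fast_le k0 H t n : (0 < k0)%N -> t%:R * beta^-1 ^+ H <= (1 - beta^-1) / 2 ->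
  ((n.-1%:R * ((1 - beta^-1) / 2 * (beta / (1 + beta * k0%:R) * (p k0 * (extp p H.+1 - extp p H)))))%:E *
   Ex t (fun om s => (has (fun v => n <= size v)%N s)%:R%R) <= 1)%E.
Proof.
move=> k00 tH; set kap := (1 - beta^-1) / 2 * _.
have kap0 : 0 <= kap.
  rewrite /kap !mulr_ge0 ?subr_ge0 ?invr_ge0 ?(ltW b0) ?offspring_ge0 //.
  - by rewrite invf_le1 // ltW.
  - by rewrite addr_ge0 // mulr_ge0 // ltW.
  - exact: extp_nondecreasing.
pose rs := [seq (l, i) | l <- iota 1 n.-1, i <- iota 0 t.+1].
have rsP x : x \in rs -> (0 < x.1)%N && (x.1 < n)%N && (x.2 <= t)%N.
  move=> /allpairsP[[l i] [hl hi ->]].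
  by move: hl hi; rewrite !mem_iota /=; lia.
(* The last possible trial reaches its level at time [t], enters the trap at [t.+1] and stays for
   [t] steps. *)
pose N := (t.+1 + t)%N.
pose b (x : nat * nat) om (s : seq word) := trial k0 H x.1 x.2 om (take (x.2.+1 + t).+1 s).
have mbb x : mb (b x) by move=> s; exact: mb_trial.
have ab x : adm (fun om s => (b x om s)%:R : R) by exact: adm_mb.
have af l : adm (fun om s => (first_at l s)%:R : R) by exact: adm_path.
apply: (@le_trans _ _ (\sum_(x <- rs) Ex N (fun om s => (b x om s)%:R%R))%E); last first.
  rewrite -Ex_sum //; apply: (@le_trans _ _ (Ex N (fun _ _ => 1))); last first.
    by rewrite /Ex integral_cst // mul1e; exact: probability_le1.
  apply: Ex_le_valid => [||om s sN v].
  - split => [om s|s]; first by apply: sumr_ge0.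
    by apply: (@measurable_sum _ env R) => j; case: (ab j).
  - exact: adm_cst.
  apply: sum_excl => [|x y xr yr bx by_].
    by apply: allpairs_uniq => [||[? ?] [? ?]]; rewrite ?iota_uniq.
  have /andP[/andP[x1 xn] x2] := rsP x xr; have /andP[/andP[y1 yn] y2] := rsP y yr.
  have sx : (t + x.2.+1 < size s)%N by rewrite sN /N addnS addSn !ltnS leq_add2l.
  have sy : (t + y.2.+1 < size s)%N by rewrite sN /N addnS addSn !ltnS leq_add2l.
  have [xy|yx|e] := ltngtP x.1 y.1.
  - by have /negP := trial_excl v sx sy x1 xy x2 y2 bx.
  - by have /negP := trial_excl v sy sx y1 yx y2 x2 by_.
  have fx z : z \in [:: x; y] -> first_at z.1 (take z.2.+1 s) /\ (z.2 < size s)%N.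
    rewrite !inE => zz; have [bz z2] : b z om s /\ (z.2 <= t)%N by case/orP: zz => /eqP ->.
    split; last by rewrite sN ltnS (leq_trans z2) // /N addSn leqW // leq_addr.
    move: bz; rewrite /b /trial => /andP[en _]; move: en; rewrite /enter => /andP[st _].
    have e1 : (z.2.+1 <= z.2.+2)%N by [].
    have e2 : (z.2.+2 <= (z.2.+1 + t).+1)%N by rewrite addSn !ltnS leq_addr.
    by move: st; rewrite /start (take_takel _ e1) (take_takel _ (leq_trans e1 e2)) => /andP[].
  have [f1 s1] := fx x (mem_head _ _).
  have [f2 s2] : first_at y.1 (take y.2.+1 s) /\ (y.2 < size s)%N by apply: fx; rewrite !inE eqxx orbT.
  case: x y e f1 s1 f2 s2 {xr yr bx by_ x1 xn x2 y1 yn y2 sx sy fx} => [l i] [l' i'] /= <- f1 s1 f2 s2.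
  by congr (_, _); apply/eqP; rewrite eqn_leq (first_at_mono s1 s2 (leqnn _) f1 f2) (first_at_mono s2 s1 (leqnn _) f2 f1).
rewrite big_allpairs_dep /=.
have key l : (l <= n)%N -> (Ex t (fun om s => (has (fun v => n <= size v)%N s)%:R%R) <=
    \sum_(i <- iota 0 t.+1) Ex i (fun om s => (first_at l s)%:R%R))%E.
  move=> ln; apply: (@le_trans _ _ (Ex t (fun om s => (\sum_(i <- iota 0 t.+1) (first_at l (take i.+1 s))%:R)%R))).
    apply: Ex_le_valid => [||om s st v]; first exact: adm_path.
      split => [om s|s]; first by apply: sumr_ge0.
      exact: measurable_cst.
    case: hasP => [[x xs nx]|_]; last by apply: sumr_ge0.
    have xi : (index x s < size s)%N by rewrite index_mem.
    have [|i ij fi] := first_at_exists (l := l) v xi; first by rewrite nth_index // (leq_trans ln).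
    rewrite (big_rem i); last by rewrite mem_iota; lia.
    by rewrite /= fi lerDl; apply: sumr_ge0.
  rewrite Ex_sum; last by move=> i; exact: (adm_comp (take i.+1) (af l)).
  rewrite big_seq [leRHS]big_seq; apply: lee_sum => i; rewrite mem_iota => ti.
  by rewrite (@Ex_take _ _ _ P nu X i t (fun om s => (first_at l s)%:R)) //; lia.
have key2 l : l \in iota 1 n.-1 -> (kap%:E * Ex t (fun om s => (has (fun v => n <= size v)%N s)%:R%R) <=
    \sum_(i <- iota 0 t.+1) Ex N (fun om s => (b (l, i) om s)%:R%R))%E.
  rewrite mem_iota => ln; apply: (@le_trans _ _ (kap%:E * \sum_(i <- iota 0 t.+1) Ex i (fun om s => (first_at l s)%:R%R))%E).
    by apply: lee_wpmul2l; rewrite ?lee_fin //; apply: key; lia.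
  rewrite ge0_sume_distrr; last by move=> i _; apply: Ex_ge0.
  rewrite big_seq [leRHS]big_seq; apply: lee_sum => i; rewrite mem_iota => ti.
  rewrite (@Ex_take _ _ _ P nu X (i.+1 + t) N (fun om s => (trial k0 H l i om s)%:R)); last by rewrite /N; lia.
  by apply: trial_ge => //; lia.
have [e eE] : exists e, Ex t (fun om s => (has (fun v => n <= size v)%N s)%:R%R) = e%:E.
  have := @Ex_bool _ _ _ _ _ _ _ _ _ W t (fun om s => has (fun v => n <= size v)%N s) (mb_path _).
  move=> ->; exists (fine (P [set w | has (fun v => n <= size v)%N (traj X w t)])).
  rewrite fineK //; apply: fin_num_measure.
  by apply: (@measurable_event t (fun om s => has (fun v => n <= size v)%N s)); exact: mb_path.
rewrite eE -EFinM in key2 *; apply: (@le_trans _ _ (\sum_(l <- iota 1 n.-1) (kap * e)%:E)%E).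
  rewrite -EFinM sumEFin lee_fin -subn1 -[iota _ _]/(index_iota 1 n) sumr_const_nat.
  by rewrite -mulrA mulr_natl.
by rewrite big_seq [leRHS]big_seq; apply: lee_sum => l ll; exact: key2.
Qed.


End Walk.

(** * Backtracking *)

Lemma last_switch (b : nat -> bool) i j : (i <= j)%N -> b i -> ~~ b j ->
  exists2 k, (i <= k < j)%N & b k && ~~ b k.+1.
Proof.
elim: j => [|j IH]; first by rewrite leqn0 => /eqP -> ->.
rewrite leq_eqVlt => /predU1P[->|]; first by move=> ->.
rewrite ltnS => ij bi nbj; have [bj|nb] := boolP (b j).
  by exists j; rewrite ?ij ?ltnSn // bj.
by have [k /andP[ik kj] h] := IH ij bi nb; exists k => //; rewrite ik ltnW.
Qed.

Definition climb om m (s : seq word) : bool :=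
  (m <= lvl (alive om) (last [::] s))%N && all (fun v => lvl (alive om) v < m)%N (take (size s).-1 s).

Lemma climb_take om m s i : (i < size s)%N ->
  climb om m (take i.+1 s) = (m <= lvl (alive om) (nth [::] s i))%N &&
    all (fun v => lvl (alive om) v < m)%N (take i s).
Proof.
by move=> si; rewrite (take_nth [::]) // /climb last_rcons size_rcons -cats1 take_size_cat.
Qed.

Definition returns n (s : seq word) : bool :=
  has (fun i => (4 * n <= size (nth [::] s i))%N && has (fun v => size v < n)%N (drop i s)) (iota 0 (size s)).

Section Walk.
Context {R : realType} {p : nat -> R} {q beta : R} {d : measure_display}
  {Omega : measurableType d} {P : probability Omega R}
  {nu : Omega -> word -> nat} {X : Omega -> nat -> word}.
Context {W : galton_watson_walk p q beta P nu X}.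
Local Notation Ex := (Ex P nu X).
Local Notation m1 := (limn (series (fun k => k%:R * p k))).

Let beta1 : 1 < beta. Proof. exact: bias_gt1. Qed.
Let b0 : 0 < beta. Proof. exact: bias_gt0. Qed.

Lemma mb_climb m : mb (fun om s => climb om m s).
Proof.
apply: mb_and; first exact: (mb_lvl (last [::]) (fun k s => m <= k)%N).
move=> s; elim: (take _ _) => [|v l IH] /=; first exact: measurable_cstb.
exact: (mb_and (mb_lvl (fun=> v) (fun k s => k < m)%N) (fun=> IH) s).
Qed.

(** At level [4 n], with no deep trap around, the walk has passed backbone level [2 n]. Any vertex
    below level [n] has backbone level below [n], so a return forces a crossing of level [n] after
    the first climb to [2 n]. *)
Lemma returns_crosses n N om s : (0 < n)%N -> size s = N.+1 -> valid om s -> alive om [::] ->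
  returns n s -> ~~ meets_deep (4 * n).+1 n N om s ->
  exists2 i, (i < N.+1)%N & exists2 k, (i <= k < N)%N &
    climb om (2 * n) (take i.+1 s) && crossb n om (take k.+2 s).
Proof.
move=> n0 sN v a0 /hasP[i]; rewrite mem_iota add0n => /andP[_ si] /andP[i4 /hasP[x xd xn]] nd.
have [i0 i0i f] := first_at_exists v si i4.
have si0 : (i0 < size s)%N by exact: leq_ltn_trans i0i si.
have /eqP s4 : size (nth [::] s i0) == (4 * n)%N by move: f; rewrite first_at_take // => /andP[].
set al := alive om; set u := proj al (nth [::] s i0).
have pu : prefix u (nth [::] s i0) by exact: prefix_proj.
have [i1 i1i0 [e1 f1]] := first_visit v si0 pu.
have i1N : (i1 < N.+1)%N by rewrite -sN; exact: leq_ltn_trans i1i0 si0.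
have ndu : ~~ deep om n u.
  apply: contraNN nd => h; apply/hasP; exists i1; first by rewrite mem_iota add0n i1N.
  rewrite e1 h andbT /freshn f1 (last_nth [::]) size_takel ?sN //= nth_take // e1 ltnS -s4.
  exact: size_prefix.
(* The trap containing this vertex of level [4 n] has depth at most [n], so its base is at level
   [3 n] or more. *)
have hl : (2 * n <= lvl al (nth [::] s i0))%N.
  have iu := allP (valid_intree v) _ (mem_nth [::] si0).
  have bu : bbk al u by exact: bbk_proj.
  have := trap_size bu ndu iu erefl; rewrite s4 /u size_proj -/al.
  by move: (lvl _ _) => L; clear; lia.
pose a y := (2 * n <= lvl al y)%N.
have ha : has a s by apply/hasP; exists (nth [::] s i0) => //; exact: mem_nth.
have i2s : (find a s < size s)%N by rewrite -has_find.
have i2i0 : (find a s <= i0)%N by rewrite leqNgt; apply/negP => /(before_find [::]); rewrite /a hl.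
exists (find a s); first by rewrite -sN.
have xi : (index x (drop i s) < size (drop i s))%N by rewrite index_mem.
set j := (i + index x (drop i s))%N.
have js : (j < size s)%N by rewrite /j -ltn_subRL -size_drop.
have ej : nth [::] s j = x by rewrite /j -nth_drop nth_index.
have [|||k /andP[ik kj] /andP[k1 k2]] := @last_switch (fun k => (n <= lvl al (nth [::] s k))%N) (find a s) j.
- exact: leq_trans i2i0 (leq_trans i0i (leq_addr _ _)).
- have := nth_find [::] ha; rewrite /a; apply: leq_trans.
  by rewrite mul2n -addnn leq_addr.
- by rewrite ej -ltnNge; exact: leq_ltn_trans (lvl_le_size _ _) xn.
have kN : (k.+1 < size s)%N by exact: leq_ltn_trans kj js.
exists k; first by rewrite ik -ltnS -sN.
rewrite climb_take // -[(2 * n <= _)%N]/(a _) (nth_find [::] ha) andTb; apply/andP; split.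
  apply/(all_nthP [::]) => m; rewrite size_takel ?(ltnW i2s) // => mi.
  by rewrite nth_take // ltnNge; have := before_find [::] mi; rewrite /a => ->.
rewrite /crossb (take_nth [::]) // prev_rcons; last by case: (s) js.
rewrite last_rcons (take_nth [::]) ?(ltnW kN) // last_rcons /cross -/al.
by rewrite ltnNge k1 ltnNge k2.
Qed.

(** At the first climb to backbone level [2 n] the crossing potential of level [n] is at most
    [B beta^-n], with [B = 2 / (beta - 1)], and a path has at most one such time. *)
Lemma climb_sum n N : (0 < n)%N ->
  (\sum_(i <- iota 0 N.+1) Ex i (fun om s => ((climb om (2 * n) s && alive om [::])%:R * crossW beta (alive om) n (last [::] s))%R) <=
  (2 / (beta - 1) * beta^-1 ^+ n)%:E)%E.
Proof.
move=> n0; set c := 2 / _ * _.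
have c0 : 0 <= c by rewrite mulr_ge0 ?divr_ge0 ?exprn_ge0 ?invr_ge0 ?(ltW b0) // subr_ge0 ltW.
have ac i : adm (fun om s => (climb om (2 * n) (take i.+1 s))%:R : R).
  by apply: adm_mb => s; exact: mb_climb.
have acl : adm (fun om s => (climb om (2 * n) s)%:R : R) by apply: adm_mb => s; exact: mb_climb.
apply: (@le_trans _ _ (\sum_(i <- iota 0 N.+1) c%:E * Ex N (fun om s => (climb om (2 * n) (take i.+1 s))%:R%R))%E).
  rewrite big_seq [leRHS]big_seq; apply: lee_sum => i; rewrite mem_iota add0n ltnS => /andP[_ iN].
  rewrite (@Ex_take _ _ _ P nu X i N (fun om s => (climb om (2 * n) s)%:R)) // -ExZ //.
  apply: Ex_le => [||om s].
  - apply: admM; last exact: adm_crossW.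
    by apply: adm_mb; apply: mb_and; [exact: mb_climb|exact: (mb_alive (fun=> [::]))].
  - by apply: admM => //; exact: adm_cst.
  have [/andP[h _]|] := boolP (climb om _ s); last by rewrite mul0r mulr_ge0.
  have nl : (n <= lvl (alive om) (last [::] s))%N by apply: leq_trans h; rewrite mul2n -addnn leq_addr.
  rewrite andTb mulr1; case: (alive om [::]); last by rewrite mul0r.
  rewrite mul1r /crossW ltnNge nl /= ler_wpM2l //; first by rewrite divr_ge0 // subr_ge0 ltW.
  rewrite ler_wiXn2l ?invr_ge0 ?(ltW b0) ?invf_le1 ?(ltW beta1) //.
  by apply: leq_trans (leq_sub2r n h); rewrite mul2n -addnn addnK.
rewrite -ge0_sume_distrr; last by move=> i _; apply: Ex_ge0.
rewrite -[leRHS]mule1; apply: lee_wpmul2l; first by rewrite lee_fin.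
rewrite -Ex_sum //; apply: (@le_trans _ _ (Ex N (fun _ _ => 1))); last first.
  by rewrite /Ex integral_cst // mul1e; exact: probability_le1.
apply: Ex_le_valid => [||om s sN v].
- split => [om s|s]; first by apply: sumr_ge0.
  by apply: (@measurable_sum _ env R) => j; case: (ac j).
- exact: adm_cst.
apply: sum_excl => [|x y]; first exact: iota_uniq.
rewrite !mem_iota !add0n -sN => /andP[_ xs] /andP[_ ys].
rewrite !climb_take // => /andP[lx /allP ax] /andP[ly /allP ay].
have aux a b : (a < b)%N -> (b < size s)%N -> (forall z, z \in take b s -> (lvl (alive om) z < 2 * n)%N) ->
    (2 * n <= lvl (alive om) (nth [::] s a))%N -> False.
  move=> ab bs h; rewrite leqNgt h // -(nth_take [::] ab); apply: mem_nth.
  by rewrite size_takel // ltnW.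
by have [xy|yx|//] := ltngtP x y; exfalso; [exact: (aux _ _ xy ys ay lx)|exact: (aux _ _ yx xs ax ly)].
Qed.

Lemma returns_le n N : (0 < n)%N ->
  (Ex N (fun om s => (alive om [::] && returns n s)%:R%R) <=
   (m1 * (q - extp p n) * ((4 * n).+1%:R * C1 (q := q) (beta := beta)) + 2 / (beta - 1) * beta^-1 ^+ n)%:E)%E.
Proof.
move=> n0; rewrite EFinD.
pose F (i k : nat) om s := climb om (2 * n) (take i.+1 s) && alive om [::] && crossb n om (take k.+2 s).
have mc : mb (crossb n) by exact: mb_cross.
have mF i k : mb (F i k).
  apply: mb_and => [|s]; last exact: mc.
  by apply: mb_and => [s|]; [exact: mb_climb|exact: (mb_alive (fun=> [::]))].
have aF i k : adm (fun om s => (F i k om s)%:R : R) by exact: adm_mb.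
have aSF i : adm (fun om s => \sum_(k <- index_iota i N) (F i k om s)%:R : R).
  split => [om s|s]; first by apply: sumr_ge0.
  by apply: (@measurable_sum _ env R) => j; case: (aF i j).
have aSSF : adm (fun om s => \sum_(i <- iota 0 N.+1) \sum_(k <- index_iota i N) (F i k om s)%:R : R).
  split => [om s|s]; first by apply: sumr_ge0 => i _; apply: sumr_ge0.
  by apply: (@measurable_sum _ env R) => i; case: (aSF i).
have aD : adm (fun om s => (meets_deep (4 * n).+1 n N om s)%:R : R) by apply: adm_mb; exact: mb_meets_deep.
apply: (@le_trans _ _ (Ex N (fun om s => (meets_deep (4 * n).+1 n N om s)%:R%R) +
   Ex N (fun om s => (\sum_(i <- iota 0 N.+1) \sum_(k <- index_iota i N) (F i k om s)%:R)%R))%E).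
  rewrite -ExD //; apply: Ex_le_valid => [||om s sN v].
  - by apply: adm_mb; apply: mb_and; [exact: (mb_alive (fun=> [::]))|exact: mb_path].
  - exact: admD.
  have [/andP[a0 rt]|_] := boolP (_ && _); last by rewrite addr_ge0 //; case: aSSF.
  have [_|nd] := boolP (meets_deep _ _ _ _ _).
    by rewrite lerDl; case: aSSF.
  have [i iN [k ik /andP[ci ck]]] := returns_crosses n0 sN v a0 rt nd.
  have ii : i \in iota 0 N.+1 by rewrite mem_iota.
  have kk : k \in index_iota i N by rewrite mem_index_iota.
  have FE : F i k om s = true by rewrite /F ci a0 ck.
  rewrite add0r (big_rem i ii) /= (big_rem k kk) /= FE -addrA lerDl addr_ge0 //.
    by apply: sumr_ge0.
  by apply: sumr_ge0 => j _; apply: sumr_ge0.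
apply: leeD.
  exact: deep_count.
rewrite Ex_sum //; apply: le_trans (climb_sum N n0).
rewrite big_seq [leRHS]big_seq; apply: lee_sum => i; rewrite mem_iota add0n ltnS => /andP[_ iN].
rewrite Ex_sum //; apply: le_trans (cross_count (W := W) (fun s => mb_climb (2 * n) s) n0 iN).
rewrite big_nat [leRHS]big_nat; apply: lee_sum => k /andP[ik kN].
rewrite -(@Ex_take _ _ _ P nu X k.+1 N (fun om s => (climb om (2 * n) (take i.+1 s) && alive om [::] && crossb n om s)%:R)) //.
rewrite le_eqVlt; apply/orP; left; apply/eqP; apply: eq_integral => w _.
by rewrite take_takel // ltnS leqW.
Qed.

End Walk.

(** * Polynomial bounds *)

Lemma bernoulli (R : realDomainType) (x : R) n : 0 <= x -> 1 + n%:R * x <= (1 + x) ^+ n.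
Proof.
move=> x0; elim: n => [|n IH]; first by rewrite mul0r addr0 expr0.
rewrite exprS; apply: (@le_trans _ _ ((1 + x) * (1 + n%:R * x))); last first.
  by rewrite ler_wpM2l // addr_ge0.
have : 0 <= n%:R * x * x by rewrite !mulr_ge0.
by rewrite -natr1 => h; nra.
Qed.

(** Writing [a] as the square of [s], each factor [n] is absorbed by one factor [s^n] through
    Bernoulli's inequality. *)
Lemma natX_expr_bounded (R : realType) (a : R) : 0 < a -> a < 1 ->
  exists2 C, 0 < C & forall n, n%:R ^+ 2 * a ^+ n <= C.
Proof.
move=> a0 a1; set s := Num.sqrt a.
have s0 : 0 < s by rewrite sqrtr_gt0.
have s1 : s < 1 by rewrite -sqrtr1 ltr_sqrt.
have d0 : 0 < s^-1 - 1 by rewrite subr_gt0 invf_gt1.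
exists ((s^-1 - 1)^-1 ^+ 2) => [|n]; first by rewrite exprn_gt0 // invr_gt0.
have <- : s ^+ 2 = a by rewrite sqr_sqrtr // ltW.
rewrite exprAC -exprMn lerXn2r ?nnegrE ?mulr_ge0 ?exprn_ge0 ?invr_ge0 ?(ltW s0) ?(ltW d0) //.
rewrite -ler_pdivlMr ?exprn_gt0 // -exprVn mulrC ler_pdivlMr //.
apply: le_trans (_ : 1 + n%:R * (s^-1 - 1) <= _); first by rewrite lerDr.
by have := bernoulli n (ltW d0); rewrite addrCA subrr addr0.
Qed.

Lemma floor_log (R : realType) (b x : R) : 1 < b -> 1 <= x -> exists H, b ^+ H <= x < b ^+ H.+1.
Proof.
move=> b1 x1; have b0 : 0 < b by apply: lt_trans b1.
have x0 : 0 < x by apply: lt_le_trans x1.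
have lb : 0 < ln b by exact: ln_gt0.
have y0 : 0 <= ln x / ln b by rewrite divr_ge0 ?ln_ge0 // ltW.
exists (Num.truncn (ln x / ln b)); have /andP[h1 h2] := truncn_itv y0.
rewrite -[X in _ <= X](@lnK R) ?posrE // -[X in X < _](@lnK R) ?posrE //.
have e n : b ^+ n = expR (n%:R * ln b) by rewrite mulr_natl -lnXn // lnK // posrE exprn_gt0.
by rewrite !e ler_expR ltr_expR -ler_pdivlMr // h1 -ltr_pdivrMr.
Qed.

Section Walk.
Context {R : realType} {p : nat -> R} {q beta : R} {d : measure_display}
  {Omega : measurableType d} {P : probability Omega R}
  {nu : Omega -> word -> nat} {X : Omega -> nat -> word}.
Context {W : galton_watson_walk p q beta P nu X}.
Local Notation Ex := (Ex P nu X).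
Local Notation m1 := (limn (series (fun k => k%:R * p k))).
Local Notation r := (gf' p q).

Definition walk_exponent := - ln r / ln beta.
Local Notation gamma := walk_exponent.

Let beta1 : 1 < beta. Proof. exact: bias_gt1. Qed.
Let b0 : 0 < beta. Proof. exact: bias_gt0. Qed.
Let r0 : 0 < r. Proof. exact: gf'q_gt0. Qed.
Let r1 : r < 1. Proof. exact: gf'q_lt1. Qed.
Let lb : 0 < ln beta. Proof. exact: ln_gt0. Qed.
Let br : 1 < beta * r.
Proof. by rewrite mulrC -ltr_pdivrMl // mulr1; exact: bias_gt. Qed.

Lemma walk_exponent_gt0 : 0 < gamma.
Proof. by rewrite divr_gt0 // oppr_gt0 ln_lt0 // r0. Qed.

Lemma walk_exponent_lt1 : gamma < 1.
Proof.
rewrite ltr_pdivrMr // mul1r -subr_gt0 opprK -lnM ?posrE //.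
exact: ln_gt0.
Qed.

Let g0 := walk_exponent_gt0.

Let powr_le (x y : R) : 0 < x -> x <= y -> y `^ (- gamma) <= x `^ (- gamma).
Proof.
move=> x0 xy; rewrite !powRN lef_pV2 ?posrE ?powR_gt0 ?(lt_le_trans x0) //.
by apply: ge0_ler_powR; rewrite ?(ltW g0) ?nnegrE ?(ltW x0) // (le_trans (ltW x0)).
Qed.

(** This identity is the reason for the value of the exponent: it expresses the probability of a
    trap of height [H] through its time scale [beta^H]. *)
Let r_pow H : r ^+ H = (beta ^+ H) `^ (- gamma).
Proof.
have bH : 0 < beta ^+ H by rewrite exprn_gt0.
rewrite /powR gt_eqF // lnXn // -mulr_natr mulrA mulNr /walk_exponent divfK ?gt_eqF // opprK.
by rewrite mulr_natr -lnXn // lnK // posrE exprn_gt0.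
Qed.

Lemma below_pow : exists2 C, 0 < C & forall n N,
  (Ex N (fun om s => (below n om s)%:R%R) <= (C * n%:R * N.+1%:R `^ (- gamma))%:E)%E.
Proof.
have [C C0 HC] := @Ebar_le _ _ _ _ _ _ _ _ _ W.
have m0 : 0 <= m1 by exact: mean_ge0.
have c1 : 1 <= C1 (q := q) (beta := beta) by exact: (C1_ge1 (W := W)).
have c0 : 0 < C1 (q := q) (beta := beta) by apply: lt_le_trans c1.
pose D := (1 + beta * m1 + beta * (m1 * C)) / (beta - 1).
have D0 : 0 < D.
  rewrite divr_gt0 ?subr_gt0 // -addrA ltr_pwDl // addr_ge0 // !mulr_ge0 // ltW //.
exists (C1 (q := q) (beta := beta) * (m1 + D) * r^-1) => [|n N].
  have mD : 0 < m1 + D by exact: ltr_wpDl.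
  by apply: mulr_gt0; [exact: mulr_gt0|rewrite invr_gt0].
have N1 : 1 <= N.+1%:R :> R by rewrite ler1n.
have N0 : 0 < N.+1%:R :> R by rewrite ltr0n.
(* This cutoff balances the two errors: [taubar / N.+1] is at most of order
   [(beta r)^H / beta^H = r^H], the order of the probability of a higher trap. *)
have [H /andP[h1 h2]] := floor_log beta1 N1.
apply: le_trans (below_le n H N) _; rewrite lee_fin.
have rH0 : 0 < r ^+ H by rewrite exprn_gt0.
have gap : q - extp p H <= r ^+ H by exact: extp_gap_le.
have rH : r ^+ H <= r^-1 * N.+1%:R `^ (- gamma).
  rewrite ler_pdivlMl // -exprS r_pow; apply: powr_le => //; exact: ltW.
have tb : taubar (p := p) (q := q) (beta := beta) H / N.+1%:R <= D * r ^+ H.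
  rewrite ler_pdivrMr // -mulrA; apply: (@le_trans _ _ (D * (beta * r) ^+ H)); last first.
    by rewrite ler_pM2l // exprMn mulrC ler_pM2l.
  rewrite /taubar /D mulrAC ler_pM2r ?invr_gt0 ?subr_gt0 //.
  have e1 : 1 <= (beta * r) ^+ H by rewrite exprn_ege1 // ltW.
  rewrite [leRHS]mulrDl; apply: lerD.
    by rewrite ler_peMr // addr_ge0 // mulr_ge0 // ltW.
  by rewrite -!mulrA ler_pM2l //; apply: ler_wpM2l => //; exact: HC.
apply: (@le_trans _ _ (n%:R * C1 (q := q) (beta := beta) * ((m1 + D) * r ^+ H))).
  apply: ler_wpM2l; first by rewrite mulr_ge0 // ltW.
  rewrite [leRHS]mulrDl lerD // ?ler_wpM2l //.
rewrite [leRHS](_ : _ = n%:R * C1 (q := q) (beta := beta) * ((m1 + D) * (r^-1 * N.+1%:R `^ (- gamma)))); last by ring.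
have mD : 0 < m1 + D by exact: ltr_wpDl.
by apply: ler_wpM2l; [exact: mulr_ge0 (ltW c0)|rewrite ler_pM2l].
Qed.

Lemma hit_pow : exists2 C, 0 < C & forall n t, (0 < n)%N -> (0 < t)%N ->
  (Ex t (fun om s => (has (fun v => n <= size v)%N s)%:R%R) <= (C * t%:R `^ gamma / n%:R)%:E)%E.
Proof.
have [k0 k00 pk0] := @offspring_pos _ _ _ (walk_supercritical (galton_watson_walk := W)).
have [c c0 Hc] := @extp_step_ge _ _ _ (walk_supercritical (galton_watson_walk := W)).
have kap0 : 0 < (1 - beta^-1) / 2 by rewrite divr_gt0 // subr_gt0 invf_lt1.
set kap := (1 - beta^-1) / 2 in kap0.
have B0 : 0 < beta / (1 + beta * k0%:R).
  by rewrite divr_gt0 // ltr_pwDl // mulr_ge0 // ltW.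
set B := beta / _ in B0.
pose A := kap * (B * (p k0 * c)) * r.
have A0 : 0 < A by do 2 apply: mulr_gt0 => //; apply: mulr_gt0 => //; exact: mulr_gt0.
have kg : 0 < kap^-1 `^ gamma by rewrite powR_gt0 // invr_gt0.
(* The summand 1 covers [n = 1], where [n.-1 = 0] and [fast_le] is empty; the factor 2 replaces
   [n.-1] by [n] in the other cases. *)
pose C := 2 * (A^-1 * kap^-1 `^ gamma) + 1.
have AK : 0 < 2 * (A^-1 * kap^-1 `^ gamma) by apply: mulr_gt0 => //; apply: mulr_gt0 => //; rewrite invr_gt0.
exists C => [|n t n0 t0]; first exact: addr_gt0.
have t1 : 1 <= t%:R :> R by rewrite ler1n.
have n0' : 0 < n%:R :> R by rewrite ltr0n.
have tg1 : 1 <= t%:R `^ gamma by rewrite -[leLHS](powRr0 t%:R) ler_powR // ltW.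
set E := Ex t _.
have E1 : (E <= 1)%E.
  apply: (@le_trans _ _ (Ex t (fun _ _ => 1))).
    by apply: Ex_le => [||om s]; [exact: adm_path|exact: adm_cst|case: (has _ _)].
  by rewrite /Ex integral_cst // mul1e; exact: probability_le1.
have E0 : (0 <= E)%E by apply: Ex_ge0; exact: adm_path.
have [e eE] : exists e, E = e%:E by case: (E) E0 E1 => [e _ _|//|//]; exists e.
move: E0 E1; rewrite eE !lee_fin => e0 e1.
rewrite ler_pdivlMr //.
have [n1|n1] := leqP n 1.
  have -> : n = 1%N by apply/eqP; rewrite eqn_leq n1 n0.
  rewrite mulr1; apply: (@le_trans _ _ 1) => //.
  apply: (@le_trans _ _ C); last by rewrite ler_peMr // addr_ge0 // ltW.
  by rewrite lerDr ltW.
have x1 : 1 <= t%:R / kap.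
  rewrite ler_pdivlMr // mul1r (le_trans _ t1) // /kap ler_pdivrMr // mul1r.
  have : 0 < beta^-1 by rewrite invr_gt0.
  by move: (beta^-1) => y; lra.
(* Traps of height [H.+1] are just high enough to hold the walk for [t] steps, while [r^H] is still
   at least [(t / kap)^-gamma]. *)
have [H /andP[h1 h2]] := floor_log beta1 x1.
have tH : t%:R * beta^-1 ^+ H.+1 <= kap.
  by rewrite exprVn ler_pdivrMr ?exprn_gt0 // mulrC -ler_pdivrMr // ltW.
have := fast_le (W := W) n k00 tH; rewrite -/E eE -EFinM lee_fin -/kap -/B.
have rH : (t%:R / kap) `^ (- gamma) <= r ^+ H.
  by rewrite r_pow; apply: powr_le => //; rewrite exprn_gt0.
have st : A * (t%:R / kap) `^ (- gamma) <= kap * (B * (p k0 * (extp p H.+2 - extp p H.+1))).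
  apply: (@le_trans _ _ (A * r ^+ H)); first by rewrite ler_pM2l.
  rewrite (_ : A * r ^+ H = kap * (B * (p k0 * (c * r ^+ H.+1)))); last by rewrite /A exprS; ring.
  by do 3 (apply: ler_wpM2l; first exact: ltW); exact: Hc.
move=> h; have nn : n%:R <= 2 * n.-1%:R :> R.
  by rewrite -natrM ler_nat; case: (n) n1 => [|[|m]] // _; rewrite mul2n -addnn /= addSn ltnS leq_addl.
have : n.-1%:R * (A * (t%:R / kap) `^ (- gamma)) * e <= 1.
  apply: le_trans h; rewrite ler_wpM2r //.
  by rewrite ler_wpM2l.
rewrite powRN powRM ?invr_ge0 ?(ltW kap0) //.
set T := t%:R `^ gamma in tg1 *; set K := kap^-1 `^ gamma in kg *.
have T0 : 0 < T by apply: lt_le_trans tg1.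
rewrite (_ : _ * e = n.-1%:R * e / (A^-1 * (T * K))); last by field; rewrite !gt_eqF.
rewrite ler_pdivrMr ?mulr_gt0 ?invr_gt0 // mul1r => h'.
apply: (@le_trans _ _ (2 * (A^-1 * (T * K)))).
  apply: (@le_trans _ _ (2 * (n.-1%:R * e))); last by rewrite ler_pM2l.
  by rewrite mulrC mulrA ler_wpM2r.
rewrite (_ : C * T = 2 * (A^-1 * (T * K)) + T); last by rewrite /C -/K; ring.
by rewrite lerDl ltW.
Qed.

(** The true decay is exponential up to a polynomial factor; the rate [1 / n] suffices, being
    summable along powers of 2. *)
Lemma returns_pow : exists2 C, 0 < C & forall n N, (0 < n)%N ->
  (Ex N (fun om s => (alive om [::] && returns n s)%:R%R) <= (C / n%:R)%:E)%E.
Proof.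
have bi0 : 0 < beta^-1 by rewrite invr_gt0.
have bi1 : beta^-1 < 1 by rewrite invf_lt1.
have [Ca Ca0 Ha] := natX_expr_bounded r0 r1.
have [Cb Cb0 Hb] := natX_expr_bounded bi0 bi1.
have m0 : 0 <= m1 by exact: mean_ge0.
have c1 : 1 <= C1 (q := q) (beta := beta) by exact: (C1_ge1 (W := W)).
have c0 : 0 < C1 (q := q) (beta := beta) by apply: lt_le_trans c1.
have d0 : 0 < 2 / (beta - 1) by rewrite divr_gt0 // subr_gt0.
exists (m1 * (5 * (Ca * C1 (q := q) (beta := beta))) + 2 / (beta - 1) * Cb) => [|n N n0].
  apply: ltr_wpDl; last exact: mulr_gt0.
  by apply: mulr_ge0 => //; apply: mulr_ge0 => //; apply: mulr_ge0; exact: ltW.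
apply: le_trans (returns_le N n0) _; rewrite lee_fin.
move: (C1 (q := q) (beta := beta)) c0 {c1} => K c0.
have n0' : 0 < n%:R :> R by rewrite ltr0n.
have n1' : 1 <= n%:R :> R by rewrite ler1n.
have gap : q - extp p n <= r ^+ n by exact: extp_gap_le.
have rn0 : 0 < r ^+ n by rewrite exprn_gt0.
have bn0 : 0 < beta^-1 ^+ n by rewrite exprn_gt0.
rewrite ler_pdivlMr // mulrDl; apply: lerD.
  rewrite -!mulrA; apply: ler_wpM2l => //.
  apply: (@le_trans _ _ (r ^+ n * ((5 * n%:R) * (K * n%:R)))).
    apply: ler_pM => //.
    - rewrite subr_ge0; have /andP[] : 0 <= extp p n <= q by exact: extp_bounds.
      by [].
    - by apply: mulr_ge0 => //; apply: mulr_ge0 => //; exact: (ltW c0).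
    rewrite ler_pM2r ?mulr_gt0 // -natr1 natrM.
    by rewrite (_ : 5 = 4%:R + 1) ?mulrDl ?mul1r ?lerD2l //; lra.
  rewrite [leLHS](_ : _ = 5 * ((n%:R ^+ 2 * r ^+ n) * K)); last by ring.
  by rewrite ler_pM2l // ler_pM2r.
move: (2 / (beta - 1)) d0 => D d0; rewrite -mulrA ler_pM2l //; apply: le_trans (Hb n).
by rewrite mulrC ler_pM2r // ler_eXnr.
Qed.

End Walk.

(** * Tightness *)

Lemma ext_bound om h v w : ext om h v -> intree om (v ++ w) -> (size w < h)%N.
Proof.
elim: h v w => [//|h IH] v [//|j w] /= /allP H ij.
have jv : (j < om v)%N.
  have := allP ij (size v); rewrite mem_iota size_cat /= add0n -[X in (X < _)%N]addn0 ltn_add2l => /(_ isT).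
  by rewrite nth_cat ltnn subnn take_size_cat.
rewrite ltnS; apply: (IH (rcons v j)); last by rewrite cat_rcons.
by apply: H; rewrite mem_iota.
Qed.

Lemma ext_witness om h v : intree om v -> ~~ ext om h v ->
  exists2 u, size u = (size v + h)%N & intree om u.
Proof.
elim: h v => [|h IH] v iv; first by move=> _; exists v; rewrite ?addn0.
rewrite /= -has_predC => /hasP[j]; rewrite mem_iota add0n => /andP[_ jv] /= nj.
have [|u su iu] := IH _ _ nj; first by rewrite intree_rcons iv.
by exists u => //; rewrite su size_rcons addSnnS.
Qed.

Lemma in_treeP om u : reflect (in_tree om u) (intree om u).
Proof.
apply: (iffP allP) => [H i iu|H i]; first by apply: H; rewrite mem_iota.
by rewrite mem_iota => /andP[_]; exact: H.
Qed.

Lemma survivesP om : survives om <-> alive om [::].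
Proof.
split=> [H|a h].
  apply/asboolP => h; apply/negP => e; have [u [su /in_treeP iu]] := H h.
  by have := @ext_bound om h [::] u e iu; rewrite su ltnn.
have [//|u su /in_treeP iu] := @ext_witness om h [::] _ (alive_ext h a).
by exists u.
Qed.

Lemma returnsP d (T : measurableType d) (X : T -> nat -> word) w n N :
  reflect (exists i j, [/\ (i <= j <= N)%N, (4 * n <= size (X w i))%N & (size (X w j) < n)%N])
    (returns n (traj X w N)).
Proof.
apply: (iffP hasP) => [[i]|[i [j [/andP[ij jN] iX jX]]]].
  rewrite mem_iota add0n size_traj => /andP[_ iN] /andP[i4 /hasP[x xd xn]].
  have xi : (index x (drop i (traj X w N)) < size (drop i (traj X w N)))%N by rewrite index_mem.
  have jN : (i + index x (drop i (traj X w N)) <= N)%N.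
    by rewrite -ltnS -[N.+1](size_traj (X := X) w) -ltn_subRL -size_drop.
  exists i, (i + index x (drop i (traj X w N)))%N; split.
  - by rewrite leq_addr.
  - by move: i4; rewrite nth_traj.
  - by rewrite -(nth_traj (X := X) w jN) -nth_drop nth_index.
exists i; first by rewrite mem_iota size_traj ltnS (leq_trans ij).
rewrite nth_traj ?(leq_trans ij) // iX; apply/hasP; exists (X w j) => //.
rewrite -(nth_traj (X := X) w jN) -(subnKC ij) -nth_drop; apply: mem_nth.
by rewrite size_drop size_traj ltn_sub2r // ltnS // (leq_trans ij).
Qed.

Lemma ae_eventually_not d (T : measurableType d) (R : realType) (P : {measure set T -> \bar R})
  (F : nat -> set T) : (forall k, measurable (F k)) -> (\sum_(0 <= k <oo) P (F k) < +oo)%E ->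
  {ae P, forall w, \forall k \near \oo, ~ F k w}.
Proof.
move=> mF sF; exists (lim_sup_set F); split.
- apply: bigcap_measurable => // n _; exact: bigcup_measurable.
- exact: lim_sup_set_cvg0.
move=> w /= H n _; apply: contrapT => N; apply: H; exists n => // k /= nk Fk.
by apply: N; exists k.
Qed.

Lemma nneseries_geometric_lty (R : realType) (u : nat -> \bar R) (C a : R) : 0 <= C -> 0 <= a < 1 ->
  (forall k, (0 <= u k)%E) -> (forall k, (u k <= (C * a ^+ k)%:E)%E) -> (\sum_(0 <= k <oo) u k < +oo)%E.
Proof.
move=> C0 /andP[a0 a1] u0 uC.
apply: (@le_lt_trans _ _ (\sum_(0 <= k <oo) (C * a ^+ k)%:E)%E).
  by apply: lee_nneseries => // k _ _; exact: uC.
rewrite eseries_EFin ?ltry //.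
  by move=> k; rewrite mulr_ge0 // exprn_ge0.
by apply: (@is_cvg_geometric_series _ C a); rewrite ger0_norm.
Qed.

Section Walk.
Context {R : realType} {p : nat -> R} {q beta : R} {d : measure_display}
  {Omega : measurableType d} {P : probability Omega R}
  {nu : Omega -> word -> nat} {X : Omega -> nat -> word}.
Context {W : galton_watson_walk p q beta P nu X}.
Local Notation Ex := (Ex P nu X).
Local Notation gamma := (walk_exponent (p := p) (q := q) (beta := beta)).

Let g0 : 0 < gamma. Proof. exact: (walk_exponent_gt0 (W := W)). Qed.
Let g1 : gamma < 1. Proof. exact: (walk_exponent_lt1 (W := W)). Qed.
Lemma powR_gammaK (x : R) : 0 <= x -> (x `^ gamma^-1) `^ gamma = x.
Proof. by move=> x0; rewrite -powRrM mulVf ?gt_eqF // powRr1. Qed.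

Lemma P_alive : P [set w | alive (nu w) [::]] = (1 - q)%:E.
Proof. by have := EE_alive (W := W) [::]; rewrite EE_bool //; exact: measurable_alive. Qed.

Lemma measurable_alive_nu : measurable [set w | alive (nu w) [::]].
Proof. exact: (measurable_preimage_nu (measurable_alive _)). Qed.

Lemma set_survives : [set w | survives (nu w)] = [set w | alive (nu w) [::]].
Proof. by apply/seteqP; split => w /= /survivesP. Qed.

Lemma P_event_le n b (A : set Omega) (c : R) : mb b -> A = [set w | b (nu w) (traj X w n)] ->
  (Ex n (fun om s => (b om s)%:R%R) <= c%:E)%E -> fine (P A) <= c.
Proof.
move=> hb ->; rewrite Ex_bool // => h.
rewrite -lee_fin fineK //; apply: fin_num_measure; exact: measurable_event.
Qed.

Lemma tight_hit (eps : R) : 0 < eps -> exists M : R, forall n : nat, (0 < n)%N ->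
  cprob P [set w | survives (nu w)] [set w | ~ hits_by (X w) n (M * n%:R `^ gamma^-1)] <= eps.
Proof.
move=> e0; have [C C0 HC] := @below_pow _ _ _ _ _ _ _ _ _ W.
have q1 : 0 < 1 - q by rewrite subr_gt0; exact: q_lt1.
(* Chosen so that at time [M n^(1/gamma)] the bound of [below_pow] equals [eps (1 - q)]; the factor
   [1 - q] is the survival probability by which [cprob] divides. *)
pose M := (C / (eps * (1 - q))) `^ gamma^-1; exists M => n n0.
have n0' : 0 < n%:R :> R by rewrite ltr0n.
have M0 : 0 < M by rewrite powR_gt0 // divr_gt0 // mulr_gt0.
have x0 : 0 < M * n%:R `^ gamma^-1 by rewrite mulr_gt0 // powR_gt0.
set x := M * _ in x0 *; pose N := Num.truncn x.
have /andP[xN Nx] : N%:R <= x < N.+1%:R by apply: truncn_itv; exact: ltW.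
rewrite /cprob set_survives P_alive /= ler_pdivrMr //.
apply: (@P_event_le N (fun om s => alive om [::] && all (fun v => size v != n) s)).
- by apply: mb_and; [exact: (mb_alive (fun=> [::]))|exact: mb_path].
- apply/seteqP; split => [w [nh a]|w].
    apply/andP; split; first exact: a.
    apply/allP => v /mapP[i]; rewrite mem_iota add0n ltnS => /andP[_ iN] ->.
    apply/negP => /eqP si; apply: nh; exists i; split => //.
    by apply: le_trans xN; rewrite ler_nat.
  move=> /andP[a /allP h]; split; last exact: a.
  move=> [i [ix si]].
  have iN : (i <= N)%N by rewrite -ltnS -(ltr_nat R) (le_lt_trans ix).
  suff : size (X w i) != n by rewrite si eqxx.
  apply: h.
  by apply: map_f; rewrite mem_iota add0n ltnS iN.
(* A step raises the level by at most one, so a path that avoids level [n] stays below it. *)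
apply: (@le_trans _ _ (Ex N (fun om s => (below n om s)%:R%R))).
  apply: Ex_le_valid => [||om s sN v].
  - by apply: adm_mb; apply: mb_and; [exact: (mb_alive (fun=> [::]))|exact: mb_path].
  - by apply: adm_mb; exact: mb_below.
  rewrite /below; case: (alive om [::]) => //=.
  case: (boolP (all (fun v => size v != n) s)) => // /allP h; rewrite (_ : all _ s = true) //.
  apply/allP => y ys; rewrite ltnNge; apply/negP => ny.
  have yi : (index y s < size s)%N by rewrite index_mem.
  have [|i ij fi] := first_at_exists (l := n) v yi; first by rewrite nth_index.
  have si : (i < size s)%N by exact: leq_ltn_trans ij yi.
  by move: fi; rewrite first_at_take // (negbTE (h _ (mem_nth [::] si))).
apply: le_trans (HC n N) _; rewrite lee_fin.
have : N.+1%:R `^ (- gamma) <= (x `^ gamma)^-1.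
  rewrite powRN lef_pV2 ?posrE ?powR_gt0 //.
  by apply: ge0_ler_powR; rewrite ?nnegrE ?(ltW g0) ?(ltW x0) // ltW.
rewrite /x powRM ?powR_ge0 ?(ltW M0) // !powR_gammaK ?(ltW n0') //; last first.
  by rewrite ltW // divr_gt0 // mulr_gt0.
move=> h; apply: (@le_trans _ _ (C * n%:R * (C / (eps * (1 - q)) * n%:R)^-1)).
  by rewrite ler_pM2l // mulr_gt0.
rewrite le_eqVlt; apply/orP; left; apply/eqP; field.
by rewrite !gt_eqF // mulr_gt0.
Qed.

Lemma tight_height (eps : R) : 0 < eps -> exists M : R, forall n : nat, (0 < n)%N ->
  cprob P [set w | survives (nu w)] [set w | M * n%:R `^ gamma < (size (X w n))%:R] <= eps.
Proof.
move=> e0; have [C C0 HC] := @hit_pow _ _ _ _ _ _ _ _ _ W.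
have q1 : 0 < 1 - q by rewrite subr_gt0; exact: q_lt1.
pose M := C / (eps * (1 - q)); exists M => n n0.
have n0' : 0 < n%:R :> R by rewrite ltr0n.
have M0 : 0 < M by rewrite divr_gt0 // mulr_gt0.
have x0 : 0 < M * n%:R `^ gamma by rewrite mulr_gt0 // powR_gt0.
set x := M * _ in x0 *; pose m := Num.truncn x.
have /andP[mx xm] : m%:R <= x < m.+1%:R by apply: truncn_itv; exact: ltW.
rewrite /cprob set_survives P_alive /= ler_pdivrMr //.
apply: (@P_event_le n (fun om s => alive om [::] && (m < size (last [::] s))%N)).
- by apply: mb_and; [exact: (mb_alive (fun=> [::]))|exact: (mb_path (fun s => (m < size (last [::] s))%N))].
- apply/seteqP; split => [w [h a]|w /andP[a]].
    apply/andP; split; first exact: a.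
    by rewrite last_traj -(ltr_nat R); apply: le_lt_trans mx h.
  rewrite last_traj => h; split; last exact: a.
  by rewrite /mkset (lt_le_trans xm) // ler_nat.
apply: (@le_trans _ _ (Ex n (fun om s => (has (fun v => m.+1 <= size v)%N s)%:R%R))).
  apply: Ex_le_valid => [||om s sN v].
  - apply: adm_mb; apply: mb_and; first exact: (mb_alive (fun=> [::])).
    exact: (mb_path (fun s => (m < size (last [::] s))%N)).
  - exact: adm_path.
  case: (boolP (_ && _)) => // /andP[_ h]; rewrite (_ : has _ _ = true) //.
  by apply/hasP; exists (last [::] s) => //; case: (s) sN => // y s' _; rewrite /= mem_last.
apply: le_trans (HC m.+1 n (ltn0Sn m) n0) _; rewrite lee_fin.
rewrite ler_pdivrMr ?ltr0n // (@le_trans _ _ (eps * (1 - q) * x)) //; last first.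
  by rewrite ler_pM2l ?mulr_gt0 // ltW.
rewrite /x /M mulrA le_eqVlt; apply/orP; left; apply/eqP; congr (_ * _); field.
by rewrite !gt_eqF // mulr_gt0.
Qed.

End Walk.

(** * Almost sure growth *)

Lemma exponent_bounds (R : realFieldType) (g t : R) : 0 < g -> g < 1 -> 0 < t -> t <= 2^-1 ->
  g - t <= g / (1 + t) /\ g / (1 - t) <= g + 2 * t.
Proof.
move=> g0 g1 t0 t1; have gt : g * t <= t by rewrite ler_piMl // ltW.
have tt : 0 < t * t by rewrite mulr_gt0.
have tt2 : t * t <= 2^-1 * t by rewrite ler_pM2r.
by split; [rewrite ler_pdivlMr; lra|rewrite ler_pdivrMr; nra].
Qed.

Section Walk.
Context {R : realType} {p : nat -> R} {q beta : R} {d : measure_display}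
  {Omega : measurableType d} {P : probability Omega R}
  {nu : Omega -> word -> nat} {X : Omega -> nat -> word}.
Context {W : galton_watson_walk p q beta P nu X}.
Local Notation Ex := (Ex P nu X).
Local Notation gamma := (walk_exponent (p := p) (q := q) (beta := beta)).

Let g0 : 0 < gamma. Proof. exact: (walk_exponent_gt0 (W := W)). Qed.
Let g1 : gamma < 1. Proof. exact: (walk_exponent_lt1 (W := W)). Qed.

Section Growth.
Variable theta : R.
Hypotheses (theta0 : 0 < theta) (theta1 : theta < 1).

Let y (k : nat) : R := 2 ^+ k.
Let y1 k : 1 <= y k. Proof. by rewrite /y exprn_ege1 // ler1n. Qed.
Let y0 k : 0 < y k. Proof. by rewrite /y exprn_gt0. Qed.
Let a := (2 : R) `^ (- theta).
Let a01 : 0 <= a < 1.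
Proof.
rewrite powR_ge0 /= /a /powR gt_eqF // -[X in _ < X]expR0 ltr_expR mulNr oppr_lt0 mulr_gt0 //.
by apply: ln_gt0; rewrite ltr1n.
Qed.
Let ak k : a ^+ k = y k `^ (- theta).
Proof. by rewrite -powR_mulrn ?powR_ge0 // -powRrM mulrC powRrM powR_mulrn. Qed.
Let yk k : ((2 ^ k)%N)%:R = y k :> R. Proof. exact: natrX. Qed.

(** Eventually level [2^k] is reached by time [slow k] on survival, but not by time [fast k]. The
    margin [theta] in the exponents makes both failure probabilities of order [2^(- theta k)], hence
    summable. *)
Let slow k := Num.truncn (y k `^ (gamma^-1 * (1 + theta))).
Let fast k := Num.truncn (y k `^ (gamma^-1 * (1 - theta))).

Let bad_slow k := [set w | below (2 ^ k) (nu w) (traj X w (slow k))].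
Let bad_fast k := [set w | has (fun v => 2 ^ k <= size v)%N (traj X w (fast k))].
(** A return may occur at any later time; the events increase with [N], and [returns_pow] is uniform
    in [N]. *)
Let bad_back k := \bigcup_N [set w | alive (nu w) [::] && returns (2 ^ k) (traj X w N)].

Let ae_slow : {ae P, forall w, \forall k \near \oo, ~ bad_slow k w}.
Proof.
have [C C0 HC] := @below_pow _ _ _ _ _ _ _ _ _ W.
apply: ae_eventually_not.
  by move=> k; exact: (measurable_event (slow k) (mb_below (2 ^ k))).
apply: (nneseries_geometric_lty (ltW C0) a01) => [k|k]; first exact: measure_ge0.
have := HC (2 ^ k)%N (slow k); rewrite Ex_bool; last exact: mb_below.
move=> /le_trans; apply; rewrite lee_fin -mulrA ler_pM2l // yk ak.
have z0 : 0 < y k `^ (gamma^-1 * (1 + theta)) by rewrite powR_gt0.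
have /andP[_ h] := truncn_itv (ltW z0).
apply: (@le_trans _ _ (y k * ((y k `^ (gamma^-1 * (1 + theta))) `^ gamma)^-1)).
  rewrite ler_pM2l // powRN lef_pV2 ?posrE ?powR_gt0 //.
  by apply: ge0_ler_powR; rewrite ?nnegrE ?(ltW g0) ?(ltW z0) // ltW.
rewrite -powRrM -powRN -[X in X * _](powRr1 (ltW (y0 k))) -powRD; last by rewrite (gt_eqF (y0 k)) implybT.
apply: ler_powR => //.
by rewrite (_ : gamma^-1 * (1 + theta) * gamma = 1 + theta); [lra|field; rewrite gt_eqF].
Qed.

Let ae_fast : {ae P, forall w, \forall k \near \oo, ~ bad_fast k w}.
Proof.
have [C C0 HC] := @hit_pow _ _ _ _ _ _ _ _ _ W.
have mb_f k : mb (fun om s => has (fun v => 2 ^ k <= size v)%N s) by exact: mb_path.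
apply: ae_eventually_not.
  by move=> k; exact: (measurable_event (fast k) (mb_f k)).
apply: (nneseries_geometric_lty (ltW C0) a01) => [k|k]; first exact: measure_ge0.
have e0 : 0 <= gamma^-1 * (1 - theta) by rewrite mulr_ge0 ?invr_ge0 ?(ltW g0) // subr_ge0 ltW.
have z1 : 1 <= y k `^ (gamma^-1 * (1 - theta)).
  by rewrite -[leLHS](powRr0 (y k)) ler_powR.
have /andP[h _] := truncn_itv (le_trans ler01 z1).
have t0 : (0 < fast k)%N by rewrite truncn_gt0.
have := HC (2 ^ k)%N (fast k) (expn_gt0 2 k) t0.
rewrite (Ex_bool (fast k) (mb_f k)).
move=> /le_trans; apply; rewrite lee_fin -mulrA ler_pM2l // yk ak.
apply: (@le_trans _ _ ((y k `^ (gamma^-1 * (1 - theta))) `^ gamma / y k)).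
  rewrite ler_pM2r ?invr_gt0 //.
  by apply: ge0_ler_powR; rewrite ?nnegrE ?(ltW g0) // (le_trans ler01).
rewrite -powRrM -(powR_inv1 (ltW (y0 k))) -powRD; last by rewrite (gt_eqF (y0 k)) implybT.
apply: ler_powR => //.
by rewrite (_ : gamma^-1 * (1 - theta) * gamma = 1 - theta); [lra|field; rewrite gt_eqF].
Qed.

Let ae_back : {ae P, forall w, \forall k \near \oo, ~ bad_back k w}.
Proof.
have [C C0 HC] := @returns_pow _ _ _ _ _ _ _ _ _ W.
have mb_r k : mb (fun om s => alive om [::] && returns (2 ^ k) s).
  by apply: mb_and; [exact: (mb_alive (fun=> [::]))|exact: mb_path].
have mr k N : measurable [set w | alive (nu w) [::] && returns (2 ^ k) (traj X w N)].
  exact: (measurable_event N (mb_r k)).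
have h01 : 0 <= (2^-1 : R) < 1 by lra.
apply: ae_eventually_not => [k|]; first exact: bigcupT_measurable.
apply: (nneseries_geometric_lty (ltW C0) h01) => [k|k]; first exact: measure_ge0.
have mono : {homo (fun N => [set w | alive (nu w) [::] && returns (2 ^ k) (traj X w N)]) : n m / (n <= m)%N >-> (n <= m)%O}.
  move=> n m nm; apply/subsetPset => w /andP[al /returnsP[i [j [/andP[ij jn] h1 h2]]]].
  apply/andP; split => //; apply/returnsP; exists i, j; split => //.
  by rewrite ij (leq_trans jn).
have cv := nondecreasing_cvg_mu (mu := P) (mr k) (bigcupT_measurable _ (mr k)) mono.
rewrite /bad_back -(cvg_lim _ cv) //; apply: lime_le; first by apply/cvg_ex; eexists; exact: cv.
apply: nearW => N /=; have := HC (2 ^ k)%N N (expn_gt0 2 k).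
rewrite (Ex_bool N (mb_r k)) yk => h.
by rewrite exprVn.
Qed.

(** Interpolation between powers of 2. If [x = j^(gamma / (1 + theta))] lies between [2^(k+2)] and
    [2^(k+3)], then level [2^(k+2)] has been reached and the walk has not come back below [2^k],
    whence the factor 8. In the upper bound no return has to be excluded, and rounding costs a
    factor 2. *)
Lemma growth : {ae P, forall w, alive (nu w) [::] -> \forall j \near \oo,
  j%:R `^ (gamma / (1 + theta)) <= 8 * (size (X w j))%:R /\
  (size (X w j))%:R <= 2 * j%:R `^ (gamma / (1 - theta))}.
Proof.
have p1 : 0 < 1 + theta by rewrite addr_gt0.
have p2 : 0 < 1 - theta by rewrite subr_gt0.
move: ae_slow ae_fast ae_back; apply: filterS3 => w n1 n2 n3 al.
have [K _ HK] : \forall k \near \oo, [/\ ~ bad_slow k w, ~ bad_fast k w & ~ bad_back k w].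
  by move: n1 n2 n3; apply: filterS3.
pose z := y K.+2 `^ (gamma^-1 * (1 + theta)).
have z0 : 0 < z by rewrite powR_gt0.
have expK (x e : R) : 0 <= x -> 0 < e -> (x `^ (gamma / e)) `^ (gamma^-1 * e) = x.
  move=> x0 e0; rewrite -powRrM (_ : _ * _ = 1) ?powRr1 //.
  by field; rewrite !gt_eqF.
have expK' (x e : R) : 0 <= x -> 0 < e -> (x `^ (gamma^-1 * e)) `^ (gamma / e) = x.
  move=> x0 e0; rewrite -powRrM (_ : _ * _ = 1) ?powRr1 //.
  by field; rewrite !gt_eqF.
exists (Num.truncn z).+1 => // j /= zj.
have jz : z <= j%:R.
  have /andP[_ h] := truncn_itv (ltW z0).
  by rewrite (le_trans (ltW h)) // ler_nat.
have j1 : 1 <= j%:R :> R by rewrite ler1n; apply: leq_trans zj.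
have j0 : 0 <= j%:R :> R by [].
have big x e : 0 < e -> e <= 1 + theta -> x = j%:R `^ (gamma / e) -> y K.+2 <= x.
  move=> e0 ee ->; rewrite -[leLHS](expK' _ (1 + theta)) ?(ltW (y0 _)) //.
  apply: (@le_trans _ _ (j%:R `^ (gamma / (1 + theta)))).
    by apply: ge0_ler_powR; rewrite ?nnegrE ?(ltW z0) // divr_ge0 ?(ltW g0) // ltW.
  by apply: ler_powR => //; rewrite ler_pM2l // lef_pV2 ?posrE.
have level x : y K.+2 <= x -> exists2 k, (K <= k)%N & y k.+2 <= x < y k.+2.+1.
  move=> xK; have [H /andP[h1 h2]] := floor_log (ltr1n R 2) (le_trans (y1 _) xK).
  have : y K.+2 < y H.+1 := le_lt_trans xK h2.
  rewrite /y ltr_eXn2l ?ltr1n // ltnS => KH.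
  have H2 : (2 <= H)%N by exact: leq_trans KH.
  exists (H - 2)%N; first by rewrite leq_subRL // add2n.
  by rewrite -[(H - 2).+2]addn2 subnK // /y h1.
split.
  set x := _ `^ _; have xE : x = j%:R `^ (gamma / (1 + theta)) by [].
  have [k Kk /andP[k1 k2]] := level x (big x _ p1 (lexx _) xE).
  have [ns _ _] := HK k.+2 (leqW (leqW Kk)); have [_ _ nb] := HK k Kk.
  have sj : (slow k.+2 <= j)%N.
    have zz : 0 <= y k.+2 `^ (gamma^-1 * (1 + theta)) by exact: powR_ge0.
    have /andP[h _] := truncn_itv zz.
    rewrite -(ler_nat R) (le_trans h) // -[leRHS](expK _ (1 + theta)) //.
    apply: ge0_ler_powR; rewrite ?nnegrE ?(ltW (y0 _)) ?powR_ge0 //.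
    by rewrite mulr_ge0 ?invr_ge0 // ltW.
  have [i iN si] : exists2 i, (i <= slow k.+2)%N & (2 ^ k.+2 <= size (X w i))%N.
    apply: contrapT => nex; apply: ns; apply/andP; split => //.
    apply/allP => v /mapP[i]; rewrite mem_iota add0n ltnS => /andP[_ iN] ->.
    by rewrite ltnNge; apply/negP => h; apply: nex; exists i.
  have sX : (2 ^ k <= size (X w j))%N.
    rewrite leqNgt; apply/negP => h; apply: nb; exists j => //.
    apply/andP; split => //; apply/returnsP; exists i, j; split => //.
      by rewrite leqnn andbT (leq_trans iN).
    by move: si; rewrite !expnS mulnA.
  apply: (le_trans (ltW k2)); rewrite /y !exprS !mulrA (_ : 2 * 2 * 2 = 8 :> R); last by ring.
  by rewrite ler_pM2l // -/(y k) -yk ler_nat.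
set x := _ `^ _; have xE : x = j%:R `^ (gamma / (1 - theta)) by [].
have e12 : 1 - theta <= 1 + theta by rewrite lerD2l; exact: (ge0_cp (ltW theta0)).2.
have [k Kk /andP[k1 k2]] := level x (big x _ p2 e12 xE).
have [_ nf _] := HK k.+3 (leqW (leqW (leqW Kk))).
have jf : (j <= fast k.+3)%N.
  have zz : 0 <= y k.+3 `^ (gamma^-1 * (1 - theta)) by exact: powR_ge0.
  have /andP[_ h] := truncn_itv zz.
  rewrite -ltnS -(ltr_nat R); apply: le_lt_trans h; rewrite -[leLHS](expK _ (1 - theta)) //.
  apply: ge0_ler_powR; rewrite ?nnegrE ?(ltW (y0 _)) ?powR_ge0 ?(ltW k2) //.
  by rewrite mulr_ge0 ?invr_ge0 // ltW.
have sX : (size (X w j) < 2 ^ k.+3)%N.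
  rewrite ltnNge; apply/negP => h; apply: nf; apply/hasP; exists (X w j) => //.
  by apply: map_f; rewrite mem_iota add0n ltnS.
apply: (@le_trans _ _ (y k.+3)); first by rewrite -yk ler_nat ltnW.
by rewrite /y exprS ler_pM2l.
Qed.

End Growth.

Let u w (n : nat) : R := ln (size (X w n))%:R / ln n%:R.

Lemma measurable_cvg_height : measurable [set w | u w @ \oo --> gamma].
Proof.
have -> : [set w | u w @ \oo --> gamma] =
    \bigcap_m \bigcup_K \bigcap_(n in [set n | (K <= n)%N]) [set w | `|gamma - u w n| <= m.+1%:R^-1].
  apply/seteqP; split => w /=.
    move=> /cvgrPdist_le h m _; have [|K _ HK] := h m.+1%:R^-1; first by rewrite invr_gt0.
    by exists K.
  move=> h; apply/cvgrPdist_le => e e0.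
  have [K _ HK] := h (Num.truncn e^-1) I; exists K => // n Kn.
  apply: le_trans (HK n Kn) _; rewrite -[leRHS]invrK lef_pV2 ?posrE ?invr_gt0 //.
  by have /andP[_ /ltW] : (Num.truncn e^-1)%:R <= e^-1 < (Num.truncn e^-1).+1%:R by apply: truncn_itv; rewrite invr_ge0 ltW.
apply: bigcap_measurable => // m _; apply: bigcupT_measurable => K.
apply: bigcap_measurable => [|n _]; first by exists K => /=.
apply: (@measurable_count_set _ _ _ (fun w => X w n) (fun v => [set w | `|gamma - ln (size v)%:R / ln n%:R| <= m.+1%:R^-1])).
  exact: measurable_walk.
move=> v; have [h|h] := boolP (`|gamma - ln (size v)%:R / ln n%:R| <= m.+1%:R^-1).
  by rewrite (_ : [set _ | _] = setT) //; apply/seteqP; split.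
by rewrite (_ : [set _ | _] = set0) //; apply/seteqP; split.
Qed.

Lemma height_cvg : {ae P, forall w, alive (nu w) [::] -> u w @ \oo --> gamma}.
Proof.
(* Countably many margins, so that one almost sure event serves for all of them. *)
pose th m : R := m.+2%:R^-1.
have th0 m : 0 < th m by rewrite invr_gt0.
have th2 m : th m <= 2^-1 by rewrite lef_pV2 ?posrE // ler_nat.
have th1 m : th m < 1 by apply: le_lt_trans (th2 m) _; lra.
have := ae_foralln (fun m => growth (th0 m) (th1 m)).
apply: filterS => w H al; apply/cvgrPdist_le => e e0.
pose m := Num.truncn (4 / e).
have hm : th m <= e / 4.
  have x0 : 0 <= 4 / e by rewrite divr_ge0 // ltW.
  have /andP[_ h] := truncn_itv x0.
  rewrite -[leRHS]invrK lef_pV2 ?posrE ?invr_gt0 ?divr_gt0 // invf_div (le_trans (ltW h)) //.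
  by rewrite ler_nat.
have Hm := H m al; move: (th m) (th0 m) (th1 m) (th2 m) hm Hm => t t0 t1 t2 hm Hm.
near=> j.
have [lo up] : j%:R `^ (gamma / (1 + t)) <= 8 * (size (X w j))%:R /\
  (size (X w j))%:R <= 2 * j%:R `^ (gamma / (1 - t)) by near: j.
(* Beyond this [j] the constants 8 and 2 contribute at most [e / 2] after division by [ln j]. The
   margin contributes at most [2 t <= e / 2]. *)
have jbig : expR (2 * ln 8 / e + 1) <= j%:R by near: j; exact: nbhs_infty_ger.
have l80 : 0 <= ln 8 :> R by rewrite ln_ge0 // ler1n.
have j0 : 0 < j%:R :> R by apply: lt_le_trans jbig; exact: expR_gt0.
have L : 2 * ln 8 / e + 1 <= ln j%:R by rewrite -ler_expR lnK.
have L0 : 0 < ln (j%:R : R).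
  by apply: lt_le_trans L; rewrite ltr_wpDl // divr_ge0 ?mulr_ge0 // ltW.
have L8 : ln 8 <= e / 2 * ln (j%:R : R).
  apply: (@le_trans _ _ (e / 2 * (2 * ln 8 / e))).
    by rewrite le_eqVlt; apply/orP; left; apply/eqP; field; rewrite gt_eqF.
  by rewrite ler_pM2l ?divr_gt0 // (le_trans _ L) // lerDl.
have s0 : 0 < (size (X w j))%:R :> R.
  have : 0 < j%:R `^ (gamma / (1 + t)) :> R by rewrite powR_gt0.
  by move=> /lt_le_trans/(_ lo); rewrite pmulr_rgt0.
have lo' : gamma / (1 + t) * ln j%:R <= ln 8 + ln (size (X w j))%:R.
  by rewrite -lnM ?posrE // -ln_powR ler_ln ?posrE ?powR_gt0 // mulr_gt0.
have up' : ln (size (X w j))%:R <= ln 2 + gamma / (1 - t) * ln j%:R.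
  by rewrite -ln_powR -lnM ?posrE ?powR_gt0 // ler_ln ?posrE // mulr_gt0 // powR_gt0.
have l28 : ln 2 <= ln 8 :> R by rewrite ler_ln ?posrE // ler_nat.
have [A1 A2] := exponent_bounds g0 g1 t0 t2.
rewrite /u; move: (ln (size _)%:R) lo' up' => s lo' up'; move: (ln j%:R) L0 L8 lo' up' {L} => l L0 L8 lo' up'.
have B1 : (gamma - t) * l <= gamma / (1 + t) * l by rewrite ler_pM2r.
have B2 : gamma / (1 - t) * l <= (gamma + 2 * t) * l by rewrite ler_pM2r.
have B3 : t * l <= e / 4 * l by rewrite ler_pM2r.
rewrite distrC ler_distl; move: (gamma / _) (gamma / _) lo' up' B1 B2 {A1 A2} => c2 c1.
move: (gamma) (ln 2) (ln 8) L8 l28 => g n2 n8 L8 l28 lo' up' B1 B2.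
by apply/andP; split; [rewrite ler_pdivlMr // | rewrite ler_pdivrMr //]; lra.
Unshelve. all: by end_near.
Qed.

End Walk.

(** * Convergence under the conditional law and conclusion *)

Section Walk.
Context {R : realType} {p : nat -> R} {q beta : R} {d : measure_display}
  {Omega : measurableType d} {P : probability Omega R}
  {nu : Omega -> word -> nat} {X : Omega -> nat -> word}.
Context {W : galton_watson_walk p q beta P nu X}.

Lemma cprob_height_cvg : cprob P [set w | survives (nu w)]
  [set w | (fun n : nat => ln (size (X w n))%:R / ln n%:R) @ \oo --> walk_exponent (p := p) (q := q) (beta := beta)] = 1.
Proof.
set A := [set w | _ @ \oo --> _]; rewrite /cprob set_survives; set S := [set w | _].
have mS : measurable S by exact: measurable_alive_nu.
have mA : measurable A by exact: measurable_cvg_height.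
have PS : P S = (1 - q)%:E by exact: P_alive.
have -> : P (A `&` S) = P S.
  apply/eqP; rewrite eq_le le_measure ?inE //=; last exact: measurableI.
  have [N [mN PN HN]] := @height_cvg _ _ _ _ _ _ _ _ _ W.
  apply: (@le_trans _ _ (P ((A `&` S) `|` N))).
    apply: le_measure; rewrite ?inE //; first by apply: measurableU => //; exact: measurableI.
    move=> w Sw; have [Aw|nA] := pselect (A w); first by left.
    by right; apply: HN => /= /(_ Sw).
  have PN0 : P N = 0%E by exact: PN.
  have : (P ((A `&` S) `|` N) <= P (A `&` S) + P N)%E by apply: measureU2 => //; exact: measurableI.
  by rewrite PN0 adde0.
by rewrite PS divff //= gt_eqF // subr_gt0; exact: q_lt1.
Qed.

End Walk.

Theorem theorem1 (R : realType) (p : nat -> R) (q beta : R)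
  (d : measure_display) (Omega : measurableType d) (P : probability Omega R)
  (nu : Omega -> seq nat -> nat) (X : Omega -> nat -> seq nat) :
  (* offspring distribution *)
  (forall k, 0 <= p k) ->
  series p @ \oo --> (1 : R) ->
  0 < p 0%N ->
  cvg (series (fun k => k%:R * p k) @ \oo) ->
  1 < limn (series (fun k => k%:R * p k)) ->
  cvg (series (fun k => (k ^ 2)%:R * p k) @ \oo) ->
  (* q is the extinction probability: smallest fixed point of f in [0,1] *)
  0 <= q <= 1 -> gf p q = q ->
  (forall s, 0 <= s <= 1 -> gf p s = s -> q <= s) ->
  (* bias *)
  (gf' p q)^-1 < beta ->
  (* measurability of the basic random variables *)
  (forall u k, measurable [set w | nu w u = k]) ->
  (forall i v, measurable [set w | X w i = v]) ->
  (* joint law: offspring numbers nu(u), u a word, i.i.d. with law p (so the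
     tree is Galton-Watson), and given the tree X is the biased walk from 0 *)
  (forall (n : nat) (x : nat -> seq nat) (s : seq (seq nat)) (kk : seq nat -> nat),
     uniq s -> (forall i, (i < n)%N -> x i \in s) ->
     P [set w | (forall u, u \in s -> nu w u = kk u) /\
                (forall i, (i <= n)%N -> X w i = x i)]
     = ((\prod_(u <- s) p (kk u)) * (x 0%N == [::])%:R *
        \prod_(i < n) trans beta (kk (x i)) (x i) (x i.+1))%:E) ->
  let gamma := - ln (gf' p q) / ln beta in
  let S := [set w | survives (nu w)] in
  (* (i) tightness of Delta_n / n^(1/gamma) under P( . | survival) *)
  (forall eps : R, 0 < eps -> exists M : R, forall n : nat, (0 < n)%N ->
     cprob P S [set w | ~ hits_by (X w) n (M * n%:R `^ gamma^-1)] <= eps) /\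
  (* (ii) tightness of |X_n| / n^gamma *)
  (forall eps : R, 0 < eps -> exists M : R, forall n : nat, (0 < n)%N ->
     cprob P S [set w | M * n%:R `^ gamma < (size (X w n))%:R] <= eps) /\
  (* (iii) ln|X_n| / ln n -> gamma almost surely *)
  cprob P S [set w | (fun n : nat => ln (size (X w n))%:R / ln n%:R) @ \oo --> gamma] = 1.
Proof.
move=> p_ge0 p_sum p0_gt0 cvg_mean mean_gt1 cvg_sqr q01 q_fix q_min beta_gt m_nu m_X law gamma S.
have W : galton_watson_walk p q beta P nu X by split => //; split.
split; first exact: (tight_hit (W := W)).
by split; [exact: (tight_height (W := W))|exact: (cprob_height_cvg (W := W))].
Qed.
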